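(* Let $H\in(0,1)$ and $0<T<\infty$, and let $Y^{(1)}_t=\int_0^t e^{-s}\,dB^H_{a_s}$ with $a_t=He^{t/H}$, where $B^H$ is a fractional Brownian motion with Hurst parameter $H$. Suppose that $u=\{u_t,\ t\in[0,T]\}$ is a stochastic process that is Hölder continuous of order $\beta$ with $\beta>1-H$, and set $$Z_t=\int_0^t u_s\,dY^{(1)}_s,\qquad t\in[0,T].$$ Then, as $n\to\infty$, $$n^{2H-1}V_n(Z)_t\longrightarrow\int_0^t|u_s|^2\,ds$$ almost surely and uniformly in $t\in[0,T]$.
   Context: A fractional Brownian motion $B^H=\{B^H_t,\ t\ge 0\}$ with Hurst parameter $H\in(0,1)$ is a zero-mean Gaussian process with covariance $E[B^H_sB^H_t]=\frac12\left(s^{2H}+t^{2H}-|t-s|^{2H}\right)$, taken with continuous paths (they are $(H-\varepsilon)$-Hölder continuous on every finite interval for every $\varepsilon\in(0,H)$). With $a_t=He^{t/H}$, the process $Y^{(1)}_t=\int_0^t e^{-s}\,dB^H_{a_s}$ is defined pathwise as a Riemann-Stieltjes integral (via integration by parts); its paths are Hölder continuous of order $H-\varepsilon$ for every $\varepsilon\in(0,H)$. Hölder continuity of a stochastic process refers to its paths on $[0,T]$. Since $\beta>1-H$, the integral $\int_0^t u_s\,dY^{(1)}_s$ is a pathwise Riemann-Stieltjes (Young) integral. For a stochastic process $Z=\{Z_t\}$ and an integer $n\ge 1$, the realized quadratic variation is $$V_n(Z)_t=\sum_{i=1}^{[nt]}\left|Z_{\frac in}-Z_{\frac{i-1}n}\right|^2,$$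 where $[nt]$ is the largest integer that is at most $nt$. *)

(* Defs.v *)
From HB Require Import structures.
From mathcomp Require Import all_boot all_order all_algebra.
From mathcomp Require Import all_classical all_reals all_analysis.

Set Implicit Arguments.
Unset Strict Implicit.
Unset Printing Implicit Defensive.

Import Order.TTheory GRing.Theory Num.Theory.
Import numFieldNormedType.Exports.

Local Open Scope classical_set_scope.
Local Open Scope ring_scope.

Section riemann_stieltjes.
Context {R : realType}.
Implicit Types (f g : R -> R) (a b : R) (s : seq R) (xi : nat -> R).

(* The partition a = x_0 < x_1 < ... < x_k = b is encoded, as in
   [itv_partition a b s], by the list s = [:: x_1; ...; x_k]: hence
   x_i is [nth b (a :: s) i] and x_(i+1) is [nth b s i]. *)
Definition stieltjes_sum f g a b s xi : R :=
  \sum_(0 <= i < size s)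
    f (xi i) * (g (nth b s i) - g (nth b (a :: s) i)).

Definition mesh_lt a b s (delta : R) : Prop :=
  forall i, (i < size s)%N -> nth b s i - nth b (a :: s) i < delta.

Definition tagged_by a b s xi : Prop :=
  forall i, (i < size s)%N -> nth b (a :: s) i <= xi i <= nth b s i.

Definition is_stieltjes f g a b (l : R) : Prop :=
  forall e : R, 0 < e -> exists2 delta : R, 0 < delta &
    forall s xi, itv_partition a b s -> mesh_lt a b s delta ->
      tagged_by a b s xi -> `|stieltjes_sum f g a b s xi - l| < e.

(* The Riemann-Stieltjes integral of f with respect to g over [a, b], for
   a <= b; it takes the default value 0 when the integral does not exist. *)
Definition stieltjes f g a b : R := xget 0 [set l | is_stieltjes f g a b l].

Definition holder_on (beta : R) (D : set R) f : Prop :=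
  exists C : R, forall x y, D x -> D y -> `|f x - f y| <= C * `|x - y| `^ beta.

End riemann_stieltjes.

Section processes.
Context {R : realType} {d : measure_display} {Omega : measurableType d}.
Variable P : probability Omega R.
Implicit Types (X : R -> Omega -> R) (I : set R).

(* A process with index set I; the values of X outside I are irrelevant. *)
Definition stochastic_process I X : Prop :=
  forall t, I t -> measurable_fun [set: Omega] (X t).

(* Constants are Gaussian: the case sigma = 0 is treated apart because
   [normal_prob m 0] is not a point mass in the library. *)
Definition gaussian_law (mu : set R -> \bar R) : Prop :=
  exists m sigma : R, 0 <= sigma /\
    forall A : set R, measurable A ->
      mu A = if sigma == 0 then \d_m A else normal_prob m sigma A.

Definition gaussian_process I X : Prop :=
  stochastic_process I X /\
  forall (k : nat) (t c : 'I_k -> R), (forall i, I (t i)) ->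
    gaussian_law (pushforward P (fun w => \sum_(i < k) c i * X (t i) w)).

Definition fractional_brownian_motion (H : R) (B : R -> Omega -> R) : Prop :=
  [/\ gaussian_process `[0, +oo[ B,
      forall t, 0 <= t -> ('E_P[B t] = 0)%E,
      forall s t, 0 <= s -> 0 <= t ->
        ('E_P[B s \* B t] =
        (2^-1 * (s `^ (2 * H) + t `^ (2 * H) - `|t - s| `^ (2 * H)))%R%:E)%E
    & \forall w \ae P, {within `[0, +oo[, continuous (fun t => B t w)}].

Definition time_change (H t : R) : R := H * expR (t / H).

Definition Y1 (H : R) (B : R -> Omega -> R) (t : R) (w : Omega) : R :=
  stieltjes (fun s => expR (- s)) (fun s => B (time_change H s) w) 0 t.

End processes.

Definition realized_variation {R : realType} (z : R -> R) (n : nat) (t : R) : R :=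
  \sum_(1 <= i < (Num.truncn (n%:R * t)).+1)
    `|z (i%:R / n%:R) - z (i.-1%:R / n%:R)| ^+ 2.

(* Main.v *)
(* Write W_s = B_{a_s}. Young's estimate, applied to both integrals, gives
   Z_{(i+1)/n} - Z_{i/n} = u_{i/n} e^{-i/n} (W_{(i+1)/n} - W_{i/n}) + O(n^{-theta})
   with theta close to H + beta > 1, so the quadratic variation of Z is, up to a
   uniformly small error, a weighted sum of the squares of the variables
   X_i = e^{-i/n} (W_{(i+1)/n} - W_{i/n}). Since beta may be replaced by a smaller
   order, it remains to see that the partial sums of n^{2H-1} X_i^2 - 1/n tend to 0
   uniformly; freezing the continuous weight u^2 on blocks, these sums then turn
   into a Riemann sum of u^2.

   The X_i are centred Gaussian variables with the common variance
   (H (e^{1/(nH)} - 1))^{2H} ~ n^{-2H}. The increments of fractional Brownian motion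
   have covariances of constant sign off the diagonal, so the absolute row sums of
   their covariance matrix telescope and are O(n^{-min(1,2H)}). Gaussian integration
   by parts turns this bound into a bound on all even moments of
   sum_i (X_i^2 - E X_i^2), which is summable in n when the moment is high enough.
   The Hoelder continuity of the paths of B follows in the same way from its
   moments, by dyadic chaining. *)
Require Import Defs.
From HB Require Import structures.
From mathcomp Require Import all_boot all_order all_algebra.
From mathcomp Require Import all_classical all_reals all_analysis.
From mathcomp Require Import measurable_realfun ring lra zify.
Import Order.TTheory GRing.Theory Num.Theory.
Import numFieldNormedType.Exports.
Local Open Scope classical_set_scope.
Local Open Scope ring_scope.

Set Implicit Arguments.
Unset Strict Implicit.
Unset Printing Implicit Defensive.


(** * Young integration *)

(** [stieltjes] returns 0 when no integral exists, so nothing about [Z] can be read off its formula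
    before the Riemann-Stieltjes sums are known to converge; a single local estimate of increments
    supplies both this convergence and the error of each step. Two inequalities shape the orders:
    alpha + beta > 1 for the Young integral, and 2 alpha + beta > 2H, because about n errors, each
    of size n^(2H-1) n^(-alpha) n^(-(alpha+beta)), must add up to o(1). Uniformity in t concerns
    about T n partial sums. Summing a high moment over all of them takes the place of a maximal
    inequality; a second moment would decay only like n^(-kappa) with kappa = min(1, 2 - 2H), which
    is too slow for this sum. The Gaussian calculus starts from moment generating functions: the
    definition of a Gaussian process gives the law of every finite linear combination, and moments
    of polynomials are recovered by differentiating E exp(L a) in the direction of a second
    vector. *)

Definition young_const {R : realType} (theta : R) : R := 2 / (1 - 2 `^ (1 - theta)).

Lemma two_powR_lt1 {R : realType} (theta : R) : 1 < theta -> 2 `^ (1 - theta) < 1 :> R.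
Proof.
move=> t1; rewrite /powR pnatr_eq0 /= -[ltRHS]expR0 ltr_expR.
by rewrite pmulr_llt0 ?ln_gt0 ?ltr1n// subr_lt0.
Qed.

Lemma young_const_ge0 {R : realType} (theta : R) : 1 < theta -> 0 <= young_const theta.
Proof. by move=> t1; rewrite divr_ge0// subr_ge0 ltW// two_powR_lt1. Qed.

(** The bookkeeping of one bisection in [young_sum_le]: each half contributes the constant times
    2^(-theta), and the two correction products contribute 1 each. *)
Lemma young_constE {R : realType} (theta : R) : 1 < theta ->
  2 * young_const theta * 2^-1 `^ theta + 2 = young_const theta.
Proof.
move=> t1; have h := two_powR_lt1 t1.
have -> : 2 * young_const theta * 2^-1 `^ theta = young_const theta * 2 `^ (1 - theta).
  rewrite powRB ?pnatr_eq0 ?implybT// powRr1// -powR_inv1// -powRrM mulN1r powRN.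
  by ring.
rewrite /young_const; field.
by rewrite subr_eq0 gt_eqF.
Qed.

Lemma exists_crossing {R : realType} (x : nat -> R) (c : R) (p q : nat) :
  (p < q)%N -> x p <= c -> c <= x q ->
  exists2 j, (p <= j < q)%N & x j <= c <= x j.+1.
Proof.
elim: q => // q IH; rewrite ltnS => pq xpc cxq.
have [cxq'|xqc] := leP c (x q); last first.
  by exists q; [rewrite pq leqnn | rewrite (ltW xqc)].
move: pq; rewrite leq_eqVlt => /predU1P[pq|pq].
  by exists q; [rewrite -pq !leqnn | rewrite cxq andbT -pq].
have [j /andP[pj jq] h] := IH pq xpc cxq'.
by exists j => //; rewrite pj ltnS ltnW.
Qed.

(** [holder_on] with its constant exposed, because the estimates below carry it along. *)
Definition holder_with {R : realType} (C beta : R) (D : set R) (f : R -> R) : Prop :=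
  forall x y, D x -> D y -> `|f x - f y| <= C * `|x - y| `^ beta.

(* Splitting at the first partition interval that meets the midpoint halves the
   length of both remaining pieces; since theta > 1 this beats the doubling of
   their number, and young_const is the fixed point of the resulting recursion. *)
Lemma young_sum_le {R : realType} (alpha beta Cf Cg : R) (D : set R)
    (f g : R -> R) (x : nat -> R) (p q : nat) :
  0 < alpha -> 0 < beta -> 1 < alpha + beta -> 0 <= Cf -> 0 <= Cg ->
  holder_with Cf beta D f -> holder_with Cg alpha D g ->
  {homo x : i j / (i <= j)%N >-> i <= j} -> (forall i, D (x i)) -> (p <= q)%N ->
  `|\sum_(p <= i < q) f (x i) * (g (x i.+1) - g (x i))
    - f (x p) * (g (x q) - g (x p))|
  <= young_const (alpha + beta) * Cf * Cg * (x q - x p) `^ (alpha + beta).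
Proof.
move=> a0 b0 ab Cf0 Cg0 hf hg xmon xD.
have := young_const_ge0 ab; have := young_constE ab.
move: (young_const (alpha + beta)) => K KE K0.
have [m] := ubnP (q - p); elim: m p q => // m IH p q qpm pq.
move: pq; rewrite leq_eqVlt => /predU1P[->|pq].
  rewrite big_geq// !subrr mulr0 subrr normr0.
  by rewrite !mulr_ge0// powR_ge0.
set l := x q - x p; set c := (x p + x q) / 2.
have xpq : x p <= x q by apply: xmon; exact: ltnW.
have l0 : 0 <= l by rewrite subr_ge0.
have [||j /andP[pj jq] /andP[xjc cxj]] := @exists_crossing _ x c p q pq.
  by rewrite /c; lra.
  by rewrite /c; lra.
have xpj : x p <= x j by exact: xmon.
have xjq : x j.+1 <= x q by exact: xmon.
have xjj : x j <= x j.+1 by exact: xmon.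
have half a b : 0 <= b - a -> b - a <= l / 2 ->
    K * Cf * Cg * (b - a) `^ (alpha + beta) <=
    K * Cf * Cg * l `^ (alpha + beta) * 2^-1 `^ (alpha + beta).
  move=> ab0 abl; rewrite -[leRHS]mulrA ler_wpM2l ?mulr_ge0//.
  rewrite -powRM ?invr_ge0//; apply: ge0_ler_powR => //.
  - by rewrite addr_ge0// ltW.
  - by rewrite nnegrE divr_ge0.
have IHl : `|\sum_(p <= i < j) f (x i) * (g (x i.+1) - g (x i))
    - f (x p) * (g (x j) - g (x p))| <=
    K * Cf * Cg * l `^ (alpha + beta) * 2^-1 `^ (alpha + beta).
  apply: (le_trans (IH p j _ pj)).
    by rewrite (leq_trans _ (_ : q - p <= m)%N)// ltn_sub2r.
  by apply: half; rewrite /l; move: xjc; rewrite /c; lra.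
have IHr : `|\sum_(j.+1 <= i < q) f (x i) * (g (x i.+1) - g (x i))
    - f (x j.+1) * (g (x q) - g (x j.+1))| <=
    K * Cf * Cg * l `^ (alpha + beta) * 2^-1 `^ (alpha + beta).
  apply: (le_trans (IH j.+1 q _ jq)).
    by rewrite (leq_trans _ (_ : q - p <= m)%N)// ltn_sub2l// ltnS.
  by apply: half; rewrite /l; move: cxj; rewrite /c; lra.
have prod a b c' d : x p <= a -> a <= x q -> x p <= b -> b <= x q ->
    x p <= c' -> c' <= x q -> x p <= d -> d <= x q ->
    D a -> D b -> D c' -> D d ->
    `|(f a - f b) * (g c' - g d)| <= Cf * Cg * l `^ (alpha + beta).
  move=> *; rewrite normrM (addrC alpha) powRD; last first.
    by apply/implyP => /eqP; lra.
  rewrite mulrACA ler_pM//.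
    apply: (le_trans (hf _ _ _ _)) => //; rewrite ler_wpM2l// ge0_ler_powR ?nnegrE ?(ltW a0) ?(ltW b0)//.
    by rewrite ler_norml /l; lra.
  apply: (le_trans (hg _ _ _ _)) => //; rewrite ler_wpM2l// ge0_ler_powR ?nnegrE ?(ltW a0) ?(ltW b0)//.
  by rewrite ler_norml /l; lra.
have h1 : `|(f (x j) - f (x p)) * (g (x j.+1) - g (x j))| <= Cf * Cg * l `^ (alpha + beta).
  by apply: prod => //; lra.
have h2 : `|(f (x j.+1) - f (x p)) * (g (x q) - g (x j.+1))| <= Cf * Cg * l `^ (alpha + beta).
  by apply: prod => //; lra.
rewrite (@big_cat_nat _ _ _ j)//=; last exact: ltnW.
rewrite [\sum_(j <= i < q) _]big_ltn//.
set SL := \sum_(p <= i < j) _ in IHl *; set SR := \sum_(j.+1 <= i < q) _ in IHr *.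
(* The interval that straddles the midpoint comes with the value [f (x j)] and the right piece with
   [f (x j.+1)]; replacing both by [f (x p)] costs exactly the products bounded in [h1] and [h2]. *)
have -> : SL + (f (x j) * (g (x j.+1) - g (x j)) + SR) - f (x p) * (g (x q) - g (x p)) =
  (SL - f (x p) * (g (x j) - g (x p))) +
  (SR - f (x j.+1) * (g (x q) - g (x j.+1))) +
  ((f (x j) - f (x p)) * (g (x j.+1) - g (x j)) +
   (f (x j.+1) - f (x p)) * (g (x q) - g (x j.+1))) by ring.
apply: (le_trans (ler_normD _ _)); apply: (le_trans (lerD (ler_normD _ _) (ler_normD _ _))).
apply: (le_trans (lerD (lerD IHl IHr) (lerD h1 h2))).
rewrite -[X in _ <= X * _ * _ * _]KE.
by rewrite le_eqVlt; apply/orP; left; apply/eqP; ring.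
Qed.

Lemma powR_natN_cvg0 {R : realType} (k : R) : 0 < k ->
  (n%:R `^ (- k)) @[n --> \oo] --> (0 : R).
Proof.
move=> k0; apply/cvgr0Pnorm_lt => e e0.
near=> n.
have n0 : (0 : R) < n%:R by rewrite ltr0n; near: n; exact: nbhs_infty_gt.
rewrite ger0_norm ?powR_ge0// powRN -[ltRHS]invrK ltf_pV2 ?posrE ?invr_gt0 ?powR_gt0//.
have -> : e^-1 = (e^-1 `^ k^-1) `^ k.
  by rewrite -powRrM mulVf ?gt_eqF// powRr1// invr_ge0 ltW.
apply: gt0_ltr_powR; rewrite ?nnegrE ?powR_ge0 ?ltW//.
by near: n; exact: nbhs_infty_gtr.
Unshelve. all: by end_near. Qed.

Lemma ultra_fmap (S V : Type) (f : S -> V) (F : set_system S) :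
  UltraFilter F -> UltraFilter (f @ F).
Proof.
move=> UF; split; first exact: fmap_proper_filter.
move=> G GF FG; apply/seteqP; split => // A GA.
have [//|FnA] := in_ultra_setVsetC (f @^-1` A) UF.
have GnA : G (~` A) by exact: FG.
by have /filter_ex [? []] : G (A `&` ~` A) by exact: filterI.
Qed.

(** Compactness of a segment in its ultrafilter form. One ultrafilter serves all sequences at once,
    so limits for all times t can be taken simultaneously without extracting subsequences. *)
Lemma bounded_ultra_cvg {R : realType} (U : set_system nat) (a : nat -> R) (M : R) :
  UltraFilter U -> (forall n, `|a n| <= M) -> exists l : R, a @ U --> l.
Proof.
move=> UU aM.
have := @segment_compact R (- M) M; rewrite compact_ultra => /(_ (a @ U) (ultra_fmap a UU)).
case.
- by apply: (@filterS _ U _ setT) => [n _ /=|]; [rewrite in_itv/= -ler_norml|exact: filterT].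
- by move=> l [_ ?]; exists l.
Qed.

(** Turns the difference of two sums stopped at t and at s into one sum over the grid clamped to
    [s, t]. *)
Lemma clamp_increment {R : realType} (g : R -> R) (a s t : R) : s <= t ->
  g (Num.min a t) - g (Num.min a s) = g (Num.max s (Num.min a t)) - g s.
Proof.
move=> st; have [as_|sa] := leP a s.
  by rewrite (min_idPl (le_trans as_ st)) (max_idPl as_) !subrr.
by rewrite (max_idPr _)// le_min st ltW.
Qed.

Section young_integral.
Context {R : realType} (alpha beta Cf Cg T : R) (f g : R -> R).
Hypotheses (T0 : 0 < T) (a0 : 0 < alpha) (b0 : 0 < beta) (ab : 1 < alpha + beta).
Hypotheses (Cf0 : 0 <= Cf) (Cg0 : 0 <= Cg).
Hypotheses (hf : holder_with Cf beta `[0, T] f) (hg : holder_with Cg alpha `[0, T] g).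

Let K := young_const (alpha + beta) * Cf * Cg.
Let h (n : nat) : R := T / n.+1%:R.
Let x (n i : nat) : R := h n * i%:R.
(** Left-point sum of f dg on the uniform grid of [0, T], stopped at t. Stopping with [Num.min] lets
    one grid serve every t, so that increments in t can be compared. *)
Let J (n : nat) (t : R) : R :=
  \sum_(0 <= i < n.+1) f (x n i) * (g (Num.min (x n i.+1) t) - g (Num.min (x n i) t)).

Let h_gt0 n : 0 < h n. Proof. by rewrite divr_gt0. Qed.

Let holder_product (a b c d l : R) : 0 <= l ->
  0 <= a <= T -> 0 <= b <= T -> 0 <= c <= T -> 0 <= d <= T ->
  `|a - b| <= l -> `|c - d| <= l ->
  `|(f a - f b) * (g c - g d)| <= Cf * Cg * l `^ (alpha + beta).
Proof.
move=> l0 aT bT cT dT abl cdl; rewrite normrM (addrC alpha) powRD; last first.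
  by rewrite gt_eqF ?addr_gt0.
rewrite mulrACA ler_pM//.
  apply: (le_trans (hf _ _)); rewrite /= ?in_itv//.
  by rewrite ler_wpM2l// ge0_ler_powR ?nnegrE ?(ltW b0).
apply: (le_trans (hg _ _)); rewrite /= ?in_itv//.
by rewrite ler_wpM2l// ge0_ler_powR ?nnegrE ?(ltW a0).
Qed.

(** The points [c i], the grid clamped to [s, t], fall under [young_sum_le]. In [J], however, f is
    evaluated at [x n i] instead of [c i]; each of the n + 1 cells pays at most [h n] to the power
    alpha + beta for this, which gives the second error term. It vanishes as n grows since alpha +
    beta > 1. *)
Let J_increment n (s t : R) : 0 <= s -> s <= t -> t <= T ->
  `|J n t - J n s - f s * (g t - g s)| <=
  K * (t - s) `^ (alpha + beta) + Cf * Cg * (n.+1%:R * h n `^ (alpha + beta)).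
Proof.
move=> s0 st tT.
pose c i := Num.max s (Num.min (x n i) t).
have xS i : x n i.+1 = x n i + h n by rewrite /x -natr1 mulrDr mulr1.
have xmon : {homo x n : i j / (i <= j)%N >-> i <= j}.
  by move=> i j ij; rewrite /x ler_pM2l// ler_nat.
have x0 : x n 0 = 0 by rewrite /x mulr0.
have xe : x n n.+1 = T by rewrite /x /h divfK// pnatr_eq0.
have c_st i : s <= c i <= t by rewrite /c le_max lexx/= ge_max st ge_min lexx orbT.
have cmon : {homo c : i j / (i <= j)%N >-> i <= j}.
  by move=> i j ij; rewrite /c le_max2// le_min2// xmon.
have c0 : c 0 = s by rewrite /c x0 (max_idPl _)// ge_min s0.
have ce : c n.+1 = t by rewrite /c xe (min_idPr tT) (max_idPr st).
have -> : J n t - J n s = \sum_(0 <= i < n.+1) f (x n i) * (g (c i.+1) - g (c i)).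
  rewrite /J -sumrB; apply: eq_bigr => i _; rewrite -mulrBr; congr (_ * _).
  have := clamp_increment g (x n i.+1) st; have := clamp_increment g (x n i) st.
  rewrite -/(c i) -/(c i.+1) => e1 e2; lra.
have -> : \sum_(0 <= i < n.+1) f (x n i) * (g (c i.+1) - g (c i)) - f s * (g t - g s) =
   (\sum_(0 <= i < n.+1) f (c i) * (g (c i.+1) - g (c i)) - f (c 0) * (g (c n.+1) - g (c 0)))
   + \sum_(0 <= i < n.+1) (f (x n i) - f (c i)) * (g (c i.+1) - g (c i)).
  rewrite c0 ce addrAC -big_split/=; congr (_ - _); apply: eq_bigr => i _; ring.
apply: (le_trans (ler_normD _ _)); apply: lerD.
  rewrite -[in leRHS]c0 -[in leRHS]ce.
  apply: (@young_sum_le _ _ _ _ _ `[0, T]) => // i /=.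
  by rewrite in_itv/=; have := c_st i; lra.
apply: (le_trans (ler_norm_sum _ _ _)).
apply: (@le_trans _ _ (\sum_(0 <= i < n.+1) Cf * Cg * h n `^ (alpha + beta))); last first.
  by rewrite sumr_const_nat subn0 -[leLHS]mulr_natl [leRHS]mulrCA.
apply: ler_sum_nat => i /andP[_ iN].
have hn := h_gt0 n.
have xi0 : 0 <= x n i by rewrite /x mulr_ge0// ltW.
have xiT : x n i.+1 <= T by rewrite -xe; exact: xmon.
have := c_st i; have := c_st i.+1; have := xS i => xSi csi1 csi.
(* A cell to the left of s, or in the next case to the right of t, is clamped to a single point and
   contributes nothing. *)
have [xs|sx] := leP (x n i.+1) s.
  have -> : c i = s by apply/max_idPl; rewrite ge_min; apply/orP; left; lra.
  have -> : c i.+1 = s by apply/max_idPl; rewrite ge_min xs.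
  by rewrite subrr mulr0 normr0; apply: mulr_ge0; rewrite ?powR_ge0 ?mulr_ge0.
have [tx|] := boolP (t <= x n i); last rewrite -ltNge => xt.
  have -> : c i = t by rewrite /c (min_idPr tx) (max_idPr st).
  have -> : c i.+1 = t by rewrite /c (min_idPr _) ?(max_idPr st)//; lra.
  by rewrite subrr mulr0 normr0; apply: mulr_ge0; rewrite ?powR_ge0 ?mulr_ge0.
have cE : c i = Num.max s (x n i) by rewrite /c (min_idPl (ltW xt)).
have cE1 : c i.+1 <= x n i.+1 by rewrite /c ge_max (ltW sx) ge_min lexx.
have cE2 : x n i <= c i by rewrite cE le_max lexx orbT.
have cE3 : c i <= x n i.+1 by rewrite cE ge_max (ltW sx)/= xSi lerDl ltW.
have cE4 := cmon _ _ (leqnSn i).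
apply: holder_product; rewrite ?ler_norml; lra.
Qed.

(** [I] is the limit of [J] along one ultrafilter finer than the filter at infinity. [J_increment]
    bounds each sequence, so the limits exist, and its inequality passes to the limit with the grid
    error gone. This takes the place of a comparison between different grids. *)
Lemma young_integral_exists : exists2 I : R -> R, I 0 = 0 &
  forall s t : R, 0 <= s -> s <= t -> t <= T ->
    `|I t - I s - f s * (g t - g s)| <= K * (t - s) `^ (alpha + beta).
Proof.
have K0 : 0 <= K by do 2!apply: mulr_ge0 => //; exact: young_const_ge0.
have [U [UU infU]] := ultraFilterLemma (_ : ProperFilter \oo).
pose e n := Cf * Cg * (n.+1%:R * h n `^ (alpha + beta)).
have ecvg : e @ \oo --> 0.
  pose k := alpha + beta - 1.
  have k0 : 0 < k by rewrite subr_gt0.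
  have -> : e = (fun n => (Cf * Cg * T `^ (alpha + beta)) * n.+1%:R `^ (- k)).
    apply/funext => n; rewrite /e /h powRM ?invr_ge0// ?(ltW T0)//.
    have -> : - k = 1 - (alpha + beta) by rewrite /k; ring.
    rewrite powRB ?pnatr_eq0 ?implybT// powRr1// -powR_inv1// -powRrM mulN1r powRN.
    by ring.
  rewrite -[X in _ --> X](mulr0 (Cf * Cg * T `^ (alpha + beta))).
  apply: cvgM; first exact: cvg_cst.
  by have := powR_natN_cvg0 k0; rewrite -cvg_shiftS.
have J0 n : J n 0 = 0.
  rewrite /J big1_seq// => i _.
  have x0 j : 0 <= x n j by rewrite /x mulr_ge0// ltW.
  by rewrite !(min_idPr _)// subrr mulr0.
have Jb (t : R) : 0 <= t <= T -> exists M, forall n, `|J n t| <= M.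
  move=> /andP[t0 tT].
  have /cvg_seq_bounded [M [_ /(_ (M + 1))]] := cvgP _ ecvg.
  rewrite ltrDl => /(_ ltr01) eM.
  exists (K * (t - 0) `^ (alpha + beta) + (M + 1) + `|f 0 * (g t - g 0)|) => n.
  have := J_increment n (lexx 0) t0 tT; rewrite J0 subr0 => Jn.
  have := eM n I => /= /ler_normlW en.
  rewrite -lerBlDr; apply: (le_trans (lerB_dist _ _)).
  by apply: (le_trans Jn); rewrite lerD2l.
have Jl (t : R) : exists l : R, 0 <= t <= T -> J ^~ t @ U --> l.
  have [tT|tT] := boolP (0 <= t <= T); last by exists 0.
  have [M /(bounded_ultra_cvg UU)[l Hl]] := Jb t tT.
  by exists l.
have [I HI] := choice Jl.
exists I.
  have /HI : 0 <= (0 : R) <= T by rewrite lexx ltW.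
  have -> : J ^~ 0 = fun=> 0 by apply/funext => n; exact: J0.
  by move=> /cvg_unique; apply => //; exact: cvg_cst.
move=> s t s0 st tT.
have It : J ^~ t @ U --> I t by apply: HI; lra.
have Is : J ^~ s @ U --> I s by apply: HI; lra.
have eU : e @ U --> 0 by move=> A /ecvg; exact: infU.
have c1 : (fun n => `|J n t - J n s - f s * (g t - g s)|) @ U -->
    `|I t - I s - f s * (g t - g s)|.
  by apply: cvg_norm; apply: cvgB; [exact: cvgB|exact: cvg_cst].
have c2 : (fun n => K * (t - s) `^ (alpha + beta) + e n) @ U -->
    K * (t - s) `^ (alpha + beta) + 0.
  by apply: cvgD => //; exact: cvg_cst.
rewrite -[leRHS]addr0; apply: (ler_cvg_to c1 c2).
by apply: (@filterS _ U _ setT) => [n _ /=|]; [exact: J_increment|exact: filterT].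
Qed.
End young_integral.

(** * Existence and uniqueness of the Riemann-Stieltjes integral *)

Lemma exists_fine_partition {R : realType} (b delta : R) : 0 <= b -> 0 < delta ->
  exists2 s, itv_partition 0 b s & mesh_lt 0 b s delta.
Proof.
rewrite le_eqVlt => /predU1P[<- _|b0 d0].
  by exists [::] => //; split => /=.
pose n := (Num.truncn (b / delta)).+1.
have nb : b / n%:R < delta.
  by rewrite ltr_pdivrMr ?ltr0n// mulrC -ltr_pdivrMr// truncnS_gt.
pose s := mkseq (fun i => b / n%:R * i.+1%:R) n.
have E i : (i <= n)%N -> nth b (0 :: s) i = b / n%:R * i%:R.
  by case: i => [|i] ile /=; rewrite ?mulr0// nth_mkseq.
have step i : (i < n)%N -> nth b s i - nth b (0 :: s) i = b / n%:R.
  by move=> ilt; rewrite E 1?ltnW// nth_mkseq// -natr1; ring.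
exists s; last by move=> i; rewrite size_mkseq => ilt; rewrite step.
split.
  apply/(pathP b) => i; rewrite size_mkseq => ilt.
  by rewrite -subr_gt0 step// divr_gt0// ltr0n.
rewrite (last_nth b) size_mkseq E// divfK// pnatr_eq0.
by [].
Qed.

(** Both candidates are compared on a common partition, tagged at left endpoints. Since a partition
    of small mesh exists, the condition in [is_stieltjes] is never vacuous. *)
Lemma is_stieltjes_unique {R : realType} (f g : R -> R) (b l l' : R) : 0 <= b ->
  is_stieltjes f g 0 b l -> is_stieltjes f g 0 b l' -> l = l'.
Proof.
move=> b0 hl hl'; apply/eqP; rewrite -subr_eq0 -normr_le0; apply/ler_addgt0Pl => e e0.
rewrite addr0.
have e2 : 0 < e / 2 by rewrite divr_gt0.
have [d d0 hd] := hl _ e2; have [d' d'0 hd'] := hl' _ e2.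
have [|s ps ms] := exists_fine_partition b0 (_ : 0 < Num.min d d').
  by rewrite lt_min d0.
pose xi i := nth b (0 :: s) i.
have txi : tagged_by 0 b s xi.
  move=> i ilt; rewrite lexx/=; case: ps => /(pathP b) /(_ _ ilt) + _.
  exact: ltW.
have m1 : mesh_lt 0 b s d by move=> i /ms; rewrite lt_min => /andP[].
have m2 : mesh_lt 0 b s d' by move=> i /ms; rewrite lt_min => /andP[].
have := hd _ _ ps m1 txi; have := hd' _ _ ps m2 txi.
rewrite !ltr_norml ler_norml; lra.
Qed.

Lemma stieltjes_eq {R : realType} (f g : R -> R) (b l : R) : 0 <= b ->
  is_stieltjes f g 0 b l -> stieltjes f g 0 b = l.
Proof.
move=> b0 hl; apply: (is_stieltjes_unique (f := f) (g := g) b0) => //.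
by rewrite /stieltjes; case: xgetP => [x -> //|/(_ l)].
Qed.

(** The increments of [I] telescope, and on each cell they differ from the tagged term by at most (K
    + Cf Cg) times the length to the power 1 + k with k = alpha + beta - 1 > 0. The factor of order
    k is made small by the mesh; what remains adds up to the total length. *)
Lemma is_stieltjes_of_local_estimate {R : realType} (alpha beta Cf Cg T K : R)
    (f g I : R -> R) :
  0 < alpha -> 0 < beta -> 1 < alpha + beta -> 0 <= Cf -> 0 <= Cg -> 0 <= K ->
  holder_with Cf beta `[0, T] f -> holder_with Cg alpha `[0, T] g -> I 0 = 0 ->
  (forall s t : R, 0 <= s -> s <= t -> t <= T ->
    `|I t - I s - f s * (g t - g s)| <= K * (t - s) `^ (alpha + beta)) ->
  forall t, 0 <= t <= T -> is_stieltjes f g 0 t (I t).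
Proof.
move=> a0 b0 ab Cf0 Cg0 K0 hf hg I0 HI t /andP[t0 tT] e e0.
pose k := alpha + beta - 1.
have k0 : 0 < k by rewrite subr_gt0.
pose M := (K + Cf * Cg) * T.
have KC0 : 0 <= K + Cf * Cg by rewrite addr_ge0// mulr_ge0.
have T0 : 0 <= T by exact: le_trans tT.
have M0 : 0 <= M by rewrite mulr_ge0.
(* The mesh below is chosen so that its k-th power is at most [e']; the [+ 1] covers [M = 0] and
   makes the final bound [M * e' < e] strict. *)
pose e' := e / (M + 1).
have e'0 : 0 < e' by rewrite divr_gt0// ltr_wpDl.
exists (e' `^ k^-1); first exact: powR_gt0.
move=> s xi ps ms txi.
pose x i := nth t (0 :: s) i.
have xlt i : (i < size s)%N -> x i < x i.+1.
  by case: ps => /(pathP t) + _ => /[apply].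
have xend : x (size s) = t by rewrite /x -last_nth; case: ps => _ /eqP.
have xge i : (i <= size s)%N -> 0 <= x i by move=> il; exact: itv_partition_nth_ge ps.
have xle i : (i <= size s)%N -> x i <= t by move=> il; exact: itv_partition_nth_le ps.
have -> : I t = \sum_(0 <= i < size s) (I (x i.+1) - I (x i)).
  by rewrite telescope_sumr// xend /x /= I0 subr0.
rewrite /stieltjes_sum -sumrB.
apply: (le_lt_trans (ler_norm_sum _ _ _)).
apply: (@le_lt_trans _ _ (\sum_(0 <= i < size s) (K + Cf * Cg) * e' * (x i.+1 - x i))).
  apply: ler_sum_nat => i /andP[_ il].
  have xi0 := xge i (ltnW il); have xiS := xle i.+1 il; have xii := ltW (xlt i il).
  have d0 : 0 <= x i.+1 - x i by rewrite subr_ge0.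
  have [tl tr] : x i <= xi i /\ xi i <= x i.+1 by have /andP[] := txi _ il.
  have dk : (x i.+1 - x i) `^ (alpha + beta) <= e' * (x i.+1 - x i).
    have -> : alpha + beta = k + 1 by rewrite /k subrK.
    rewrite powRD; last by rewrite gt_eqF// addr_gt0.
    rewrite powRr1// ler_wpM2r//.
    rewrite -[leRHS](@powRr1 _ e') ?(ltW e'0)// -(mulVf (lt0r_neq0 k0)) powRrM.
    apply: ge0_ler_powR; rewrite ?nnegrE ?powR_ge0 ?(ltW k0)//.
    by rewrite ltW//; exact: ms.
  have fx : `|(f (xi i) - f (x i)) * (g (x i.+1) - g (x i))| <=
      Cf * Cg * (x i.+1 - x i) `^ (alpha + beta).
    rewrite normrM (addrC alpha) powRD; last by rewrite gt_eqF ?addr_gt0.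
    rewrite mulrACA ler_pM//.
      apply: (le_trans (hf _ _ _ _)); rewrite /= ?in_itv/=; [lra|lra|].
      rewrite ler_wpM2l// ge0_ler_powR ?nnegrE ?(ltW b0)//.
      by rewrite ger0_norm; lra.
    apply: (le_trans (hg _ _ _ _)); rewrite /= ?in_itv/=; [lra|lra|].
    by rewrite ger0_norm.
  have Ix := HI _ _ xi0 xii (le_trans xiS tT).
  have -> : f (xi i) * (g (x i.+1) - g (x i)) - (I (x i.+1) - I (x i)) =
     (f (xi i) - f (x i)) * (g (x i.+1) - g (x i))
     - (I (x i.+1) - I (x i) - f (x i) * (g (x i.+1) - g (x i))) by ring.
  apply: (le_trans (ler_normB _ _)); apply: (le_trans (lerD fx Ix)).
  rewrite -mulrDl (addrC (Cf * Cg)) -mulrA ler_wpM2l//.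
rewrite -mulr_sumr telescope_sumr// xend /x /= subr0.
have : (K + Cf * Cg) * e' * t <= M * e'.
  by rewrite mulrAC /M ler_wpM2r ?(ltW e'0)// ler_wpM2l.
move/le_lt_trans; apply.
by rewrite /e' mulrA ltr_pdivrMr ?ltr_wpDl// mulrDr mulr1 mulrC ltrDl.
Qed.

(** The only access to [stieltjes] in what follows: both the inner integral [Y] and the outer
    integral [Z] are handled through this estimate. *)
Lemma stieltjes_local_estimate {R : realType} (alpha beta Cf Cg T : R) (f g : R -> R) :
  0 < T -> 0 < alpha -> 0 < beta -> 1 < alpha + beta -> 0 <= Cf -> 0 <= Cg ->
  holder_with Cf beta `[0, T] f -> holder_with Cg alpha `[0, T] g ->
  forall s t : R, 0 <= s -> s <= t -> t <= T ->
    `|stieltjes f g 0 t - stieltjes f g 0 s - f s * (g t - g s)| <=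
      young_const (alpha + beta) * Cf * Cg * (t - s) `^ (alpha + beta).
Proof.
move=> T0 a0 b0 ab Cf0 Cg0 hf hg s t s0 st tT.
have [I I0 HI] := young_integral_exists T0 a0 b0 ab Cf0 Cg0 hf hg.
have IE r : 0 <= r <= T -> stieltjes f g 0 r = I r.
  move=> rT; apply: stieltjes_eq; first by case/andP: rT.
  apply: (is_stieltjes_of_local_estimate a0 b0 ab Cf0 Cg0 _ hf hg I0 HI) => //.
  by do 2!apply: mulr_ge0 => //; exact: young_const_ge0.
by rewrite !IE; [exact: HI|lra|lra].
Qed.

(** * Dyadic chaining *)

Lemma exists_dyadic_scale {R : realType} (d : R) : 0 < d -> d <= 1 ->
  exists n, 2^-1 ^+ n.+1 < d <= 2^-1 ^+ n.
Proof.
move=> d0 d1.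
have ex : exists n, 2^-1 ^+ n < d.
  exists (Num.truncn d^-1).+1; rewrite exprVn -[ltRHS]invrK ltf_pV2 ?posrE ?invr_gt0 ?exprn_gt0//.
  apply: (lt_le_trans (truncnS_gt _)).
  by rewrite -natrX ler_nat ltnW// ltn_expl.
case: (ex_minnP ex) => -[|n] hn hmin.
  by move: hn; rewrite expr0 ltNge d1.
exists n; rewrite hn/= leNgt; apply/negP => /hmin.
by rewrite ltnn.
Qed.

Section dyadic_chaining.
Context {R : realType} (alpha M : R) (g : R -> R).
Hypotheses (a0 : 0 < alpha) (M0 : 0 <= M).
Hypothesis cg : {within `[0, 1], continuous g}.
Hypothesis hM : forall n k, (k < 2 ^ n)%N ->
  `|g (k.+1%:R / (2 ^ n)%:R) - g (k%:R / (2 ^ n)%:R)| <= M * (2 `^ (- alpha)) ^+ n.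

Let q : R := 2 `^ (- alpha).
(** The sum of q^j over j >= 1, that is, the total length of a chain through all finer levels. *)
Let c : R := q / (1 - q).
Let fl (t : R) n := Num.truncn (t * (2 ^ n)%:R).
Let tn (t : R) n : R := (fl t n)%:R / (2 ^ n)%:R.

Let q0 : 0 < q. Proof. exact: powR_gt0. Qed.
Let q1 : q < 1.
Proof. by rewrite /q /powR pnatr_eq0/= -[ltRHS]expR0 ltr_expR pmulr_llt0 ?ln_gt0 ?ltr1n// oppr_lt0. Qed.
Let c0 : 0 <= c. Proof. by apply: divr_ge0; rewrite ?subr_ge0; exact: ltW. Qed.

Let p2 n : 0 < (2 ^ n)%:R :> R. Proof. by rewrite ltr0n expn_gt0. Qed.

Let fl_bounds t n : 0 <= t -> (fl t n)%:R <= t * (2 ^ n)%:R < (fl t n)%:R + 1.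
Proof.
move=> t0; rewrite natr1; apply: truncn_itv.
by rewrite mulr_ge0// ler0n.
Qed.

Let adjacent n j k : (j <= k)%N -> (k <= j.+1)%N -> (k <= 2 ^ n)%N ->
  `|g (k%:R / (2 ^ n)%:R) - g (j%:R / (2 ^ n)%:R)| <= M * q ^+ n.
Proof.
move=> jk kj kn; move: jk; rewrite leq_eqVlt => /predU1P[->|jk].
  by rewrite subrr normr0 mulr_ge0// exprn_ge0// ltW.
have -> : k = j.+1 by apply/eqP; rewrite eqn_leq kj.
by apply: hM; exact: leq_trans kn.
Qed.

(** [fl t n.+1] is either [2 * fl t n] or its successor, so refining the level keeps the dyadic
    point or moves it by one step of the finer grid. *)
Let tn_step t n : 0 <= t <= 1 -> `|g (tn t n.+1) - g (tn t n)| <= M * q ^+ n.+1.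
Proof.
move=> /andP[t0 t1].
have /andP[b1 b2] := fl_bounds n t0; have /andP[b3 b4] := fl_bounds n.+1 t0.
have -> : tn t n = (2 * fl t n)%:R / (2 ^ n.+1)%:R.
  by rewrite /tn expnS !natrM -mulf_div divff ?pnatr_eq0// mul1r.
rewrite expnS natrM mulrCA in b3 b4.
apply: adjacent.
- by rewrite -ltnS -(ltr_nat R) natrM -natr1; lra.
- by rewrite -ltnS -(ltr_nat R) -!natr1 natrM; lra.
- rewrite -(ler_nat R) expnS natrM (le_trans b3)//.
  by rewrite ler_wpM2l// ler_piMl// ltW.
Qed.

(** A geometric sum in closed form: [c * (q ^+ m - q ^+ m.+1)] equals [q ^+ m.+1], the bound for a
    single step, which closes the induction. *)
Let tn_cauchy t n j : 0 <= t <= 1 ->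
  `|g (tn t (n + j)%N) - g (tn t n)| <= M * c * (q ^+ n - q ^+ (n + j)).
Proof.
move=> t01; elim: j => [|j IH]; first by rewrite addn0 !subrr normr0 mulr0.
rewrite addnS -(subrKA (g (tn t (n + j)))).
apply: (le_trans (ler_normD _ _)).
apply: (le_trans (lerD (tn_step (n + j) t01) IH)).
rewrite le_eqVlt; apply/orP; left; apply/eqP.
rewrite /c exprS; field.
by rewrite subr_eq0 gt_eqF.
Qed.

Let tn_cvg t : 0 <= t -> tn t @ \oo --> t.
Proof.
move=> t0; apply/cvgrPdist_le => e e0.
near=> n.
have /andP[b1 b2] := fl_bounds n t0.
have ne : e^-1 <= (2 ^ n)%:R.
  apply: (@le_trans _ _ n%:R); first by near: n; exact: nbhs_infty_ger.
  by rewrite ler_nat ltnW// ltn_expl.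
have -> : t - tn t n = (t * (2 ^ n)%:R - (fl t n)%:R) / (2 ^ n)%:R.
  by rewrite mulrBl mulfK ?gt_eqF.
rewrite ger0_norm; last by rewrite divr_ge0 ?subr_ge0// ltW.
rewrite ler_pdivrMr//; apply: (@le_trans _ _ 1); first by lra.
by rewrite mulrC -ler_pdivrMr// div1r.
Unshelve. all: by end_near. Qed.

Let tn_itv t n : 0 <= t <= 1 -> tn t n \in `[0, 1].
Proof.
move=> /andP[t0 t1]; have /andP[b1 _] := fl_bounds n t0.
rewrite in_itv/= divr_ge0// ler_pdivrMr// mul1r (le_trans b1)//.
by rewrite ler_piMl// ltW.
Qed.

(** Continuity of g enters here: it carries the chain of dyadic points through to t itself. *)
Let tn_dist t n : 0 <= t <= 1 -> `|g t - g (tn t n)| <= M * c * q ^+ n.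
Proof.
move=> t01; have /andP[t0 t1] := t01.
have gcvg : (fun j => g (tn t (n + j)%N)) @ \oo --> g t.
  have /subspace_continuousP /(_ t) := cg.
  rewrite /= in_itv/= => /(_ t01) gt S gS.
  have htn : (tn t \o addn n) @ \oo --> t.
    by apply: cvg_comp (tn_cvg t0); exact: cvg_addnl.
  have := htn _ (gt _ gS); apply: (@filterS _ \oo) => j; apply.
  exact: tn_itv.
have c1 : (fun j => `|g (tn t (n + j)%N) - g (tn t n)|) @ \oo --> `|g t - g (tn t n)|.
  by apply: cvg_norm; apply: cvgB => //; exact: cvg_cst.
apply: (cvgr_to_le c1); near=> j.
apply: (le_trans (tn_cauchy n j t01)).
by apply: ler_wpM2l; [exact: mulr_ge0|rewrite gerBl exprn_ge0// ltW].
Unshelve. all: by end_near. Qed.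

Lemma dyadic_holder_unit : holder_with (M * (2 * c + 1) * 2 `^ alpha) alpha `[0, 1] g.
Proof.
have hlt (s t : R) : 0 <= s -> s < t -> t <= 1 ->
    `|g t - g s| <= M * (2 * c + 1) * 2 `^ alpha * (t - s) `^ alpha.
  move=> s0 st t1.
  have [||n /andP[n1 n2]] := @exists_dyadic_scale _ (t - s); [lra|lra|].
  have t01 : 0 <= t <= 1 by lra.
  have s01 : 0 <= s <= 1 by lra.
  have /andP[bt1 bt2] := @fl_bounds t n ltac:(lra).
  have /andP[bs1 bs2] := @fl_bounds s n ltac:(lra).
  have n2' : (t - s) * (2 ^ n)%:R <= 1.
    by rewrite -ler_pdivlMr// div1r natrX -exprVn.
  have st' : s * (2 ^ n)%:R <= t * (2 ^ n)%:R by rewrite ler_wpM2r ?ltW.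
  have h : `|g (tn t n) - g (tn s n)| <= M * q ^+ n.
    apply: adjacent.
    - by rewrite -ltnS -(ltr_nat R) -natr1; lra.
    - by rewrite -ltnS -(ltr_nat R) -!natr1; move: n2'; rewrite mulrBl; lra.
    - by rewrite -(ler_nat R) (le_trans bt1)// ler_piMl// ltW.
  have qn : q ^+ n <= 2 `^ alpha * (t - s) `^ alpha.
    have -> : q ^+ n = 2 `^ alpha * (2^-1 ^+ n.+1) `^ alpha.
      have -> : (2^-1 ^+ n.+1) `^ alpha = q ^+ n.+1.
        rewrite -[2^-1 ^+ _]powR_mulrn ?invr_ge0// -powRrM mulrC powRrM powR_mulrn ?powR_ge0//.
        by rewrite -powR_inv1// -powRrM mulN1r.
      by rewrite exprS mulrA /q -powRD ?subrr ?powRr0 ?mul1r// pnatr_eq0 implybT.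
    rewrite ler_wpM2l ?powR_ge0// ge0_ler_powR ?nnegrE ?exprn_ge0 ?invr_ge0 ?(ltW a0)//; lra.
  have -> : g t - g s = (g t - g (tn t n)) + (g (tn t n) - g (tn s n)) - (g s - g (tn s n)) by ring.
  apply: (le_trans (ler_normB _ _)).
  apply: (le_trans (lerD (le_trans (ler_normD _ _) (lerD (tn_dist n t01) h)) (tn_dist n s01))).
  have -> : M * c * q ^+ n + M * q ^+ n + M * c * q ^+ n = M * (2 * c + 1) * q ^+ n by ring.
  by rewrite -[leRHS]mulrA ler_wpM2l// mulr_ge0// addr_ge0// mulr_ge0.
move=> x y /=; rewrite !in_itv/= => /andP[x0 x1] /andP[y0 y1].
have [xy|xy|->] := ltgtP x y.
- have -> : `|x - y| = y - x by rewrite distrC ger0_norm// subr_ge0 ltW.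
  by rewrite distrC; exact: hlt.
- have -> : `|x - y| = x - y by rewrite ger0_norm// subr_ge0 ltW.
  exact: hlt.
- rewrite subrr normr0; apply: mulr_ge0; rewrite ?powR_ge0//; apply: mulr_ge0; rewrite ?powR_ge0//.
  by rewrite mulr_ge0// addr_ge0// mulr_ge0.
Qed.
End dyadic_chaining.

Lemma dyadic_holder {R : realType} (alpha M A : R) (f : R -> R) :
  0 < alpha -> 0 <= M -> 0 < A -> {within `[0, A], continuous f} ->
  (forall n k, (k < 2 ^ n)%N ->
    `|f (A * (k.+1%:R / (2 ^ n)%:R)) - f (A * (k%:R / (2 ^ n)%:R))| <=
    M * (2 `^ (- alpha)) ^+ n) ->
  exists2 C : R, 0 <= C & holder_with C alpha `[0, A] f.
Proof.
move=> a0 M0 A0 cf hM.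
have cg : {within `[0, 1], continuous (fun t => f (A * t))}.
  apply/subspace_continuousP => x /=; rewrite in_itv/= => /andP[x0 x1].
  move/subspace_continuousP : cf => /(_ (A * x)).
  have Ax : (A * x) \in `[0, A] by rewrite in_itv/= mulr_ge0 ?(ltW A0)//= ler_piMr// ltW.
  move=> /(_ Ax) fx S fS.
  have cx : (fun t => A * t) @ x --> A * x by exact: mulrl_continuous.
  have := cx _ (fx _ fS); apply: (@filterS _ (nbhs x)) => t /= h.
  rewrite in_itv/= => /andP[t0 t1]; apply: h.
  by rewrite in_itv/= mulr_ge0 ?(ltW A0)//= ler_piMr// ltW.
have := dyadic_holder_unit a0 M0 cg hM.
set C := M * _ * _ => hC.
have C0 : 0 <= C.
  have := hC 0 1; rewrite /= !in_itv/= !lexx ler01 => /(_ isT isT).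
  by rewrite sub0r normrN normr1 powR1 /= !mulr1; apply: le_trans.
exists (C * (A^-1) `^ alpha); first by rewrite mulr_ge0// powR_ge0.
move=> x y; rewrite /= !in_itv/= => /andP[x0 xA] /andP[y0 yA].
have := hC (x / A) (y / A); rewrite /= !in_itv/= !divr_ge0 ?(ltW A0)//=.
rewrite !ler_pdivrMr// !mul1r => /(_ xA yA).
rewrite !(mulrC A) !divfK ?gt_eqF//.
rewrite -mulrBl normrM (ger0_norm (_ : 0 <= A^-1)) ?invr_ge0 ?(ltW A0)//.
by rewrite powRM ?invr_ge0 ?(ltW A0)// mulrA mulrAC.
Qed.

(** * Pathwise reduction to the partial sums of squared increments *)

Lemma exists_powR_small {R : realType} (b C e : R) : 0 < b -> 0 <= C -> 0 < e ->
  exists2 d : R, 0 < d & forall x, 0 <= x -> x <= d -> C * x `^ b <= e.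
Proof.
move=> b0 C0 e0; have e'0 : 0 < e / (C + 1) by rewrite divr_gt0// ltr_wpDl.
exists ((e / (C + 1)) `^ b^-1); first exact: powR_gt0.
move=> x x0 xd.
have : x `^ b <= e / (C + 1).
  have -> : e / (C + 1) = ((e / (C + 1)) `^ b^-1) `^ b.
    by rewrite -powRrM mulVf ?gt_eqF// powRr1// ltW.
  by apply: ge0_ler_powR; rewrite ?nnegrE ?powR_ge0 ?(ltW b0).
move=> /(ler_wpM2l C0) /le_trans; apply.
by rewrite mulrA ler_pdivrMr ?ltr_wpDl// mulrC ler_wpM2l ?(ltW e0)// lerDl.
Qed.

Lemma holder_continuous {R : realType} (b C : R) (A : set R) (f : R -> R) :
  0 < b -> 0 <= C -> holder_with C b A f -> {within A, continuous f}.
Proof.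
move=> b0 C0 hf; apply/subspace_continuousP => x Ax.
apply/cvgrPdist_le => e e0.
have [d d0 hd] := exists_powR_small b0 C0 e0.
rewrite /within/=; apply/nbhs_ballP; exists d => //= y xy Ay.
apply: (le_trans (hf _ _ Ax Ay)); apply: hd => //.
exact: ltW.
Qed.

Lemma holder_bounded {R : realType} (b C T : R) (f : R -> R) : 0 <= T -> 0 <= b -> 0 <= C ->
  holder_with C b `[0, T] f ->
  forall x, 0 <= x <= T -> `|f x| <= `|f 0| + C * T `^ b.
Proof.
move=> T0 b0 C0 hf x /andP[x0 xT].
rewrite -{1}(subrK (f 0) (f x)) addrC; apply: (le_trans (ler_normD _ _)).
rewrite lerD2l; apply: (le_trans (hf _ _ _ _)); rewrite /= ?in_itv/= ?x0 ?lexx//.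
by rewrite ler_wpM2l// subr0 ge0_ler_powR ?nnegrE// ger0_norm.
Qed.

Lemma holder_sqr {R : realType} (b C M : R) (A : set R) (f : R -> R) : 0 <= C -> 0 <= M ->
  holder_with C b A f -> (forall x, A x -> `|f x| <= M) ->
  holder_with (2 * M * C) b A (fun x => f x ^+ 2).
Proof.
move=> C0 M0 hf fM x y Ax Ay; rewrite subr_sqr normrM.
have h1 := hf _ _ Ax Ay; have h2 : `|f x + f y| <= 2 * M.
  by apply: (le_trans (ler_normD _ _)); have := fM _ Ax; have := fM _ Ay; lra.
apply: (le_trans (ler_pM _ _ h1 h2)) => //.
by rewrite le_eqVlt; apply/orP; left; apply/eqP; ring.
Qed.

(* On a block the weight is frozen at its left endpoint; x i + 2 * h dominates `|x i|. *)
Lemma weighted_sum_le {R : realType} (v x : nat -> R) (L N : nat) (h delta V w : R) :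
  0 <= delta -> 0 <= V -> 0 <= w -> 0 <= h ->
  (forall k, (k <= N)%N -> `|\sum_(0 <= i < k) x i| <= delta) ->
  (forall i, (i < N)%N -> - h <= x i) ->
  (forall i, (i < N)%N -> `|v i| <= V) ->
  (forall i j, (i <= j)%N -> (j < N)%N -> (j <= i + L)%N -> `|v j - v i| <= w) ->
  forall m k, (k <= N)%N -> (k <= m * L)%N ->
  `|\sum_(0 <= i < k) v i * x i| <=
    2 * m%:R * V * delta + w * (\sum_(0 <= i < k) x i + 2 * k%:R * h).
Proof.
move=> d0 V0 w0 h0 xd xh vV vw; elim=> [k kN|m IH k kN].
  rewrite mul0n leqn0 => /eqP ->; rewrite !big_geq// normr0.
  by rewrite !mulr0 !mul0r !addr0 mulr0.
have [kmL _|mLk kmL] := leqP k (m * L).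
  apply: (le_trans (IH _ kN kmL)); rewrite lerD2r.
  by rewrite !ler_wpM2r// ler_wpM2l// ler_nat.
have IHm := IH (m * L)%N (ltnW (leq_trans mLk kN)) (leqnn _).
rewrite (@big_cat_nat _ _ _ (m * L)%N)//=; last exact: ltnW.
rewrite [X in w * (X + _)](@big_cat_nat _ _ _ (m * L)%N)//=; last exact: ltnW.
have -> : \sum_(m * L <= i < k) v i * x i =
    v (m * L)%N * (\sum_(m * L <= i < k) x i) +
    \sum_(m * L <= i < k) (v i - v (m * L)%N) * x i.
  rewrite mulr_sumr -big_split/=; apply: eq_bigr => i _; ring.
have b1 : `|v (m * L)%N * (\sum_(m * L <= i < k) x i)| <= 2 * V * delta.
  (* A block sum is a difference of two partial sums, so it is at most 2 delta; each block thus adds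
     2 V delta to the bound. *)
  have -> : \sum_(m * L <= i < k) x i =
     \sum_(0 <= i < k) x i - \sum_(0 <= i < m * L) x i.
    by rewrite [in RHS](@big_cat_nat _ _ _ (m * L)%N _ k)//= 1?ltnW// addrAC subrr add0r.
  rewrite normrM (mulrC 2) -mulrA; apply: ler_pM => //.
    by apply: vV; exact: leq_trans kN.
  apply: (le_trans (ler_normB _ _)); have := xd _ kN.
  by have := xd _ (ltnW (leq_trans mLk kN)); lra.
have b2 : `|\sum_(m * L <= i < k) (v i - v (m * L)%N) * x i| <=
    w * (\sum_(m * L <= i < k) x i + 2 * (k - m * L)%N%:R * h).
  apply: (le_trans (ler_norm_sum _ _ _)).
  have -> : w * (\sum_(m * L <= i < k) x i + 2 * (k - m * L)%N%:R * h) =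
     \sum_(m * L <= i < k) w * (x i + 2 * h).
    rewrite -mulr_sumr; congr (_ * _); rewrite big_split/= sumr_const_nat.
    by rewrite -[in RHS]mulr_natl; ring.
  apply: ler_sum_nat => i /andP[mi ik]; rewrite normrM.
  have iN := leq_trans ik kN.
  apply: ler_pM => //.
    apply: vw => //; rewrite (leq_trans (ltnW ik))// (leq_trans kmL)//.
    by rewrite mulSn addnC.
  by have := xh _ iN; rewrite ler_norml; lra.
apply: (le_trans (ler_normD _ _)).
apply: (le_trans (lerD IHm (le_trans (ler_normD _ _) (lerD b1 b2)))).
rewrite natrB; last exact: ltnW.
by rewrite le_eqVlt; apply/orP; left; apply/eqP; rewrite -natr1; ring.
Qed.

Lemma primitive_estimate {R : realType} (b C T : R) (v : R -> R) :
  0 < b -> 0 <= C -> holder_with C b `[0, T] v ->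
  forall s t : R, 0 <= s -> s <= t -> t <= T ->
  `|\int[lebesgue_measure]_(r in `[0, t]) v r - \int[lebesgue_measure]_(r in `[0, s]) v r
    - v s * (t - s)| <= C * (t - s) `^ b * (t - s).
Proof.
move=> b0 C0 hv s t s0 st tT.
have vint : lebesgue_measure.-integrable `[0, t] (EFin \o v).
  apply: continuous_compact_integrable; first exact: segment_compact.
  apply: (continuous_subspaceW _ (holder_continuous b0 C0 hv)).
  by move=> r /=; rewrite !in_itv/= => /andP[-> /le_trans]; apply.
rewrite Rintegral_itvB//.
set D := [set` _].
have mD : measurable (D : set (measurableTypeR R)) by exact: measurable_itv.
have vD : lebesgue_measure.-integrable D (EFin \o v).
  apply: integrableS vint => // r; rewrite /D /= !in_itv/= => /andP[sr ->].
  by rewrite andbT ltW// (le_lt_trans s0).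
have muD : lebesgue_measure D = (t - s)%:E :> \bar R.
  rewrite /D lebesgue_measure_itv/= lte_fin.
  by move: st; rewrite le_eqVlt => /predU1P[->|->]//; rewrite ltxx subrr.
have Dt : D `<=` `[0, t].
  move=> r; rewrite /D /= !in_itv/= => /andP[sr ->].
  by rewrite andbT ltW// (le_lt_trans s0).
have cD (c : R) : lebesgue_measure.-integrable D (EFin \o (fun=> c)).
  have cint : lebesgue_measure.-integrable `[0, t] (EFin \o (fun=> c)).
    apply: continuous_compact_integrable; first exact: segment_compact.
    by apply: continuous_subspaceT => r; exact: cvg_cst.
  exact: integrableS cint.
have cst_int (c : R) : \int[lebesgue_measure]_(r in D) c = c * (t - s).
  by rewrite Rintegral_cst// [X in fine X](_ : _ = (t - s)%:E).
have vB : lebesgue_measure.-integrable D (EFin \o (fun r => v r - v s)).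
  exact: (integrableB mD vD (cD (v s))).
rewrite -cst_int -RintegralB//.
apply: (le_trans (le_normr_Rintegral mD vB)).
rewrite -cst_int; apply: le_Rintegral => //.
  exact: (integrable_abse vB).
move=> r Dr; have := Dt _ Dr; have := Dr.
rewrite /D /= !in_itv/= => /andP[sr rt] _.
apply: (le_trans (hv _ _ _ _)); rewrite /= ?in_itv/=; [lra|lra|].
rewrite ler_wpM2l// ge0_ler_powR ?nnegrE ?(ltW b0)//; first lra.
by rewrite ger0_norm; lra.
Qed.

(** The complete cells contribute the Hölder error, summed by telescoping the primitive; the
    incomplete cell between [x k] and t is no longer than 1/n and contributes [M / n%:R]. *)
Lemma riemann_sum_le {R : realType} (b C M T : R) (v : R -> R) (n : nat) (t : R) :
  0 < b -> 0 <= C -> holder_with C b `[0, T] v ->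
  (forall x, 0 <= x <= T -> `|v x| <= M) -> (0 < n)%N -> 0 <= t <= T ->
  `|\sum_(0 <= i < Num.truncn (n%:R * t)) v (i%:R / n%:R) / n%:R -
    \int[lebesgue_measure]_(r in `[0, t]) v r| <= C * n%:R^-1 `^ b * T + M / n%:R.
Proof.
move=> b0 C0 hv vM n0 /andP[t0 tT].
pose F (s : R) := \int[lebesgue_measure]_(r in `[0, s]) v r.
have F0 : F 0 = 0 by rewrite /F set_itv1 Rintegral_set1.
have nR : 0 < n%:R :> R by rewrite ltr0n.
have M0 : 0 <= M by apply: (le_trans (normr_ge0 (v 0))); apply: vM; rewrite lexx (le_trans t0).
set k := Num.truncn _; pose x i : R := i%:R / n%:R.
have /andP[k1 k2] : k%:R <= n%:R * t < k%:R + 1.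
  by rewrite natr1; apply: truncn_itv; rewrite mulr_ge0// ltW.
have xk : x k <= t by rewrite /x ler_pdivrMr// mulrC.
have xkt : t - x k <= n%:R^-1.
  by rewrite lerBlDl /x -[X in _ + X]mul1r -mulrDl ler_pdivlMr// mulrC ltW.
have x_ge0 i : 0 <= x i by rewrite /x mulr_ge0 ?invr_ge0 ?ler0n.
have xS i : x i.+1 - x i = n%:R^-1 by rewrite /x -natr1; ring.
have xle i j : (i <= j)%N -> x i <= x j by move=> ij; rewrite /x ler_pM2r ?invr_gt0// ler_nat.
have step s r : 0 <= s -> s <= r -> r <= T -> r - s <= n%:R^-1 ->
    `|F r - F s - v s * (r - s)| <= C * n%:R^-1 `^ b * (r - s).
  move=> s0 sr rT rs; apply: (le_trans (primitive_estimate b0 C0 hv s0 sr rT)).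
  rewrite ler_wpM2r ?subr_ge0// ler_wpM2l// ge0_ler_powR ?nnegrE ?(ltW b0)//.
  by rewrite subr_ge0.
have e1 : \sum_(0 <= i < k) (F (x i.+1) - F (x i) - v (x i) * (x i.+1 - x i)) =
    F (x k) - \sum_(0 <= i < k) v (i%:R / n%:R) / n%:R.
  rewrite big_split/= telescope_sumr// {2}/x mul0r F0 subr0 sumrN; congr (_ - _).
  by apply: eq_bigr => i _; rewrite xS.
have e2 : `|F (x k) - \sum_(0 <= i < k) v (i%:R / n%:R) / n%:R| <= C * n%:R^-1 `^ b * x k.
  rewrite -e1; apply: (le_trans (ler_norm_sum _ _ _)).
  apply: (@le_trans _ _ (\sum_(0 <= i < k) C * n%:R^-1 `^ b * (x i.+1 - x i))).
    apply: ler_sum_nat => i /andP[_ ik]; apply: step => //.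
    - exact: xle.
    - by apply: le_trans tT; apply: le_trans xk; exact: xle.
    - by rewrite xS.
  by rewrite -mulr_sumr telescope_sumr// {2}/x mul0r subr0.
have e3 := step _ _ (x_ge0 k) xk tT xkt.
have e4 : `|v (x k) * (t - x k)| <= M / n%:R.
  rewrite normrM ler_pM//; first by apply: vM; rewrite x_ge0 (le_trans xk).
  by rewrite ger0_norm ?subr_ge0.
have e5 : C * n%:R^-1 `^ b * t <= C * n%:R^-1 `^ b * T.
  by rewrite ler_wpM2l// mulr_ge0// powR_ge0.
move: e2 e3 e4; rewrite -/(F t) mulrBr !ler_norml; lra.
Qed.

Lemma powR_invl {R : realType} (x a : R) : 0 <= x -> x^-1 `^ a = x `^ (- a).
Proof. by move=> x0; rewrite -powR_inv1// -powRrM mulN1r. Qed.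

(** Order 1 makes the Young condition for the inner integral read alpha + 1 > 1, which holds however
    rough the driving path is. *)
Lemma expRN_lipschitz {R : realType} (T : R) :
  holder_with 1 1 `[0, T] (fun r : R => expR (- r)).
Proof.
have h (x y : R) : 0 <= x -> x <= y -> `|expR (- x) - expR (- y)| <= y - x.
  move=> x0 xy; rewrite ger0_norm; last by rewrite subr_ge0 ler_expR lerN2.
  have -> : expR (- x) - expR (- y) = expR (- x) * (1 - expR (- (y - x))).
    by rewrite mulrBr mulr1 -expRD; congr (_ - expR _); ring.
  have e1 := expR_ge1Dx (- (y - x)).
  have e2 : expR (- x) <= 1 by rewrite -[leRHS]expR0 ler_expR oppr_le0.
  have e3 := expR_ge0 (- x).
  have e4 : expR (- (y - x)) <= 1 by rewrite -[leRHS]expR0 ler_expR oppr_le0 subr_ge0.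
  apply: (@le_trans _ _ (1 * (1 - expR (- (y - x))))); last by lra.
  by rewrite ler_wpM2r// subr_ge0.
move=> x y; rewrite /= !in_itv/= mul1r powRr1// => /andP[x0 _] /andP[y0 _].
have [xy|yx] := leP x y.
  by rewrite [leRHS]distrC [leRHS]ger0_norm ?subr_ge0//; exact: h.
by rewrite distrC [leRHS]ger0_norm ?subr_ge0 ?(ltW yx)//; apply: h => //; exact: ltW.
Qed.

(** * The variation of [Z] along one fixed path *)

Section pathwise.
Context {R : realType} (H T alpha beta Cu CW : R) (u W Z : R -> R).
Hypotheses (T0 : 0 < T) (a0 : 0 < alpha) (b0 : 0 < beta) (b1 : beta <= 1).
Hypotheses (ab : 1 < alpha + beta) (abH : 2 * H < 2 * alpha + beta).
Hypotheses (Cu0 : 0 <= Cu) (CW0 : 0 <= CW).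
Hypotheses (hu : holder_with Cu beta `[0, T] u) (hW : holder_with CW alpha `[0, T] W).

Let Y (t : R) : R := stieltjes (fun r => expR (- r)) W 0 t.
Hypothesis ZE : forall t, 0 <= t <= T -> Z t = stieltjes u Y 0 t.

Let D (n i : nat) : R :=
  expR (- (i%:R / n%:R)) * (W (i.+1%:R / n%:R) - W (i%:R / n%:R)).

Hypothesis hQV : forall e, 0 < e -> \forall n \near \oo, forall k : nat, k%:R / n%:R <= T ->
  `|\sum_(0 <= i < k) (n%:R `^ (2 * H - 1) * D n i ^+ 2 - n%:R^-1)| <= e.

Let Y_local : exists2 C : R, 0 <= C & forall s t : R, 0 <= s -> s <= t -> t <= T ->
  `|Y t - Y s - expR (- s) * (W t - W s)| <= C * (t - s) `^ (alpha + 1).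
Proof.
have a1 : 1 < alpha + 1 by rewrite ltrDr.
exists (young_const (alpha + 1) * 1 * CW).
  by do 2!apply: mulr_ge0 => //; exact: young_const_ge0.
move=> s t s0 st tT.
exact: (stieltjes_local_estimate T0 a0 ltr01 a1 ler01 CW0 (@expRN_lipschitz R T) hW).
Qed.

(** Up to the bounded factor exp(-s), an increment of [Y] is one of [W] plus a term of the higher
    order alpha + 1. So [Y] keeps the order of [W], which makes the outer integral against [Y] a
    Young integral. *)
Let Y_holder : exists2 C : R, 0 <= C & holder_with C alpha `[0, T] Y.
Proof.
have [C C0 hC] := Y_local.
have h (s t : R) : 0 <= s -> s <= t -> t <= T ->
    `|Y t - Y s| <= (C * T + CW) * (t - s) `^ alpha.
  move=> s0 st tT.
  have ts0 : 0 <= t - s by rewrite subr_ge0.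
  have h1 := hC _ _ s0 st tT.
  have h2 : `|expR (- s) * (W t - W s)| <= CW * (t - s) `^ alpha.
    rewrite normrM -[leRHS]mul1r ler_pM//.
      by rewrite ger0_norm ?expR_ge0// -[leRHS]expR0 ler_expR oppr_le0.
    have := hW (x := t) (y := s); rewrite (ger0_norm ts0) /= !in_itv/=.
    by apply; lra.
  have h3 : C * (t - s) `^ (alpha + 1) <= C * T * (t - s) `^ alpha.
    rewrite powRD; last by rewrite gt_eqF ?addr_gt0.
    rewrite powRr1// -mulrA ler_wpM2l// mulrC ler_wpM2r ?powR_ge0//; lra.
  by rewrite mulrDl; move: h1 h2; rewrite !ler_norml; lra.
exists (C * T + CW); first by rewrite addr_ge0// mulr_ge0// ltW.
move=> x y; rewrite /= !in_itv/= => /andP[x0 xT] /andP[y0 yT].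
have [xy|yx] := leP x y.
  by rewrite distrC (distrC x) [`|y - x|]ger0_norm ?subr_ge0//; exact: h.
by rewrite [`|x - y|]ger0_norm ?subr_ge0 ?(ltW yx)//; apply: h => //; exact: ltW.
Qed.

(** Two freezings: u in the outer integral, with error n^(-(alpha+beta)), then exp(-s) in the inner
    one, with error n^(-(alpha+1)). The second is absorbed by the first because beta <= 1. *)
Let Z_local : exists2 C : R, 0 <= C & forall n i : nat, (0 < n)%N -> i.+1%:R / n%:R <= T ->
  `|Z (i.+1%:R / n%:R) - Z (i%:R / n%:R) - u (i%:R / n%:R) * D n i| <=
  C * n%:R `^ (- (alpha + beta)).
Proof.
have [C1 C10 hC1] := Y_local; have [CY CY0 hY] := Y_holder.
pose M := `|u 0| + Cu * T `^ beta.
have uM := holder_bounded (ltW T0) (ltW b0) Cu0 hu.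
have M0 : 0 <= M by rewrite addr_ge0// mulr_ge0// powR_ge0.
have K0 := young_const_ge0 ab.
set K := young_const _ in K0.
have KC0 : 0 <= K * Cu * CY by rewrite mulr_ge0// mulr_ge0.
exists (K * Cu * CY + M * C1); first by rewrite addr_ge0// mulr_ge0.
move=> n i n0 iT.
have nR : 0 < n%:R :> R by rewrite ltr0n.
set s := i%:R / n%:R; set t := i.+1%:R / n%:R.
have s0 : 0 <= s by rewrite /s mulr_ge0 ?invr_ge0 ?ler0n.
have ts : t - s = n%:R^-1 by rewrite /t /s -natr1; ring.
have st : s <= t by rewrite -subr_ge0 ts invr_ge0 ltW.
have tT : t <= T by exact: iT.
have t0 : 0 <= t by exact: le_trans st.
have sT : s <= T by exact: le_trans tT.
have h1 := stieltjes_local_estimate T0 a0 b0 ab Cu0 CY0 hu hY s0 st tT.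
rewrite -!ZE ?s0 ?t0// in h1.
have h2 := hC1 _ _ s0 st iT.
rewrite ts !powR_invl ?ler0n// -/K in h1 h2.
have h3 : n%:R `^ (- (alpha + 1)) <= n%:R `^ (- (alpha + beta)).
  by rewrite ler_powR ?ler1n// lerN2 lerD2l.
have h4 : `|u s * (Y t - Y s - D n i)| <= M * (C1 * n%:R `^ (- (alpha + beta))).
  rewrite normrM; apply: ler_pM => //; first by apply: uM; rewrite s0.
  by apply: (le_trans h2); rewrite ler_wpM2l.
have -> : Z t - Z s - u s * D n i =
  (Z t - Z s - u s * (Y t - Y s)) + u s * (Y t - Y s - D n i) by ring.
apply: (le_trans (ler_normD _ _)); apply: (le_trans (lerD h1 h4)).
by rewrite [leRHS]mulrDl mulrA.
Qed.

Let D_le n i : (0 < n)%N -> i.+1%:R / n%:R <= T -> `|D n i| <= CW * n%:R `^ (- alpha).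
Proof.
move=> n0 iT; have nR : 0 < n%:R :> R by rewrite ltr0n.
have s0 : 0 <= i%:R / n%:R :> R by rewrite mulr_ge0 ?invr_ge0 ?ler0n.
have ts : i.+1%:R / n%:R - i%:R / n%:R = n%:R^-1 :> R by rewrite -natr1; ring.
have n1 : 0 < n%:R^-1 :> R by rewrite invr_gt0.
rewrite normrM -[leRHS]mul1r ler_pM//.
  by rewrite ger0_norm ?expR_ge0// -[leRHS]expR0 ler_expR oppr_le0.
have := hW (x := i.+1%:R / n%:R) (y := i%:R / n%:R).
rewrite ts (ger0_norm (ltW n1)) powR_invl ?ler0n//= !in_itv/=.
by apply; lra.
Qed.

(** A difference of squares is the error of [Z_local] times a quantity of order n^(-alpha). With the
    normalisation n^(2H-1) and at most T n terms, the powers of n add up to the stated exponent,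
    which is negative by [abH]. *)
Let sqr_error : exists2 C : R, 0 <= C & forall n k : nat, (0 < n)%N -> k%:R / n%:R <= T ->
  `|n%:R `^ (2 * H - 1) * (\sum_(0 <= i < k) (Z (i.+1%:R / n%:R) - Z (i%:R / n%:R)) ^+ 2)
    - \sum_(0 <= i < k) u (i%:R / n%:R) ^+ 2 * (n%:R `^ (2 * H - 1) * D n i ^+ 2)| <=
  C * n%:R `^ (- (2 * alpha + beta - 2 * H)).
Proof.
have [C C0 hC] := Z_local.
pose M := `|u 0| + Cu * T `^ beta.
have uM := holder_bounded (ltW T0) (ltW b0) Cu0 hu.
have M0 : 0 <= M by rewrite addr_ge0// mulr_ge0// powR_ge0.
exists (T * (C * (2 * M * CW + C))).
  by rewrite mulr_ge0 ?(ltW T0)// mulr_ge0// addr_ge0// mulr_ge0// mulr_ge0.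
move=> n k n0 kT; have nR : 0 < n%:R :> R by rewrite ltr0n.
rewrite mulr_sumr -sumrB; apply: (le_trans (ler_norm_sum _ _ _)).
pose h := n%:R `^ (- (alpha + beta)) * n%:R `^ (- alpha).
apply: (@le_trans _ _ (\sum_(0 <= i < k) n%:R `^ (2 * H - 1) * (C * (2 * M * CW + C) * h))).
  apply: ler_sum_nat => i /andP[_ ik].
  have iT : i.+1%:R / n%:R <= T.
    by apply: le_trans kT; rewrite ler_pM2r ?invr_gt0// ler_nat.
  have iT' : 0 <= (i%:R / n%:R : R) <= T.
    have s0 : 0 <= i%:R / n%:R :> R by rewrite mulr_ge0 ?invr_ge0 ?ler0n.
    rewrite s0/=; apply: le_trans iT.
    by rewrite ler_pM2r ?invr_gt0// ler_nat.
  set dZ := Z _ - Z _; set us := u _.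
  have -> : n%:R `^ (2 * H - 1) * dZ ^+ 2 - us ^+ 2 * (n%:R `^ (2 * H - 1) * D n i ^+ 2)
    = n%:R `^ (2 * H - 1) * ((dZ - us * D n i) * (2 * (us * D n i) + (dZ - us * D n i))).
    by ring.
  rewrite normrM ger0_norm ?powR_ge0// ler_wpM2l ?powR_ge0// normrM.
  have r1 := hC n i n0 iT; rewrite -/dZ -/us in r1.
  have r2 := D_le n0 iT.
  have r3 : `|us| <= M by exact: uM.
  have p0 : 0 <= n%:R `^ (- alpha) :> R by exact: powR_ge0.
  have p1 : n%:R `^ (- (alpha + beta)) <= n%:R `^ (- alpha).
    by rewrite ler_powR ?ler1n// lerN2 lerDl ltW.
  have -> : C * (2 * M * CW + C) * h =
     (C * n%:R `^ (- (alpha + beta))) * ((2 * M * CW + C) * n%:R `^ (- alpha)).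
    by rewrite /h; ring.
  apply: ler_pM => //; apply: (le_trans (ler_normD _ _)).
  rewrite [leRHS]mulrDl lerD//; last by apply: (le_trans r1); rewrite ler_wpM2l.
  rewrite normrM (ger0_norm (ler0n _ 2)) (normrM us) -!mulrA ler_wpM2l//.
  exact: ler_pM.
rewrite sumr_const_nat subn0 -[leLHS]mulr_natl.
have kn : k%:R <= T * n%:R by rewrite -ler_pdivrMr.
have X0 : 0 <= n%:R `^ (2 * H - 1) * (C * (2 * M * CW + C) * h).
  apply: mulr_ge0; first exact: powR_ge0.
  apply: mulr_ge0; last by rewrite mulr_ge0 ?powR_ge0.
  by rewrite mulr_ge0// addr_ge0// mulr_ge0// mulr_ge0.
apply: (le_trans (ler_wpM2r X0 kn)).
have -> : n%:R `^ (- (2 * alpha + beta - 2 * H)) = n%:R * n%:R `^ (2 * H - 1) * h.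
  have nE : n%:R = n%:R `^ 1 :> R by rewrite powRr1// ltW.
  have n00 : n%:R != 0 :> R by rewrite gt_eqF.
  rewrite /h [X in _ = X * _ * _]nE -!powRD ?n00 ?implybT//; congr (_ `^ _); ring.
by rewrite le_eqVlt; apply/orP; left; apply/eqP; ring.
Qed.
Let weighted_error e : 0 < e -> \forall n \near \oo, forall k : nat, k%:R / n%:R <= T ->
  `|\sum_(0 <= i < k) u (i%:R / n%:R) ^+ 2 *
      (n%:R `^ (2 * H - 1) * D n i ^+ 2 - n%:R^-1)| <= e.
Proof.
move=> e0.
pose M := `|u 0| + Cu * T `^ beta.
have uM := holder_bounded (ltW T0) (ltW b0) Cu0 hu.
have M0 : 0 <= M by rewrite addr_ge0// mulr_ge0// powR_ge0.
have hv : holder_with (2 * M * Cu) beta `[0, T] (fun x => u x ^+ 2).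
  by apply: holder_sqr => // x; rewrite /= in_itv/=; exact: uM.
pose V := M ^+ 2; have V0 : 0 <= V by exact: sqr_ge0.
(* Half of e goes to the oscillation of the weight: the bracket that multiplies [w] in
   [weighted_sum_le] will be at most delta + 2 T <= 2 T + 1. *)
pose w := e / 2 / (2 * T + 1).
have w0 : 0 < w by rewrite !divr_gt0// ltr_wpDl// mulr_ge0// ltW.
have Cv0 : 0 <= 2 * M * Cu by rewrite mulr_ge0// mulr_ge0.
have [rho rho0 hrho] := exists_powR_small b0 Cv0 w0.
(* Blocks have time length about [rho], on which u^2 varies by at most [w]. Once n rho >= 2, the
   number [L] of indices in a block is at least n rho / 2, so [m] blocks cover all k <= T n; [m]
   does not depend on n. *)
pose m := (Num.truncn (2 * T / rho)).+1.
have m0 : 0 < m%:R :> R by rewrite ltr0n.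
(* The other half of e pays for [2 * m%:R * V * delta]; the cap at 1 serves the bracket bounded by 2
   T + 1. *)
pose delta := Num.min 1 (e / 2 / (2 * m%:R * (V + 1))).
have V1 : 0 < V + 1 by rewrite ltr_wpDl.
have delta0 : 0 < delta by rewrite lt_min ltr01 !divr_gt0// mulr_gt0// mulr_gt0.
have delta1 : delta <= 1 by rewrite ge_min lexx.
have delta2 : 2 * m%:R * V * delta <= e / 2.
  apply: (@le_trans _ _ (2 * m%:R * (V + 1) * delta)).
    by rewrite ler_wpM2r ?(ltW delta0)// ler_wpM2l ?mulr_ge0// lerDl.
  rewrite mulrC -ler_pdivlMr ?mulr_gt0//.
  by rewrite ge_min lexx orbT.
near=> n => k kT.
have n0 : (0 < n)%N by near: n; exact: nbhs_infty_gt.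
have nR : 0 < n%:R :> R by rewrite ltr0n.
have nrho : 2 / rho <= n%:R by near: n; exact: nbhs_infty_ger.
have QV : forall k : nat, k%:R / n%:R <= T ->
    `|\sum_(0 <= i < k) (n%:R `^ (2 * H - 1) * D n i ^+ 2 - n%:R^-1)| <= delta.
  by near: n; exact: hQV.
pose L := Num.truncn (rho * n%:R).
have /andP[L1 L2] : L%:R <= rho * n%:R < L%:R + 1.
  by rewrite natr1; apply: truncn_itv; rewrite mulr_ge0// ltW.
have kn : k%:R <= T * n%:R by rewrite -ler_pdivrMr.
have kmL : (k <= m * L)%N.
  rewrite -(ler_nat R) natrM; apply: (le_trans kn).
  apply: (@le_trans _ _ ((2 * T / rho) * (rho * n%:R / 2))).
    by rewrite le_eqVlt; apply/orP; left; apply/eqP; field; rewrite gt_eqF.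
  apply: ler_pM; first 2 last.
  - by apply: ltW; rewrite /m; exact: truncnS_gt.
  - have : 2 <= rho * n%:R by rewrite -ler_pdivrMl// mulrC.
    lra.
  - by rewrite !mulr_ge0 ?invr_ge0 ?(ltW T0) ?(ltW rho0).
  - by rewrite !mulr_ge0 ?invr_ge0 ?(ltW nR) ?(ltW rho0).
have jT j : (j <= k)%N -> j%:R / n%:R <= T.
  by move=> jk; apply: le_trans kT; rewrite ler_pM2r ?invr_gt0// ler_nat.
have j0 j : 0 <= j%:R / n%:R :> R by rewrite mulr_ge0 ?invr_ge0 ?ler0n.
have := @weighted_sum_le _ (fun i => u (i%:R / n%:R) ^+ 2)
  (fun i => n%:R `^ (2 * H - 1) * D n i ^+ 2 - n%:R^-1) L k n%:R^-1 delta V w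
  (ltW delta0) V0 (ltW w0).
move=> /(_ _ _ _ _ _ m k (leqnn k) kmL) h; apply: (le_trans (h _ _ _ _ _)).
- by rewrite invr_ge0 ltW.
- by move=> j jk; apply: QV; exact: jT.
- by move=> i ik; rewrite lerBrDl subrr mulr_ge0 ?powR_ge0 ?sqr_ge0.
- move=> i ik; rewrite normrX lerXn2r ?nnegrE//; apply: uM.
  by rewrite j0 jT// ltnW.
- move=> i j ij jk jiL.
  have ijk := leq_ltn_trans ij jk.
  apply: (le_trans (hv _ _ _ _)).
  + by rewrite /= in_itv/= j0 jT// ltnW.
  + by rewrite /= in_itv/= j0 jT// ltnW.
  have -> : j%:R / n%:R - i%:R / n%:R = (j - i)%:R / n%:R :> R by rewrite natrB// mulrBl.
  apply: hrho; rewrite ger0_norm ?j0// ler_pdivrMr// (le_trans _ L1)// ler_nat.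
  by rewrite leq_subLR.
have QVk := QV k kT.
have e1 : w * (\sum_(0 <= i < k) (n%:R `^ (2 * H - 1) * D n i ^+ 2 - n%:R^-1) +
    2 * k%:R * n%:R^-1) <= e / 2.
  apply: (@le_trans _ _ (w * (2 * T + 1))); last by rewrite /w divfK// gt_eqF// ltr_wpDl// mulr_ge0// ltW.
  rewrite ler_wpM2l ?(ltW w0)//; move: QVk; rewrite ler_norml -mulrA; lra.
lra.
Unshelve. all: by end_near. Qed.

(** Three errors of at most e / 4 each, all bounded independently of t: squares of increments of [Z]
    against weighted squares of [D], these against the Riemann sum of u^2, and the Riemann sum
    against the integral. *)
Lemma pathwise_variation e : 0 < e -> \forall n \near \oo, forall t, 0 <= t <= T ->
  `|n%:R `^ (2 * H - 1) * realized_variation Z n t -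
    \int[lebesgue_measure]_(s in `[0, t]) (`|u s| ^+ 2)| < e.
Proof.
move=> e0; have e4 : 0 < e / 4 by rewrite divr_gt0.
pose M := `|u 0| + Cu * T `^ beta.
have uM := holder_bounded (ltW T0) (ltW b0) Cu0 hu.
have M0 : 0 <= M by rewrite addr_ge0// mulr_ge0// powR_ge0.
have hv : holder_with (2 * M * Cu) beta `[0, T] (fun x => u x ^+ 2).
  by apply: holder_sqr => // x; rewrite /= in_itv/=; exact: uM.
have vM x : 0 <= x <= T -> `|u x ^+ 2| <= M ^+ 2.
  by move=> xT; rewrite normrX lerXn2r ?nnegrE//; exact: uM.
have Cv0 : 0 <= 2 * M * Cu by rewrite mulr_ge0// mulr_ge0.
have [C1 C10 hC1] := sqr_error.
pose k1 := 2 * alpha + beta - 2 * H.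
have k10 : 0 < k1 by rewrite subr_gt0.
have lim1 : C1 * n%:R `^ (- k1) @[n --> \oo] --> C1 * (0 : R).
  by apply: cvgM; [exact: cvg_cst|exact: powR_natN_cvg0].
have lim2 : (2 * M * Cu) * n%:R `^ (- beta) * T + M ^+ 2 * n%:R `^ (- 1) @[n --> \oo] -->
    (2 * M * Cu) * (0 : R) * T + M ^+ 2 * 0.
  apply: cvgD; last by apply: cvgM; [exact: cvg_cst|exact: powR_natN_cvg0].
  apply: cvgM; last exact: cvg_cst.
  by apply: cvgM; [exact: cvg_cst|exact: powR_natN_cvg0].
rewrite mulr0 in lim1; rewrite !mulr0 mul0r addr0 in lim2.
near=> n => t tT.
have n0 : (0 < n)%N by near: n; exact: nbhs_infty_gt.
have nR : 0 < n%:R :> R by rewrite ltr0n.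
have h1 : C1 * n%:R `^ (- k1) <= e / 4.
  by near: n; apply: cvgr_le lim1 _ _.
have h2 : (2 * M * Cu) * n%:R `^ (- beta) * T + M ^+ 2 * n%:R `^ (- 1) <= e / 4.
  by near: n; apply: cvgr_le lim2 _ _.
have h3 : forall k : nat, k%:R / n%:R <= T ->
  `|\sum_(0 <= i < k) u (i%:R / n%:R) ^+ 2 *
      (n%:R `^ (2 * H - 1) * D n i ^+ 2 - n%:R^-1)| <= e / 4.
  by near: n; exact: weighted_error.
pose k := Num.truncn (n%:R * t).
have /andP[t0 tT'] := tT.
have kt : k%:R / n%:R <= T.
  apply: le_trans tT'; rewrite ler_pdivrMr// mulrC.
  by have /andP[] : k%:R <= n%:R * t < k.+1%:R by apply: truncn_itv; rewrite mulr_ge0// ltW.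
have r1 := le_trans (hC1 n k n0 kt) h1.
have r2 := h3 k kt.
have r3 := riemann_sum_le b0 Cv0 hv vM n0 tT.
rewrite powR_invl ?ler0n//= in r3; rewrite powR_inv1 ?ler0n// in h2.
have r4 := le_trans r3 h2.
have -> : realized_variation Z n t =
    \sum_(0 <= i < k) (Z (i.+1%:R / n%:R) - Z (i%:R / n%:R)) ^+ 2.
  rewrite /realized_variation -/k big_add1/=; apply: eq_bigr => i _.
  by rewrite real_normK// num_real.
have -> : \int[lebesgue_measure]_(s in `[0, t]) (`|u s| ^+ 2) =
    \int[lebesgue_measure]_(s in `[0, t]) (u s ^+ 2).
  by apply: eq_Rintegral => s _; rewrite real_normK// num_real.
have r5 : \sum_(0 <= i < k) u (i%:R / n%:R) ^+ 2 *
      (n%:R `^ (2 * H - 1) * D n i ^+ 2 - n%:R^-1) =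
  \sum_(0 <= i < k) u (i%:R / n%:R) ^+ 2 * (n%:R `^ (2 * H - 1) * D n i ^+ 2) -
  \sum_(0 <= i < k) u (i%:R / n%:R) ^+ 2 / n%:R.
  by rewrite -sumrB; apply: eq_bigr => i _; ring.
rewrite r5 in r2.
clear r5.
move: r1 r2 r4; rewrite -/k !ler_norml ltr_norml; lra.
Unshelve. all: by end_near. Qed.
End pathwise.

(** * Gaussian integration by parts and moments of quadratic forms *)

Lemma expR_taylor1 {R : realType} (y : R) : `|expR y - 1 - y| <= y ^+ 2 * expR `|y|.
Proof.
have e1 := expR_ge1Dx y; have e2 := expR_ge1Dx (- y); have e0 := expR_gt0 y.
have e3 : expR y * expR (- y) = 1 by rewrite -expRD subrr expR0.
rewrite ger0_norm; last by lra.
have [y0|y0] := leP 0 y.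
- have h : expR y - 1 <= y * expR y by nra.
  rewrite ger0_norm// expr2 -mulrA; nra.
- have h : 1 <= expR `|y| by rewrite -[leLHS]expR0 ler_expR.
  nra.
Qed.

Lemma expR_norm_le {R : realType} (x : R) : expR `|x| <= expR x + expR (- x).
Proof.
have e1 := expR_ge0 x; have e2 := expR_ge0 (- x).
by have [x0|x0] := leP 0 x; [rewrite ger0_norm|rewrite ltr0_norm]; rewrite ?lerDl ?lerDr.
Qed.

Lemma norm_le_expR {R : realType} (x : R) : `|x| <= expR x + expR (- x).
Proof. by apply: le_trans (expR_norm_le x); have := expR_ge1Dx `|x|; lra. Qed.

(** Differentiability at 0 from an explicit quadratic remainder. Such a remainder can be integrated
    pointwise, which yields differentiation under the expectation; a derivative at another parameter
    is reduced to one at 0 by moving the tilt into the weight. *)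
Lemma is_derive0_of_quadratic_error {R : realType} (F : R -> R) (A C : R) :
  (forall t, `|t| <= 1 -> `|F t - F 0 - t * A| <= C * t ^+ 2) -> is_derive (0 : R) 1 F A.
Proof.
move=> hF; have C0 : 0 <= C.
  by have := hF 1; rewrite normr1 lexx expr1n mulr1 => /(_ isT); apply: le_trans.
have cv : (fun h => h^-1 *: ((F \o shift (0 : R)) (h *: (1 : R)) - F 0)) @ (0 : R)^' --> A.
  apply/cvgrPdist_le => e e0.
  have C1 : 0 < C + 1 by rewrite ltr_wpDl.
  near=> h.
  have h0 : h != 0 by near: h; exact: nbhs_dnbhs_neq.
  have h1 : `|h| <= 1 by near: h; apply: dnbhs0_le.
  have he : `|h| <= e / (C + 1) by near: h; apply: dnbhs0_le; rewrite divr_gt0.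
  rewrite /= addr0 /GRing.scale/= mulr1 distrC.
  have -> : h^-1 * (F h - F 0) - A = h^-1 * (F h - F 0 - h * A).
    by rewrite [RHS]mulrBr mulrA mulVf// mul1r.
  rewrite normrM normfV ler_pdivrMl ?normr_gt0//; apply: (le_trans (hF _ h1)).
  rewrite -real_normK ?num_real// expr2 mulrCA ler_wpM2l//.
  by move: he; rewrite ler_pdivlMr//; have := normr_ge0 h; nra.
split; first by apply/cvg_ex; exists A.
exact/cvg_lim.
Unshelve. all: by end_near. Qed.

(** The shape of t |-> E exp(L (a + t b)): the exponent is half a quadratic form, hence a quadratic
    polynomial in t. *)
Lemma is_derive_expR_quadratic {R : realType} (x y z : R) :
  is_derive (0 : R) 1 (fun t => expR (x + t * y + t ^+ 2 * z)) (y * expR x).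
Proof.
pose B := `|y| + `|z|; have B0 : 0 <= B by rewrite addr_ge0.
apply: (@is_derive0_of_quadratic_error _ _ _ (expR x * (B ^+ 2 * expR B + B))) => t t1.
rewrite mul0r expr0n/= mul0r !addr0.
set r := t * y + t ^+ 2 * z; have -> : x + t * y + t ^+ 2 * z = x + r by rewrite /r addrA.
rewrite expRD.
have tt : t ^+ 2 = `|t| ^+ 2 by rewrite real_normK// num_real.
have t0 := normr_ge0 t.
have rB : `|r| <= `|t| * B.
  rewrite /r /B mulrDr; apply: (le_trans (ler_normD _ _)); rewrite !normrM lerD2l.
  by rewrite ler_wpM2r// ler_piMr.
have -> : expR x * expR r - expR x - t * (y * expR x) =
  expR x * ((expR r - 1 - r) + t ^+ 2 * z) by rewrite /r; ring.
rewrite normrM ger0_norm ?expR_ge0// -mulrA ler_wpM2l ?expR_ge0//.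
apply: (le_trans (ler_normD _ _)); rewrite mulrDl lerD//.
  apply: (le_trans (expR_taylor1 _)); rewrite [leRHS]mulrAC.
  apply: ler_pM; rewrite ?sqr_ge0 ?expR_ge0//.
  - by rewrite -real_normK ?num_real// tt -exprMn mulrC lerXn2r ?nnegrE ?mulr_ge0.
  - by rewrite ler_expR (le_trans rB)// ler_piMl.
rewrite normrM mulrC normrX -tt ler_wpM2r ?sqr_ge0//.
by rewrite /B lerDr.
Qed.

Lemma is_derive_affine {R : realType} (x y : R) : is_derive (0 : R) 1 (fun t => x + t * y) y.
Proof.
apply: (@is_derive0_of_quadratic_error _ _ _ 0) => t _.
have -> : x + t * y - (x + 0 * y) - t * y = 0 by ring.
by rewrite normr0 mul0r.
Qed.

Section gaussian_calculus.
Context {R : realType} {d : measure_display} {Omega : measurableType d}.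
Variable P : probability Omega R.
Context {V : lmodType R}.
Variables (L : V -> Omega -> R) (q : V -> V -> R).
Hypothesis L_lin : forall (a b : V) t w, L (a + t *: b) w = L a w + t * L b w.
Hypothesis L_meas : forall a, measurable_fun [set: Omega] (L a).
Hypothesis q_sym : forall a b, q a b = q b a.
Hypothesis q_lin : forall (c a b : V) t, q c (a + t *: b) = q c a + t * q c b.
Hypothesis L_int : forall a, P.-integrable [set: Omega] (EFin \o (fun w => expR (L a w))).
Hypothesis L_mgf : forall a, \int[P]_w expR (L a w) = expR (q a a / 2).

Local Notation "''E' f" := (\int[P]_w f w) (at level 10, f at level 9).

Let L0 w : L 0 w = 0.
Proof. by have := L_lin 0 0 1 w; rewrite scaler0 addr0; lra. Qed.

Let LN a w : L (- a) w = - L a w.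
Proof. by have := L_lin 0 a (-1) w; rewrite add0r scaleN1r L0; lra. Qed.

Let LZ a t w : L (t *: a) w = t * L a w.
Proof. by rewrite -[t *: a]add0r L_lin L0 add0r. Qed.

Let LD a b w : L (a + b) w = L a w + L b w.
Proof. by rewrite -[b]scale1r L_lin scale1r mul1r. Qed.

(** A class that contains polynomials and exponentials of the linear forms, is stable under sums and
    products since exp(L v) exp(L v') = exp(L (v + v')), and consists of integrable variables. It
    justifies every exchange of sum, derivative and expectation below. *)
Definition exp_dominated (f : Omega -> R) : Prop :=
  measurable_fun [set: Omega] f /\
  exists C s, 0 <= C /\ forall w, `|f w| <= C * \sum_(v <- s) expR (L v w).

Let integrable_sum_exp (s : seq V) (C : R) :
  P.-integrable [set: Omega] (EFin \o (fun w => C * \sum_(v <- s) expR (L v w))).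
Proof.
have : P.-integrable [set: Omega] (EFin \o (fun w => \sum_(v <- s) expR (L v w))).
  elim: s => [|v s IH].
    by apply: eq_integrable (integrable0 _ _) => // w _; rewrite /= big_nil.
  by apply: eq_integrable (integrableD _ (L_int v) IH) => // w _; rewrite /= big_cons.
move=> h; apply: eq_integrable (integrableZl _ C h) => // w _.
Qed.

Lemma exp_dominated_integrable f : exp_dominated f ->
  P.-integrable [set: Omega] (EFin \o f).
Proof.
move=> [mf [C [s [C0 hf]]]]; apply: (le_integrable measurableT _ _ (integrable_sum_exp s C)).
  exact/measurable_EFinP.
by move=> w _; rewrite /= lee_fin (le_trans (hf w))// ler_norm.
Qed.

Lemma exp_dominatedM f g : exp_dominated f -> exp_dominated g ->
  exp_dominated (fun w => f w * g w).
Proof.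
move=> [mf [C [s [C0 hf]]]] [mg [C' [s' [C'0 hg]]]]; split; first exact: measurable_funM.
exists (C * C'), [seq v + v' | v <- s, v' <- s']; split; first exact: mulr_ge0.
move=> w; rewrite normrM; apply: (le_trans (ler_pM _ _ (hf w) (hg w))) => //.
rewrite mulrACA ler_wpM2l ?mulr_ge0// big_allpairs_dep mulr_suml le_eqVlt; apply/orP; left.
apply/eqP; apply: eq_bigr => v _; rewrite mulr_sumr; apply: eq_bigr => v' _.
by rewrite LD expRD.
Qed.

Lemma exp_dominatedD f g : exp_dominated f -> exp_dominated g ->
  exp_dominated (fun w => f w + g w).
Proof.
move=> [mf [C [s [C0 hf]]]] [mg [C' [s' [C'0 hg]]]]; split; first exact: measurable_funD.
exists (C + C'), (s ++ s'); split; first exact: addr_ge0.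
move=> w; apply: (le_trans (ler_normD _ _)); rewrite big_cat/= mulrDl !mulrDr.
have p (r : seq V) : 0 <= \sum_(v <- r) expR (L v w) by apply: sumr_ge0 => v _; exact: expR_ge0.
have := hf w; have := hg w; have := mulr_ge0 C0 (p s'); have := mulr_ge0 C'0 (p s).
lra.
Qed.

Lemma exp_dominated_exp a : exp_dominated (fun w => expR (L a w)).
Proof.
split; first exact: measurableT_comp.
exists 1, [:: a]; split => // w.
by rewrite big_seq1 mul1r ger0_norm ?expR_ge0.
Qed.

Lemma exp_dominated_cst (c : R) : exp_dominated (fun=> c).
Proof.
split; first exact: measurable_cst.
exists `|c|, [:: 0]; split => // w.
by rewrite big_seq1 L0 expR0 mulr1.
Qed.

Lemma exp_dominated_linear a : exp_dominated (L a).
Proof.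
split; first exact: L_meas.
exists 1, [:: a; - a]; split => // w.
by rewrite big_cons big_seq1 mul1r LN norm_le_expR.
Qed.

Lemma exp_dominated_norm f : exp_dominated f -> exp_dominated (fun w => `|f w|).
Proof.
move=> [mf [C [s [C0 hf]]]]; split; first exact: measurableT_comp.
by exists C, s; split => // w; rewrite normr_id.
Qed.

Lemma exp_dominatedX f n : exp_dominated f -> exp_dominated (fun w => f w ^+ n).
Proof.
move=> hf; elim: n => [|n IH].
  by rewrite (_ : (fun w => _) = fun=> 1) ?funeqE//; exact: exp_dominated_cst.
rewrite (_ : (fun w => _) = fun w => f w * f w ^+ n); first exact: exp_dominatedM.
by apply/funext => w; rewrite exprS.
Qed.

Lemma exp_dominated_sum (I : Type) (r : seq I) (f : I -> Omega -> R) :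
  (forall i, exp_dominated (f i)) -> exp_dominated (fun w => \sum_(i <- r) f i w).
Proof.
move=> hf; elim: r => [|i r IH].
  rewrite (_ : (fun w => _) = fun=> 0); first exact: exp_dominated_cst.
  by apply/funext => w; rewrite big_nil.
rewrite (_ : (fun w => _) = fun w => f i w + \sum_(j <- r) f j w); first exact: exp_dominatedD.
by apply/funext => w; rewrite big_cons.
Qed.

Lemma expect_cst (r : R) : \int[P]_w r = r.
Proof. by rewrite /Rintegral integral_cst//= [X in (_ * X)%E]probability_setT mule1. Qed.

Lemma expectD f g : exp_dominated f -> exp_dominated g ->
  \int[P]_w (f w + g w) = 'E f + 'E g.
Proof. by move=> hf hg; rewrite RintegralD//; exact: exp_dominated_integrable. Qed.

Lemma expectB f g : exp_dominated f -> exp_dominated g ->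
  \int[P]_w (f w - g w) = 'E f - 'E g.
Proof. by move=> hf hg; rewrite RintegralB//; exact: exp_dominated_integrable. Qed.

Lemma expectZ (c : R) f : exp_dominated f -> \int[P]_w (c * f w) = c * 'E f.
Proof. by move=> hf; rewrite RintegralZl//; exact: exp_dominated_integrable. Qed.

Lemma expect_le f g : exp_dominated f -> exp_dominated g -> (forall w, f w <= g w) ->
  'E f <= 'E g.
Proof. by move=> hf hg fg; apply: le_Rintegral => //; exact: exp_dominated_integrable. Qed.

Lemma expect_sum (I : Type) (r : seq I) (f : I -> Omega -> R) :
  (forall i, exp_dominated (f i)) ->
  \int[P]_w (\sum_(i <- r) f i w) = \sum_(i <- r) 'E (f i).
Proof.
move=> hf; elim: r => [|i r IH].
  by under eq_Rintegral do rewrite big_nil; rewrite big_nil Rintegral_cst// mul0r.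
under eq_Rintegral do rewrite big_cons.
by rewrite expectD// ?IH ?big_cons//; exact: exp_dominated_sum.
Qed.

Lemma expect_derive f b : exp_dominated f ->
  is_derive (0 : R) 1 (fun t => \int[P]_w (f w * expR (t * L b w))) (\int[P]_w (f w * L b w)).
Proof.
move=> hf.
(* Dominates the second-order Taylor remainder for |t| <= 1, where exp|t L b| <= exp(L b) + exp(-L
   b); its expectation is the constant of the quadratic error. *)
pose g w := `|f w| * (L b w ^+ 2 * (expR (L b w) + expR (L (- b) w))).
have hg : exp_dominated g.
  apply: exp_dominatedM; first exact: exp_dominated_norm.
  apply: exp_dominatedM; first exact/exp_dominatedX/exp_dominated_linear.
  by apply: exp_dominatedD; exact: exp_dominated_exp.
have hfe t : exp_dominated (fun w => f w * expR (t * L b w)).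
  rewrite (_ : (fun w => _) = fun w => f w * expR (L (t *: b) w)).
    by apply: exp_dominatedM => //; exact: exp_dominated_exp.
  by apply/funext => w; rewrite LZ.
have hfL : exp_dominated (fun w => f w * L b w).
  by apply: exp_dominatedM => //; exact: exp_dominated_linear.
apply: (@is_derive0_of_quadratic_error _ _ _ ('E g)) => t t1.
have hB : exp_dominated (fun w => f w * expR (t * L b w) - f w * expR (0 * L b w)).
  rewrite (_ : (fun w => _) = fun w => f w * expR (t * L b w) + (-1) * (f w * expR (0 * L b w))).
    by apply: exp_dominatedD => //; apply: exp_dominatedM => //; exact: exp_dominated_cst.
  by apply/funext => w; rewrite mulN1r.
have htL : exp_dominated (fun w => t * (f w * L b w)).
  by apply: exp_dominatedM => //; exact: exp_dominated_cst.
rewrite -expectB// -expectZ// -expectB// mulrC -expectZ//.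
have hBt : exp_dominated (fun w => f w * expR (t * L b w) - f w * expR (0 * L b w)
    - t * (f w * L b w)).
  rewrite (_ : (fun w => _) = fun w => (f w * expR (t * L b w) - f w * expR (0 * L b w))
      + (- t) * (f w * L b w)).
    by apply: exp_dominatedD => //; apply: exp_dominatedM => //; exact: exp_dominated_cst.
  by apply/funext => w; rewrite mulNr.
apply: (le_trans (le_normr_Rintegral _ (exp_dominated_integrable hBt))) => //.
apply: expect_le; first exact: exp_dominated_norm.
  by apply: exp_dominatedM => //; exact: exp_dominated_cst.
move=> w; rewrite mul0r expR0.
have -> : f w * expR (t * L b w) - f w * 1 - t * (f w * L b w) =
  f w * (expR (t * L b w) - 1 - t * L b w) by ring.
rewrite normrM /g LN mulrCA; apply: ler_wpM2l => //.
apply: (le_trans (expR_taylor1 _)).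
rewrite exprMn -mulrA ler_wpM2l ?sqr_ge0// ler_wpM2l ?sqr_ge0//.
apply: le_trans (expR_norm_le _).
by rewrite ler_expR normrM ler_piMl.
Qed.

Definition lin_prod (bs : seq V) (w : Omega) : R := \prod_(b <- bs) L b w.

(* The derivative of [lin_prod bs] along the Cameron-Martin direction of [c]. *)
Fixpoint dlin_prod (c : V) (bs : seq V) (w : Omega) : R :=
  if bs is b :: bs' then q c b * lin_prod bs' w + L b w * dlin_prod c bs' w else 0.

Lemma exp_dominated_lin_prod bs : exp_dominated (lin_prod bs).
Proof.
elim: bs => [|b bs IH].
  rewrite (_ : lin_prod _ = fun=> 1); first exact: exp_dominated_cst.
  by apply/funext => w; rewrite /lin_prod big_nil.
rewrite (_ : lin_prod _ = fun w => L b w * lin_prod bs w).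
  by apply: exp_dominatedM => //; exact: exp_dominated_linear.
by apply/funext => w; rewrite /lin_prod big_cons.
Qed.

Lemma exp_dominated_dlin_prod c bs : exp_dominated (dlin_prod c bs).
Proof.
elim: bs => [|b bs IH] /=; first exact: exp_dominated_cst.
apply: exp_dominatedD; apply: exp_dominatedM => //.
- exact: exp_dominated_cst.
- exact: exp_dominated_lin_prod.
- exact: exp_dominated_linear.
Qed.

Let qD (a c : V) t : q (a + t *: c) (a + t *: c) = q a a + 2 * (t * q a c) + t ^+ 2 * q c c.
Proof. by rewrite q_lin (q_sym _ a) (q_sym _ c) !q_lin (q_sym c a); ring. Qed.

(** Two computations of the derivative at t = 0 of E exp(L (a + t c)): under the expectation, and
    from the closed form [L_mgf]. *)
Let wick_exp_nil c a :
  \int[P]_w (L c w * expR (L a w)) = q c a * \int[P]_w expR (L a w).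
Proof.
have D1 := expect_derive c (exp_dominated_exp a).
have D2 := is_derive_expR_quadratic (q a a / 2) (q a c) (q c c / 2).
have E : (fun t => \int[P]_w (expR (L a w) * expR (t * L c w))) =
    (fun t => expR (q a a / 2 + t * q a c + t ^+ 2 * (q c c / 2))).
  apply/funext => t.
  transitivity (\int[P]_w expR (L (a + t *: c) w)).
    by apply: eq_Rintegral => w _; rewrite L_lin expRD.
  by rewrite L_mgf qD; congr expR; field.
rewrite L_mgf (q_sym c a) -(@derive_val _ _ _ _ _ _ _ D2) -E (@derive_val _ _ _ _ _ _ _ D1).
by apply: eq_Rintegral => w _; rewrite mulrC.
Qed.

(* Integration by parts for the tilted weight [expR (L a)]: a factor [L b] is
   produced by differentiating the identity in the direction [b] of [a]. *)
Lemma wick_exp bs c a :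
  \int[P]_w (L c w * lin_prod bs w * expR (L a w)) =
  q c a * \int[P]_w (lin_prod bs w * expR (L a w)) +
  \int[P]_w (dlin_prod c bs w * expR (L a w)).
Proof.
elim: bs a => [|b bs IH] a.
  under eq_Rintegral do rewrite /lin_prod big_nil mulr1.
  rewrite wick_exp_nil; under [in RHS]eq_Rintegral do rewrite /lin_prod big_nil mul1r.
  rewrite [X in _ + X](_ : _ = 0) ?addr0//.
  by under eq_Rintegral do rewrite /= mul0r; rewrite expect_cst.
have hp := exp_dominated_lin_prod bs.
have hd := exp_dominated_dlin_prod c bs.
have he := exp_dominated_exp a.
have hc := exp_dominated_linear c.
have hb := exp_dominated_linear b.
have hcp := exp_dominatedM (exp_dominatedM hc hp) he.
have hpe := exp_dominatedM hp he.
have hde := exp_dominatedM hd he.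
have D1 := expect_derive b hcp.
have D2 := expect_derive b hpe.
have D3 := expect_derive b hde.
have D4 := is_deriveD (is_deriveM (is_derive_affine (q c a) (q c b)) D2) D3.
(* The induction hypothesis at [a + t *: b], read as an identity between functions of t; its
   derivative at 0 is computed by [D1] on the left and by [D4] on the right. *)
have E : (fun t => \int[P]_w (L c w * lin_prod bs w * expR (L a w) * expR (t * L b w))) =
  (fun t => q c a + t * q c b) * (fun t => \int[P]_w (lin_prod bs w * expR (L a w) * expR (t * L b w)))
  + (fun t => \int[P]_w (dlin_prod c bs w * expR (L a w) * expR (t * L b w))).
  apply/funext => t; rewrite -[RHS]/((q c a + t * q c b) * \int[P]_w (lin_prod bs w * expR (L a w) * expR (t * L b w)) + \int[P]_w (dlin_prod c bs w * expR (L a w) * expR (t * L b w))) -q_lin.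
  have S (f : Omega -> R) : \int[P]_w (f w * expR (L a w) * expR (t * L b w)) =
      \int[P]_w (f w * expR (L (a + t *: b) w)).
    by apply: eq_Rintegral => w _; rewrite L_lin expRD mulrA.
  rewrite (S (fun w => L c w * lin_prod bs w)) (S (lin_prod bs)) (S (dlin_prod c bs)).
  exact: IH.
have := @derive_val _ _ _ _ _ _ _ D1; rewrite E (@derive_val _ _ _ _ _ _ _ D4) => e.
transitivity (\int[P]_w (L c w * lin_prod bs w * expR (L a w) * L b w)).
  by apply: eq_Rintegral => w _; rewrite /lin_prod big_cons; ring.
rewrite -e /GRing.scale/= mul0r addr0.
transitivity (q c a * \int[P]_w (lin_prod bs w * expR (L a w) * L b w) +
   (q c b * \int[P]_w (lin_prod bs w * expR (L a w)) +
    \int[P]_w (dlin_prod c bs w * expR (L a w) * L b w))).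
  rewrite addrA; congr (_ + _); congr (_ + _); rewrite mulrC; congr (_ * _).
  by apply: eq_Rintegral => w _; rewrite mul0r expR0 mulr1.
congr (_ + _); first congr (_ * _).
  by apply: eq_Rintegral => w _; rewrite /lin_prod big_cons; ring.
rewrite -expectZ// -expectD.
- by apply: eq_Rintegral => w _ /=; ring.
- by apply: exp_dominatedM => //; exact: exp_dominated_cst.
- exact: exp_dominatedM.
Qed.

Lemma wick bs c : \int[P]_w (L c w * lin_prod bs w) = \int[P]_w dlin_prod c bs w.
Proof.
have q0 : q c 0 = 0 by have := q_lin c 0 0 1; rewrite scaler0 addr0; lra.
have S (f : Omega -> R) : \int[P]_w f w = \int[P]_w (f w * expR (L 0 w)).
  by apply: eq_Rintegral => w _; rewrite L0 expR0 mulr1.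
by rewrite S [RHS]S wick_exp q0 mul0r add0r.
Qed.

(* [g] is the derivative of the polynomial [f] in the direction of [c]; the test
   products [bs] make the relation stable under multiplication by linear forms. *)
Definition stein (c : V) (f g : Omega -> R) : Prop :=
  [/\ exp_dominated f, exp_dominated g & forall bs,
    \int[P]_w (L c w * f w * lin_prod bs w) =
    \int[P]_w (g w * lin_prod bs w + f w * dlin_prod c bs w)].

Lemma stein1 c : stein c (fun=> 1) (fun=> 0).
Proof.
split=> [||bs]; [exact: exp_dominated_cst..|].
under eq_Rintegral do rewrite mulr1; rewrite wick.
by apply: eq_Rintegral => w _; rewrite mul0r add0r mul1r.
Qed.

(** The relation for f tested against [b :: bs] is the new relation tested against [bs]: the factor
    [L b] changes sides. *)
Lemma steinM c f g b : stein c f g ->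
  stein c (fun w => f w * L b w) (fun w => g w * L b w + f w * q c b).
Proof.
move=> [hf hg h]; split.
- by apply: exp_dominatedM => //; exact: exp_dominated_linear.
- apply: exp_dominatedD; apply: exp_dominatedM => //.
    exact: exp_dominated_linear.
  exact: exp_dominated_cst.
- move=> bs; have := h (b :: bs) => /= e.
  transitivity (\int[P]_w (L c w * f w * lin_prod (b :: bs) w)).
    by apply: eq_Rintegral => w _; rewrite /lin_prod big_cons; ring.
  by rewrite e; apply: eq_Rintegral => w _; rewrite /lin_prod big_cons; ring.
Qed.

Let stein_dom c f g bs : exp_dominated f -> exp_dominated g ->
  exp_dominated (fun w => L c w * f w * lin_prod bs w) /\
  exp_dominated (fun w => g w * lin_prod bs w + f w * dlin_prod c bs w).
Proof.
move=> hf hg; have hp := exp_dominated_lin_prod bs; split.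
  apply: exp_dominatedM => //; apply: exp_dominatedM => //; exact: exp_dominated_linear.
apply: exp_dominatedD; first exact: exp_dominatedM.
apply: exp_dominatedM => //; exact: exp_dominated_dlin_prod.
Qed.

Lemma steinD c f g f' g' : stein c f g -> stein c f' g' ->
  stein c (fun w => f w + f' w) (fun w => g w + g' w).
Proof.
move=> [hf hg h] [hf' hg' h']; split; [exact: exp_dominatedD..|].
move=> bs; have [d1 d2] := stein_dom c bs hf hg; have [d3 d4] := stein_dom c bs hf' hg'.
transitivity (\int[P]_w (L c w * f w * lin_prod bs w) + \int[P]_w (L c w * f' w * lin_prod bs w)).
  by rewrite -expectD//; apply: eq_Rintegral => w _; ring.
by rewrite h h' -expectD//; apply: eq_Rintegral => w _; ring.
Qed.

Lemma steinZ c r f g : stein c f g -> stein c (fun w => r * f w) (fun w => r * g w).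
Proof.
move=> [hf hg h]; split=> [||bs]; [apply: exp_dominatedM => //; exact: exp_dominated_cst..|].
have [d1 d2] := stein_dom c bs hf hg.
transitivity (r * \int[P]_w (L c w * f w * lin_prod bs w)).
  by rewrite -expectZ//; apply: eq_Rintegral => w _; ring.
by rewrite h -expectZ//; apply: eq_Rintegral => w _; ring.
Qed.

Lemma stein_ext c f g f' g' : f =1 f' -> g =1 g' -> stein c f g -> stein c f' g'.
Proof. by move=> /funext <- /funext <-. Qed.

Lemma stein_sum c (I : Type) (r : seq I) (f g : I -> Omega -> R) :
  (forall i, stein c (f i) (g i)) ->
  stein c (fun w => \sum_(i <- r) f i w) (fun w => \sum_(i <- r) g i w).
Proof.
move=> h; elim: r => [|i r IH].
  apply: stein_ext (steinZ 0 (stein1 c)) => w; by rewrite big_nil mul0r.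
by apply: stein_ext (steinD (h i) IH) => w; rewrite big_cons.
Qed.

Lemma stein_expect c f g b : stein c f g ->
  \int[P]_w (L c w * f w * L b w) = \int[P]_w (g w * L b w) + q c b * \int[P]_w f w.
Proof.
move=> h; have [hf hg _] := h; have := steinM b h => -[_ _ /(_ [::])].
have -> : \int[P]_w (L c w * (f w * L b w) * lin_prod [::] w) =
    \int[P]_w (L c w * f w * L b w).
  by apply: eq_Rintegral => w _; rewrite /lin_prod big_nil; ring.
move=> ->; rewrite -expectZ// -expectD.
- by apply: eq_Rintegral => w _; rewrite /lin_prod /= big_nil; ring.
- by apply: exp_dominatedM => //; exact: exp_dominated_linear.
- by apply: exp_dominatedM => //; exact: exp_dominated_cst.
Qed.

Lemma stein_power c m : stein c (fun w => L c w ^+ m) (fun w => m%:R * q c c * L c w ^+ m.-1).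
Proof.
elim: m => [|m IH]; first by apply: stein_ext (stein1 c) => w; rewrite ?mul0r.
apply: stein_ext (steinM c IH) => w; first by rewrite exprSr.
rewrite -natr1 /=; case: m {IH} => [|m] /=; first by rewrite !expr0; ring.
by rewrite [L c w ^+ m.+1]exprS; ring.
Qed.

(** Integration by parts gives E L^(2p+2) = (2p+1) q E L^(2p). Bounding every factor 2p + 1 by the
    fixed 2N gives a pure power, so N stays constant while p runs through the induction. *)
Lemma gaussian_even_moment_le c N p : (p <= N)%N ->
  \int[P]_w (L c w ^+ (2 * p)) <= (2 * N%:R * q c c) ^+ p.
Proof.
(* The form [q] is abstract; the Stein relation for the constant 1 identifies [q c c] with a second
   moment, whence its sign. *)
have qE : q c c = \int[P]_w (L c w ^+ 2).
  have := stein_expect c (stein1 c); under eq_Rintegral do rewrite mulr1 -expr2.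
  move=> ->; under eq_Rintegral do rewrite mul0r.
  by rewrite !expect_cst add0r mulr1.
have q0 : 0 <= q c c by rewrite qE; apply: Rintegral_ge0 => w _; exact: sqr_ge0.
elim: p => [_|p IH pN].
  under eq_Rintegral do rewrite expr0.
  by rewrite expect_cst.
have -> : \int[P]_w (L c w ^+ (2 * p.+1)) = (2 * p + 1)%:R * q c c * \int[P]_w (L c w ^+ (2 * p)).
  have := stein_expect c (stein_power c (2 * p)).
  have -> : \int[P]_w (L c w * L c w ^+ (2 * p) * L c w) = \int[P]_w (L c w ^+ (2 * p.+1)).
    by apply: eq_Rintegral => w _; rewrite -exprS -exprSr mulnS.
  move=> ->; rewrite -expectZ; last exact/exp_dominatedX/exp_dominated_linear.
  rewrite -expectZ; last exact/exp_dominatedX/exp_dominated_linear.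
  rewrite -expectD; last first.
    apply: exp_dominatedM; [exact: exp_dominated_cst|exact/exp_dominatedX/exp_dominated_linear].
    apply: exp_dominatedM; last exact: exp_dominated_linear.
    apply: exp_dominatedM; [exact: exp_dominated_cst|exact/exp_dominatedX/exp_dominated_linear].
  apply: eq_Rintegral => w _; case: p {IH pN} => [|p]; first by rewrite muln0/=; ring.
  have -> : (2 * p.+1 = (2 * p).+2)%N by rewrite mulnS.
  by rewrite natrD /= !exprS; ring.
rewrite exprS; apply: ler_pM.
- by rewrite mulr_ge0.
- by apply: Rintegral_ge0 => w _; rewrite mulnC exprM sqr_ge0.
- rewrite ler_wpM2r// -natrM ler_nat.
  by rewrite addn1 -[X in (X <= _)%N]/((2 * p).+1) (leq_trans (_ : (2 * p).+1 <= 2 * p.+1)%N)// ?leq_mul2l// mulnS addSn.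
- exact: IH (ltnW pN).
Qed.

Section quadratic_form.
Variables (v : nat -> V) (k : nat) (lam : R).
Hypothesis lam_ge : forall i, (i < k)%N -> \sum_(0 <= j < k) `|q (v i) (v j)| <= lam.
Hypothesis lam0 : 0 <= lam.

Let tau : R := \sum_(0 <= i < k) q (v i) (v i).
Let Q (w : Omega) : R := \sum_(0 <= i < k) L (v i) w ^+ 2 - tau.
(** The derivative of [Q] along [c] in the sense of [stein]. *)
Let DQ (c : V) (w : Omega) : R := \sum_(0 <= i < k) 2 * q c (v i) * L (v i) w.

Let stein_Q c f g : stein c f g ->
  stein c (fun w => f w * Q w) (fun w => g w * Q w + f w * DQ c w).
Proof.
move=> h.
have h2 i := steinM (v i) (steinM (v i) h).
have := steinD (stein_sum (index_iota 0 k) h2) (steinZ (- tau) h).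
apply: stein_ext => w.
  rewrite /Q mulrBr mulr_sumr mulNr (mulrC tau); congr (_ - _).
  by apply: eq_bigr => i _; rewrite -mulrA -expr2.
rewrite /Q /DQ mulrBr !mulr_sumr mulNr (mulrC tau) [RHS]addrAC -big_split/=.
congr (_ - _); last by rewrite mulr_sumr.
by apply: eq_bigr => i _; ring.
Qed.

Let stein_QX c m : stein c (fun w => Q w ^+ m) (fun w => m%:R * Q w ^+ m.-1 * DQ c w).
Proof.
elim: m => [|m IH]; first by apply: stein_ext (stein1 c) => w; rewrite ?mul0r.
apply: stein_ext (stein_Q IH) => w; first by rewrite exprSr.
rewrite -natr1 /=; case: m {IH} => [|m] /=; first by rewrite !expr0; ring.
by rewrite [Q w ^+ m.+1]exprS; ring.
Qed.

(** The Schur test: a symmetric matrix whose absolute row sums are at most [lam] defines a quadratic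
    form bounded by [lam] times the squared Euclidean norm, and this norm is [Q w + tau]. *)
Let schur w : \sum_(0 <= i < k) DQ (v i) w * L (v i) w <= 2 * lam * (Q w + tau).
Proof.
rewrite /Q subrK /DQ; pose l i := L (v i) w.
have -> : \sum_(0 <= i < k) (\sum_(0 <= j < k) 2 * q (v i) (v j) * L (v j) w) * L (v i) w =
  \sum_(0 <= i < k) \sum_(0 <= j < k) 2 * q (v i) (v j) * (l j * l i).
  by apply: eq_bigr => i _; rewrite mulr_suml; apply: eq_bigr => j _; rewrite mulrA.
(* AM-GM: 2 x y <= x^2 + y^2 *)
apply: (@le_trans _ _ (\sum_(0 <= i < k) \sum_(0 <= j < k)
    (`|q (v i) (v j)| * l i ^+ 2 + `|q (v i) (v j)| * l j ^+ 2))).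
  apply: ler_sum => i _; apply: ler_sum => j _.
  rewrite -mulrDr; apply: (le_trans (ler_norm _)).
  rewrite -mulrA mulrCA normrM ler_wpM2l// ler_norml.
  have := sqr_ge0 (l i - l j); have := sqr_ge0 (l i + l j); rewrite sqrrB sqrrD.
  by nra.
rewrite [leLHS](_ : _ = \sum_(0 <= i < k) \sum_(0 <= j < k) `|q (v i) (v j)| * l i ^+ 2 *+ 2);
  last first.
  under eq_bigr do rewrite big_split/=.
  rewrite big_split/= [X in _ + X]exchange_big/=.
  rewrite -big_split/=; apply: eq_bigr => i _; rewrite -big_split/=; apply: eq_bigr => j _.
  by rewrite (q_sym (v j)) mulr2n.
rewrite mulr_sumr; apply: ler_sum_nat => i /andP[_ ik].
under eq_bigr do rewrite -mulrnAr.
rewrite -mulr_suml -mulr_natl mulrA (mulrC _ 2) ler_wpM2r ?sqr_ge0//.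
by rewrite ler_wpM2l// lam_ge.
Qed.

Let exp_dominated_Q : exp_dominated Q.
Proof. by have [+ _ _] := stein_Q (stein1 0); rewrite (_ : (fun=> _) = Q)// funeqE => w; rewrite mul1r. Qed.

Let exp_dominated_DQ c : exp_dominated (DQ c).
Proof.
apply: exp_dominated_sum => i; apply: exp_dominatedM; first exact: exp_dominated_cst.
exact: exp_dominated_linear.
Qed.

(** One factor [Q] is written out as the sum of L_i L_i minus [tau], and the first L_i is integrated
    by parts. The derivative of the second L_i gives [q (v i) (v i)], and these cancel [tau]; the
    rest falls on Q^(m+1). *)
Let Q_recursion m : \int[P]_w (Q w ^+ m.+2) =
  m.+1%:R * \int[P]_w (Q w ^+ m * \sum_(0 <= i < k) DQ (v i) w * L (v i) w).
Proof.
have dL i := exp_dominated_linear (v i).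
have dQ n := exp_dominatedX n exp_dominated_Q.
have dLQL i : exp_dominated (fun w => L (v i) w * Q w ^+ m.+1 * L (v i) w).
  by apply: exp_dominatedM => //; exact: exp_dominatedM.
have dQDQ i : exp_dominated (fun w => m.+1%:R * Q w ^+ m * DQ (v i) w * L (v i) w).
  apply: exp_dominatedM => //; apply: exp_dominatedM => //.
  by apply: exp_dominatedM => //; exact: exp_dominated_cst.
transitivity (\int[P]_w (\sum_(0 <= i < k) L (v i) w * Q w ^+ m.+1 * L (v i) w - tau * Q w ^+ m.+1)).
  apply: eq_Rintegral => w _; rewrite exprS {1}/Q mulrBl mulr_suml; congr (_ - _).
  by apply: eq_bigr => i _; ring.
rewrite expectB; [|exact: exp_dominated_sum|by apply: exp_dominatedM => //; exact: exp_dominated_cst].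
rewrite expect_sum// expectZ//.
under eq_bigr do rewrite (stein_expect _ (stein_QX _ _)).
rewrite big_split/= -mulr_suml addrK -expect_sum// -expectZ.
  by apply: eq_Rintegral => w _; rewrite mulrA mulr_sumr; apply: eq_bigr => i _; ring.
apply: exp_dominatedM => //; apply: exp_dominated_sum => i.
exact: exp_dominatedM.
Qed.

(** With c = 4 N lam, which is at least 2 lam (2p+1), the recursion and [schur] give E Q^(2p+2) <= c
    E[Q^(2p) (Q + tau)]; even powers keep the sign. The product c Q is split so that half of E
    Q^(2p+2) is absorbed on the left, leaving the factor c^2 + 2 c tau. *)
Lemma quadratic_form_moment_le N p : (p <= N)%N ->
  \int[P]_w (Q w ^+ (2 * p)) <= ((4 * N%:R * lam) ^+ 2 + 2 * (4 * N%:R * lam) * tau) ^+ p.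
Proof.
have tau0 : 0 <= tau.
  apply: sumr_ge0 => i _; have := stein_expect (v i) (stein1 (v i)).
  under eq_Rintegral do rewrite mulr1 -expr2.
  under [in RHS]eq_Rintegral do rewrite mul0r.
  rewrite !expect_cst add0r mulr1 => <-; apply: Rintegral_ge0 => w _; exact: sqr_ge0.
have dQ n := exp_dominatedX n exp_dominated_Q.
elim: p => [_|p IH pN]; first by under eq_Rintegral do rewrite expr0; rewrite expect_cst.
set c := 4 * N%:R * lam.
have c0 : 0 <= c by rewrite mulr_ge0.
have I0 : 0 <= \int[P]_w (Q w ^+ (2 * p)).
  by apply: Rintegral_ge0 => w _; rewrite mulnC exprM sqr_ge0.
have dcst (r : R) f : exp_dominated f -> exp_dominated (fun w => r * f w).
  by move=> hf; apply: exp_dominatedM => //; exact: exp_dominated_cst.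
(* AM-GM: c Q <= (Q^2 + c^2) / 2 *)
have h : \int[P]_w (Q w ^+ (2 * p.+1)) <=
    2^-1 * \int[P]_w (Q w ^+ (2 * p.+1)) +
    (2^-1 * c ^+ 2 + c * tau) * \int[P]_w (Q w ^+ (2 * p)).
  rewrite -!expectZ// -expectD; [|exact: dcst..].
  have -> : (2 * p.+1 = (2 * p).+2)%N by rewrite mulnS.
  rewrite Q_recursion -expectZ; last first.
    apply: exp_dominatedM => //; apply: exp_dominated_sum => i.
    by apply: exp_dominatedM => //; exact: exp_dominated_linear.
  apply: expect_le.
  - apply: dcst; apply: exp_dominatedM => //; apply: exp_dominated_sum => i.
    by apply: exp_dominatedM => //; exact: exp_dominated_linear.
  - by apply: exp_dominatedD; exact: dcst.
  move=> w; have Q0 : 0 <= Q w ^+ (2 * p) by rewrite mulnC exprM sqr_ge0.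
  rewrite !exprS; set X := Q w ^+ (2 * p) in Q0 *.
  apply: (@le_trans _ _ ((2 * p).+1%:R * (X * (2 * lam * (Q w + tau))))).
    by rewrite ler_wpM2l// ler_wpM2l// schur.
  have Qt : 0 <= Q w + tau by rewrite subrK; apply: sumr_ge0 => i _; exact: sqr_ge0.
  have cp : (2 * p).+1%:R * (2 * lam) <= c.
    by rewrite /c mulrA ler_wpM2r// -!natrM ler_nat; lia.
  apply: (@le_trans _ _ (c * (X * (Q w + tau)))).
    have -> : (2 * p).+1%:R * (X * (2 * lam * (Q w + tau))) =
       (2 * p).+1%:R * (2 * lam) * (X * (Q w + tau)) by ring.
    by rewrite ler_wpM2r// mulr_ge0.
  have := mulr_ge0 Q0 (sqr_ge0 (Q w - c)).
  by rewrite sqrrB; nra.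
rewrite exprS; apply: (@le_trans _ _ ((c ^+ 2 + 2 * c * tau) * \int[P]_w (Q w ^+ (2 * p)))).
  by move: h; set A := \int[P]_w _; set B := \int[P]_w _; nra.
rewrite ler_wpM2l ?IH ?(ltnW pN)//.
by rewrite addr_ge0 ?sqr_ge0// mulr_ge0// mulr_ge0.
Qed.
End quadratic_form.
End gaussian_calculus.

(** * From Gaussian laws to moment generating functions and covariances *)

Lemma ge0_integral_normal_prob {R : realType} (m sigma : R) (f : R -> \bar R) :
  (forall x, (0 <= f x)%E) -> measurable_fun [set: R] f ->
  (\int[normal_prob m sigma]_x f x =
   \int[lebesgue_measure]_x (f x * (normal_pdf m sigma x)%:E))%E.
Proof.
move=> f0 mf.
have dom := normal_prob_dominates m sigma.
rewrite -(Radon_Nikodym_SigmaFinite.change_of_variables dom f0 measurableT mf).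
have mpdf : measurable_fun [set: R] (fun x => (normal_pdf m sigma x)%:E).
  by apply/measurable_EFinP; exact: measurable_normal_pdf.
have mRN : measurable_fun [set: R] (Radon_Nikodym_SigmaFinite.f (normal_prob m sigma) lebesgue_measure).
  exact: measurable_int (Radon_Nikodym_SigmaFinite.f_integrable dom).
(* Both functions have the same integral over every measurable set, which identifies the
   Radon-Nikodym derivative with the normal density almost everywhere. *)
have RN : ae_eq lebesgue_measure [set: R]
    (Radon_Nikodym_SigmaFinite.f (normal_prob m sigma) lebesgue_measure)
    (fun x => (normal_pdf m sigma x)%:E).
  apply: integral_ae_eq => //.
    exact: (Radon_Nikodym_SigmaFinite.f_integrable dom).
  by move=> A _ mA; rewrite -(Radon_Nikodym_SigmaFinite.f_integral dom).
apply: ae_eq_integral => //; try exact: emeasurable_funM.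
by apply: filterS RN => x /= h xT; rewrite h.
Qed.

Lemma normal_prob_mgf {R : realType} (m sigma s : R) : sigma != 0 ->
  (\int[normal_prob m sigma]_x (expR (s * x))%:E = (expR (s * m + s ^+ 2 * sigma ^+ 2 / 2))%:E)%E.
Proof.
move=> s0; rewrite ge0_integral_normal_prob; last 2 first.
- by move=> x; rewrite lee_fin expR_ge0.
- by apply/measurable_EFinP; apply: measurableT_comp => //; exact: mulrl_measurable.
pose c := expR (s * m + s ^+ 2 * sigma ^+ 2 / 2).
transitivity (\int[lebesgue_measure]_x (c%:E * (normal_pdf (m + s * sigma ^+ 2) sigma x)%:E))%E.
  apply: eq_integral => x _; rewrite -!EFinM; congr EFin.
  (* completing the square *)
  rewrite !normal_pdfE// mulrCA [RHS]mulrCA; congr (_ * _).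
  by rewrite /normal_fun /c -!expRD; congr expR; field.
rewrite integralZl//; last exact: integrable_normal_pdf.
by rewrite integral_normal_pdf mule1.
Qed.

(** Point masses and normal laws obey the same formula, with variance sigma^2, so the case
    distinction in [gaussian_law] disappears from here on. *)
Lemma gaussian_law_mgf {R : realType} {d} {Omega : measurableType d} (P : probability Omega R)
    (X : Omega -> R) : measurable_fun [set: Omega] X ->
  gaussian_law (pushforward P X) ->
  exists m v : R, forall s : R,
    (\int[P]_w (expR (s * X w))%:E = (expR (s * m + s ^+ 2 * v / 2))%:E)%E.
Proof.
move=> mX [m [sigma [sigma0 law]]]; exists m, (sigma ^+ 2) => s.
pose X' : Omega -> measurableTypeR R := X.
have mX' : measurable_fun [set: Omega] X' by exact: mX.
pose f (x : measurableTypeR R) : \bar R := (expR (s * (x : R)))%:E.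
have mf : measurable_fun [set: measurableTypeR R] f.
  by apply/measurable_EFinP; apply: measurableT_comp => //; exact: mulrl_measurable.
have f0 x : (0 <= f x)%E by rewrite lee_fin expR_ge0.
have -> : (\int[P]_w (expR (s * X w))%:E = \int[pushforward P X']_x f x)%E.
  by rewrite ge0_integral_pushforward// preimage_setT.
have [sz|sz] := eqVneq sigma 0.
  rewrite (eq_measure_integral (\d_(m : measurableTypeR R))); last first.
    by move=> A mA _; have := law A mA; rewrite sz eqxx.
  by rewrite integral_dirac// diracT mul1e sz expr0n/= mulr0 mul0r addr0.
rewrite (eq_measure_integral (normal_prob m sigma)); last first.
  by move=> A mA _; have := law A mA; rewrite (negbTE sz).
exact: normal_prob_mgf.
Qed.

Section gaussian_space.
Context {R : realType} {d : measure_display} {Omega : measurableType d}.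
Variable P : probability Omega R.
Context {V : lmodType R}.
Variable L : V -> Omega -> R.
Hypothesis L_lin : forall (a b : V) t w, L (a + t *: b) w = L a w + t * L b w.
Hypothesis L_meas : forall a, measurable_fun [set: Omega] (L a).
Hypothesis L_gauss : forall a, gaussian_law (pushforward P (L a)).
Hypothesis L_mean : forall a, \int[P]_w L a w = 0.

Definition second_moment (a b : V) : R := \int[P]_w (L a w * L b w).

Lemma gaussian_space_integrable a :
  P.-integrable [set: Omega] (EFin \o (fun w => expR (L a w))).
Proof.
have [m [v /(_ 1)]] := gaussian_law_mgf (L_meas a) (L_gauss a).
under eq_integral do rewrite mul1r.
move=> e; apply/integrableP; split.
  by apply/measurable_EFinP; apply: measurableT_comp => //; exact: L_meas.
under eq_integral do rewrite /= ger0_norm ?expR_ge0//.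
by rewrite e ltry.
Qed.

Let L_int := gaussian_space_integrable.

Lemma second_momentC a b : second_moment a b = second_moment b a.
Proof. by apply: eq_Rintegral => w _; rewrite mulrC. Qed.

Let dL a : exp_dominated L (L a).
Proof. exact: exp_dominated_linear. Qed.

Let dLL a b : exp_dominated L (fun w => L a w * L b w).
Proof. exact: exp_dominatedM. Qed.

Lemma second_moment_lin c a b t :
  second_moment c (a + t *: b) = second_moment c a + t * second_moment c b.
Proof.
rewrite /second_moment -(expectZ L_int)// -(expectD L_int)//.
  by apply: eq_Rintegral => w _; rewrite L_lin; ring.
by apply: exp_dominatedM => //; exact: exp_dominated_cst.
Qed.

(** The law provides the formula with unknown parameters m and v. The first derivative at 0 and
    [L_mean] give m = 0; the second derivative identifies v with the second moment. *)
Lemma gaussian_space_mgf a : \int[P]_w expR (L a w) = expR (second_moment a a / 2).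
Proof.
have [m [v mgf']] := gaussian_law_mgf (L_meas a) (L_gauss a).
have mgf t : \int[P]_w expR (t * L a w) = expR (0 + t * m + t ^+ 2 * (v / 2)).
  by rewrite /Rintegral mgf' add0r mulrA.
(* The first derivative at an arbitrary t, obtained as a derivative at 0 by shifting t to t + s;
   differentiating this formula once more gives v. *)
have tilt t : \int[P]_w (expR (t * L a w) * L a w) =
    (m + t * v) * expR (0 + t * m + t ^+ 2 * (v / 2)).
  have de : exp_dominated L (fun w => expR (t * L a w)).
    rewrite (_ : (fun w => _) = fun w => expR (L (0 + t *: a) w)).
      exact: exp_dominated_exp.
    apply/funext => w; rewrite L_lin; congr expR.
    by have := L_lin 0 0 1 w; rewrite scaler0 addr0; lra.
  have D1 := expect_derive L_lin L_meas L_int a de.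
  have D2 := is_derive_expR_quadratic (0 + t * m + t ^+ 2 * (v / 2)) (m + t * v) (v / 2).
  have E : (fun s => \int[P]_w (expR (t * L a w) * expR (s * L a w))) =
      (fun s => expR (0 + t * m + t ^+ 2 * (v / 2) + s * (m + t * v) + s ^+ 2 * (v / 2))).
    apply/funext => s; transitivity (\int[P]_w expR ((t + s) * L a w)).
      by apply: eq_Rintegral => w _; rewrite -expRD mulrDl.
    by rewrite mgf; congr expR; field.
  by rewrite -(@derive_val _ _ _ _ _ _ _ D2) -E (@derive_val _ _ _ _ _ _ _ D1).
have m0 : m = 0.
  have := tilt 0.
  have -> : (m + 0 * v) * expR (0 + 0 * m + 0 ^+ 2 * (v / 2)) = m.
    by rewrite expr0n/= !mul0r !addr0 expR0 mulr1.
  move=> <-.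
  by rewrite -[RHS](L_mean a); apply: eq_Rintegral => w _; rewrite mul0r expR0 mul1r.
have vE : second_moment a a = v.
  have D1 := expect_derive L_lin L_meas L_int a (dL a).
  have D2 := is_deriveM (is_derive_affine m v) (is_derive_expR_quadratic 0 m (v / 2)).
  have E : (fun t => \int[P]_w (L a w * expR (t * L a w))) =
      (fun t => m + t * v) * (fun t : R => expR (0 + t * m + t ^+ 2 * (v / 2))).
    apply/funext => t.
    rewrite -[RHS]/((m + t * v) * expR (0 + t * m + t ^+ 2 * (v / 2))) -tilt.
    by apply: eq_Rintegral => w _; rewrite mulrC.
  rewrite /second_moment -(@derive_val _ _ _ _ _ _ _ D1) E (@derive_val _ _ _ _ _ _ _ D2).
  rewrite /GRing.scale/= m0.
  by rewrite !mul0r !mulr0 expr0n/= mul0r !addr0 expR0 mul1r add0r.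
have := mgf 1; rewrite m0 mulr0 addr0 add0r expr1n mul1r -vE => <-.
by apply: eq_Rintegral => w _; rewrite mul1r.
Qed.

Lemma gaussian_space_moment_le (c : V) (N p : nat) : (p <= N)%N ->
  \int[P]_w (L c w ^+ (2 * p)) <= (2 * N%:R * second_moment c c) ^+ p.
Proof.
exact: (gaussian_even_moment_le L_lin L_meas second_momentC second_moment_lin L_int
  gaussian_space_mgf).
Qed.

Lemma gaussian_space_quadratic_le (v : nat -> V) (k : nat) (lam : R) (N p : nat) :
  (forall i, (i < k)%N -> \sum_(0 <= j < k) `|second_moment (v i) (v j)| <= lam) ->
  0 <= lam -> (p <= N)%N ->
  \int[P]_w ((\sum_(0 <= i < k) L (v i) w ^+ 2 -
     \sum_(0 <= i < k) second_moment (v i) (v i)) ^+ (2 * p)) <=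
  ((4 * N%:R * lam) ^+ 2 +
   2 * (4 * N%:R * lam) * \sum_(0 <= i < k) second_moment (v i) (v i)) ^+ p.
Proof.
move=> h lam0 pN.
exact: (quadratic_form_moment_le L_lin L_meas second_momentC second_moment_lin L_int
  gaussian_space_mgf h lam0 pN).
Qed.

End gaussian_space.

(** * Covariances of the increments of fractional Brownian motion *)

Lemma powR_convex {R : realType} (g l x y : R) : 1 <= g -> 0 <= l <= 1 -> 0 <= x -> 0 <= y ->
  (l * x + (1 - l) * y) `^ g <= l * x `^ g + (1 - l) * y `^ g.
Proof.
move=> g1 /andP[l0 l1] x0 y0.
have := @convex_powR R g g1 (Itv01 l0 l1) x y.
by rewrite !inE/= !in_itv/= !andbT => /(_ x0 y0); rewrite !convRE.
Qed.

(** Convexity of the power [g^-1 >= 1], applied to x^g and y^g and then raised to the power g. *)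
Lemma powR_concave {R : realType} (g l x y : R) : 0 < g -> g <= 1 -> 0 <= l <= 1 ->
  0 <= x -> 0 <= y ->
  l * x `^ g + (1 - l) * y `^ g <= (l * x + (1 - l) * y) `^ g.
Proof.
move=> g0 g1 /andP[l0 l1] x0 y0.
have := @powR_convex R g^-1 l (x `^ g) (y `^ g).
rewrite -!powRrM divff ?gt_eqF// !powRr1//.
rewrite l0 l1 !powR_ge0 invf_ge1// => /(_ g1 isT isT isT) h.
have h0 : 0 <= l * x `^ g + (1 - l) * y `^ g.
  by rewrite addr_ge0// mulr_ge0 ?powR_ge0// subr_ge0.
have := ge0_ler_powR (ltW g0) _ _ h; rewrite !nnegrE powR_ge0 => /(_ isT).
rewrite -powRrM mulVf ?gt_eqF// powRr1//; apply.
by rewrite addr_ge0// mulr_ge0// subr_ge0.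
Qed.

Lemma convex_combination_exists {R : realType} (p q r s : R) : p <= r -> r <= q -> r + s = p + q ->
  exists2 l, 0 <= l <= 1 & r = l * p + (1 - l) * q /\ s = l * q + (1 - l) * p.
Proof.
move=> pr rq e; have [pq|pq] := eqVneq p q.
  exists 0; first by rewrite lexx ler01.
  by split; lra.
have pq0 : 0 < q - p by rewrite subr_gt0 lt_neqAle pq (le_trans pr).
exists ((q - r) / (q - p)).
  by apply/andP; split; [apply: divr_ge0; lra|rewrite ler_pdivrMr// mul1r; lra].
have -> : s = p + q - r by lra.
by split; field; rewrite subr_eq0 eq_sym.
Qed.

(** r and s are convex combinations of p and q with exchanged weights, so the two convexity
    inequalities add up. This and its concave twin decide the sign of the covariance of disjoint
    increments. *)
Lemma powR_four_points_ge1 {R : realType} (g p q r s : R) : 1 <= g -> 0 <= p ->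
  p <= r -> r <= q -> r + s = p + q -> r `^ g + s `^ g <= p `^ g + q `^ g.
Proof.
move=> g1 p0 pr rq e; have q0 : 0 <= q by rewrite (le_trans p0)// (le_trans pr).
have [l l01 [-> ->]] := convex_combination_exists pr rq e.
by have := powR_convex g1 l01 p0 q0; have := powR_convex g1 l01 q0 p0; lra.
Qed.

Lemma powR_four_points_le1 {R : realType} (g p q r s : R) : 0 < g -> g <= 1 -> 0 <= p ->
  p <= r -> r <= q -> r + s = p + q -> p `^ g + q `^ g <= r `^ g + s `^ g.
Proof.
move=> g0 g1 p0 pr rq e; have q0 : 0 <= q by rewrite (le_trans p0)// (le_trans pr).
have [l l01 [-> ->]] := convex_combination_exists pr rq e.
by have := powR_concave g0 g1 l01 p0 q0; have := powR_concave g0 g1 l01 q0 p0; lra.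
Qed.

Lemma powR_subadditive {R : realType} (g x y : R) : 0 < g -> g <= 1 -> 0 <= x -> 0 <= y ->
  (x + y) `^ g <= x `^ g + y `^ g.
Proof.
move=> g0 g1 x0 y0.
have := @powR_four_points_le1 _ g 0 (x + y) x y g0 g1 (lexx 0) x0.
by rewrite powR0 ?gt_eqF// !add0r; apply => //; rewrite lerDl.
Qed.

(** Subadditivity when g <= 1; a Lipschitz bound on [0, A] when 1 < g <= 2. The exponent min(1, g)
    is the origin of the rate [mu] of the row sums. *)
Lemma powR_increment_le {R : realType} (g A : R) : 0 < g -> g <= 2 -> 0 <= A ->
  exists2 C : R, 0 <= C & forall x y : R, 0 <= x <= A -> 0 <= y <= A ->
    `|x `^ g - y `^ g| <= C * `|x - y| `^ (Num.min 1 g).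
Proof.
move=> g0 g2 A0.
suff [C C0 hC] : exists2 C : R, 0 <= C & forall x y : R, 0 <= y -> y <= x -> x <= A ->
    x `^ g - y `^ g <= C * (x - y) `^ (Num.min 1 g).
  exists C => // x y /andP[x0 xA] /andP[y0 yA].
  have [yx|xy] := leP y x.
    rewrite ger0_norm; last by rewrite subr_ge0 ge0_ler_powR ?nnegrE ?(ltW g0).
    by rewrite ger0_norm ?subr_ge0//; exact: hC.
  rewrite distrC (distrC x) ger0_norm; last first.
    by rewrite subr_ge0 ge0_ler_powR ?nnegrE ?(ltW g0) ?(ltW xy).
  by rewrite ger0_norm ?subr_ge0 ?(ltW xy)//; apply: hC => //; exact: ltW.
have [g1|g1] := leP g 1.
  exists 1 => // x y y0 yx xA.
  have := @powR_subadditive _ g (x - y) y g0 g1; rewrite subr_ge0 subrK => /(_ yx y0).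
  by rewrite mul1r; lra.
exists (2 * A `^ (g - 1)); first by rewrite mulr_ge0// powR_ge0.
move=> x y y0 yx xA; rewrite powRr1 ?subr_ge0//.
have x0 : 0 <= x by exact: le_trans yx.
move: x0; rewrite le_eqVlt => /predU1P[xz|x0].
  have -> : y = x by apply/eqP; rewrite eq_le yx -xz.
  by rewrite !subrr mulr0.
pose z := y / x.
have z0 : 0 <= z by rewrite divr_ge0// ltW.
have z1 : z <= 1 by rewrite ler_pdivrMr// mul1r.
have yE : y = x * z by rewrite /z mulrC divfK// gt_eqF.
(* After scaling by x, the claim is 1 - z^g <= 2 (1 - z); since z <= 1 and g <= 2 it follows from 1
   - z^2 <= 2 (1 - z). *)
have zg : z ^+ 2 <= z `^ g.
  rewrite -powR_mulrn//; move: z0; rewrite le_eqVlt => /predU1P[<-|z0].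
    by rewrite !powR0 ?gt_eqF// pnatr_eq0.
  by apply: ger_powR; rewrite ?z0.
have xg : x `^ g = x `^ (g - 1) * x by rewrite mulrC mulr_powRB1 ?(ltW x0).
have xA' : x `^ (g - 1) <= A `^ (g - 1).
  by apply: ge0_ler_powR; rewrite ?nnegrE ?subr_ge0 ?(ltW g1) ?(ltW x0).
rewrite yE powRM ?(ltW x0)// xg.
apply: (@le_trans _ _ (x `^ (g - 1) * (2 * (x - x * z)))).
  rewrite -[X in X - _]mulr1 -mulrBr -mulrA ler_wpM2l ?powR_ge0//.
  have -> : 2 * (x - x * z) = x * (2 * (1 - z)) by ring.
  rewrite ler_wpM2l ?(ltW x0)//.
  by have := sqr_ge0 (1 - z); move: zg; rewrite !expr2; nra.
rewrite [leRHS]mulrAC [leRHS]mulrC ler_wpM2r//.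
by rewrite mulr_ge0// subr_ge0 ler_piMr// ltW.
Qed.

Definition fbm_cov {R : realType} (H s t : R) : R :=
  2^-1 * (s `^ (2 * H) + t `^ (2 * H) - `|t - s| `^ (2 * H)).

Section fbm_space.
Context {R : realType} {d : measure_display} {Omega : measurableType d}.
Variables (P : probability Omega R) (H : R) (B : R -> Omega -> R).
Hypothesis H01 : 0 < H < 1.
Hypothesis fbm : fractional_brownian_motion P H B.
Variable t : nat -> R.
Hypothesis t_ge0 : forall i, 0 <= t i.

(* Polynomials index the finite linear combinations of the values of [B] at the
   times [t i]: the coefficient of 'X^i multiplies [B (t i)]. *)
Definition fbm_comb (p : {poly R}) (w : Omega) : R := \sum_(i < size p) p`_i * B (t i) w.

Let I_t i : (`[0, +oo[%classic : set R) (t i).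
Proof. by rewrite /= in_itv/= andbT. Qed.

Let combE (p : {poly R}) n w : (size p <= n)%N -> fbm_comb p w = \sum_(i < n) p`_i * B (t i) w.
Proof.
move=> pn; rewrite /fbm_comb (big_ord_widen n (fun i => p`_i * B (t i) w)) ?pn// big_mkcond/=.
apply: eq_bigr => i _; case: ifPn => //; rewrite -leqNgt => h.
by rewrite nth_default// mul0r.
Qed.

Lemma fbm_comb_lin (a b : {poly R}) s w :
  fbm_comb (a + s *: b) w = fbm_comb a w + s * fbm_comb b w.
Proof.
pose n := maxn (size a) (size b).
have an : (size a <= n)%N by rewrite leq_maxl.
have bn : (size b <= n)%N by rewrite leq_maxr.
have abn : (size (a + s *: b)%R <= n)%N.
  by rewrite (leq_trans (size_polyD _ _))// geq_max an (leq_trans (size_scale_leq _ _)).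
rewrite !(combE _ an) (combE _ bn) (combE _ abn) mulr_sumr -big_split/=.
by apply: eq_bigr => i _; rewrite coefD coefZ; ring.
Qed.

Lemma fbm_comb_measurable a : measurable_fun [set: Omega] (fbm_comb a).
Proof.
have [[mB _] _ _ _] := fbm.
apply: measurable_sum => i; apply: measurable_funM; first exact: measurable_cst.
exact: mB.
Qed.

Lemma fbm_comb_gaussian a : gaussian_law (pushforward P (fbm_comb a)).
Proof. by have [[_ gB] _ _ _] := fbm; exact: gB. Qed.

Lemma fbm_combX i w : fbm_comb 'X^i w = B (t i) w.
Proof.
rewrite /fbm_comb size_polyXn big_ord_recr/= coefXn eqxx mul1r big1 ?add0r// => j _.
by rewrite coefXn ltn_eqF ?mul0r.
Qed.

Let L_int := gaussian_space_integrable fbm_comb_measurable fbm_comb_gaussian.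

Let dB i : exp_dominated fbm_comb (B (t i)).
Proof.
rewrite (_ : B (t i) = fbm_comb 'X^i); last by apply/funext => w; rewrite fbm_combX.
exact: (exp_dominated_linear fbm_comb_lin fbm_comb_measurable).
Qed.

Lemma fbm_comb_mean a : \int[P]_w fbm_comb a w = 0.
Proof.
have [_ EB _ _] := fbm.
rewrite /fbm_comb (expect_sum fbm_comb_lin L_int).
  rewrite big1// => i _; rewrite (expectZ L_int)//.
  have := EB _ (t_ge0 i); rewrite unlock /Rintegral => ->.
  by rewrite mulr0.
move=> i; apply: (exp_dominatedM fbm_comb_lin) => //.
exact: (exp_dominated_cst fbm_comb_lin).
Qed.

Local Notation cov := (@second_moment _ _ _ P _ fbm_comb).

Lemma fbm_comb_cov i j : cov 'X^i 'X^j = fbm_cov H (t i) (t j).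
Proof.
have [_ _ covB _] := fbm.
have := covB _ _ (t_ge0 i) (t_ge0 j); rewrite unlock => e.
transitivity (fine (\int[P]_w ((B (t i) \* B (t j)) w)%:E)%E); last by rewrite e.
by apply: eq_Rintegral => w _; rewrite !fbm_combX.
Qed.

Definition fbm_step (i : nat) : {poly R} := 'X^(i.+1) - 'X^i.

Lemma fbm_stepE i w : fbm_comb (fbm_step i) w = B (t i.+1) w - B (t i) w.
Proof. by rewrite /fbm_step -scaleN1r fbm_comb_lin !fbm_combX mulN1r. Qed.

Let covD := second_moment_lin fbm_comb_lin fbm_comb_measurable fbm_comb_gaussian.
Let covC := @second_momentC _ _ _ P _ fbm_comb.

Lemma cov_increment i j k l : cov ('X^i - 'X^j) ('X^k - 'X^l) =
  2^-1 * (`|t l - t i| `^ (2 * H) + `|t k - t j| `^ (2 * H) -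
          `|t k - t i| `^ (2 * H) - `|t l - t j| `^ (2 * H)).
Proof.
rewrite -[- 'X^j]scaleN1r -[- 'X^l]scaleN1r covD !(covC ('X^i + _)) !covD.
rewrite !fbm_comb_cov /fbm_cov.
by rewrite !(distrC (t i)) !(distrC (t j)); field.
Qed.

Lemma fbm_increment_moment_le i j N :
  \int[P]_w ((B (t i) w - B (t j) w) ^+ (2 * N)) <=
  (2 * N%:R * `|t i - t j| `^ (2 * H)) ^+ N.
Proof.
have /andP[H0 _] := H01.
have := gaussian_space_moment_le fbm_comb_lin fbm_comb_measurable fbm_comb_gaussian
  fbm_comb_mean ('X^i - 'X^j) (leqnn N).
rewrite cov_increment !subrr normr0 powR0 ?mulf_neq0 ?gt_eqF// (distrC (t j)).
have -> : 2^-1 * (`|t i - t j| `^ (2 * H) + `|t i - t j| `^ (2 * H) - 0 - 0) =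
  `|t i - t j| `^ (2 * H) by field.
apply: le_trans; rewrite le_eqVlt; apply/orP; left; apply/eqP.
by apply: eq_Rintegral => w _; rewrite -[- 'X^j]scaleN1r fbm_comb_lin !fbm_combX mulN1r.
Qed.

Hypothesis t_mono : {homo t : i j / (i <= j)%N >-> i <= j}.

(** For i < j the four lengths in the covariance have equal sums in pairs, the shortest and the
    longest forming one pair. Convexity of the power 2H >= 1, or its concavity otherwise, fixes the
    sign, which thus depends on H alone. *)
Lemma cov_step_sign : (forall i j, i != j -> 0 <= cov (fbm_step i) (fbm_step j)) \/
  (forall i j, i != j -> cov (fbm_step i) (fbm_step j) <= 0).
Proof.
have /andP[H0 H1] := H01.
have tE i j : (i < j)%N -> cov (fbm_step i) (fbm_step j) =
    2^-1 * ((t j - t i.+1) `^ (2 * H) + (t j.+1 - t i) `^ (2 * H) -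
            ((t j.+1 - t i.+1) `^ (2 * H) + (t j - t i) `^ (2 * H))).
  move=> ij; rewrite cov_increment; congr (_ * _).
  have t1 := t_mono ij; have t2 := t_mono (leqnSn i); have t3 := t_mono (leqnSn j).
  by rewrite !ger0_norm; [ring|lra..].
have ord i j : (i < j)%N ->
    [/\ 0 <= t j - t i.+1, t j - t i.+1 <= t j.+1 - t i.+1, t j.+1 - t i.+1 <= t j.+1 - t i &
     t j.+1 - t i.+1 + (t j - t i) = t j - t i.+1 + (t j.+1 - t i)].
  move=> ij; have t1 := t_mono ij; have t2 := t_mono (leqnSn i).
  have t3 := t_mono (leqnSn j); split; lra.
have [g1|g1] := leP 1 (2 * H); [left|right].
- suff h i j : (i < j)%N -> 0 <= cov (fbm_step i) (fbm_step j).
    by move=> i j; rewrite neq_ltn => /orP[|]/h//; rewrite covC.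
  move=> ij; rewrite tE// mulr_ge0 ?invr_ge0// subr_ge0.
  by have [p0 pr rq e] := ord _ _ ij; exact: powR_four_points_ge1 g1 p0 pr rq e.
- suff h i j : (i < j)%N -> cov (fbm_step i) (fbm_step j) <= 0.
    by move=> i j; rewrite neq_ltn => /orP[|]/h//; rewrite covC.
  move=> ij; rewrite tE// pmulr_rle0 ?invr_gt0// subr_le0.
  have [p0 pr rq e] := ord _ _ ij.
  by apply: powR_four_points_le1 (ltW g1) p0 pr rq e; rewrite mulr_gt0.
Qed.

(* The off-diagonal covariances have constant sign, so the sum of their absolute
   values telescopes to the covariance of one increment with the total one. *)
Lemma cov_step_row_sum i k : (i < k)%N ->
  \sum_(0 <= j < k) `|cov (fbm_step i) (fbm_step j)| <=
  `|cov (fbm_step i) ('X^k - 'X^0)| + 2 * cov (fbm_step i) (fbm_step i).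
Proof.
move=> ik.
have c0 : 0 <= cov (fbm_step i) (fbm_step i).
  by apply: Rintegral_ge0 => w _; rewrite -expr2 sqr_ge0.
have tel : \sum_(0 <= j < k) cov (fbm_step i) (fbm_step j) = cov (fbm_step i) ('X^k - 'X^0).
  have c_add a b : cov (fbm_step i) (a + b) = cov (fbm_step i) a + cov (fbm_step i) b.
    by rewrite -[b]scale1r covD scale1r mul1r.
  have c_zero : cov (fbm_step i) 0 = 0 by have := c_add 0 0; rewrite addr0; lra.
  elim: {ik} k => [|k IH]; first by rewrite big_geq// subrr c_zero.
  rewrite big_nat_recr//= IH -c_add; congr (cov _ _).
  by rewrite /fbm_step; ring.
(* The row with its diagonal entry set to 0: the other entries have one sign, so the absolute value
   leaves the sum. Removing the diagonal entry and restoring it accounts for the factor 2 in the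
   bound. *)
pose s j := if j == i then 0 else cov (fbm_step i) (fbm_step j).
have split_sum (f g : nat -> R) x : (forall j, f j = g j + (if j == i then x else 0)) ->
    \sum_(0 <= j < k) f j = \sum_(0 <= j < k) g j + x.
  move=> fg; under eq_bigr do rewrite fg.
  rewrite big_split/=; congr (_ + _).
  by rewrite -big_mkcond/= big_nat1_eq ik.
have -> : \sum_(0 <= j < k) `|cov (fbm_step i) (fbm_step j)| =
    \sum_(0 <= j < k) `|s j| + cov (fbm_step i) (fbm_step i).
  apply: split_sum => j; rewrite /s; case: eqVneq => [->|_]; last by rewrite addr0.
  by rewrite normr0 add0r ger0_norm.
have e : cov (fbm_step i) ('X^k - 'X^0) = \sum_(0 <= j < k) s j + cov (fbm_step i) (fbm_step i).
  rewrite -tel; apply: split_sum => j; rewrite /s.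
  by case: eqVneq => [->|_]; rewrite ?addr0 ?add0r.
have abs_s : \sum_(0 <= j < k) `|s j| = `|\sum_(0 <= j < k) s j|.
  have [pos|neg] := cov_step_sign.
    have s0 j : 0 <= s j by rewrite /s; case: eqVneq => // ji; apply: pos; rewrite eq_sym.
    rewrite ger0_norm ?sumr_ge0//; apply: eq_bigr => j _; exact: ger0_norm.
  have s0 j : s j <= 0 by rewrite /s; case: eqVneq => // ji; apply: neg; rewrite eq_sym.
  rewrite ler0_norm ?sumr_le0// -sumrN; apply: eq_bigr => j _; exact: ler0_norm.
rewrite abs_s.
have -> : \sum_(0 <= j < k) s j =
  cov (fbm_step i) ('X^k - 'X^0) - cov (fbm_step i) (fbm_step i) by rewrite e addrK.
have := ler_normB (cov (fbm_step i) ('X^k - 'X^0)) (cov (fbm_step i) (fbm_step i)).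
by rewrite (ger0_norm c0); lra.
Qed.

End fbm_space.

(** * Almost sure bounds *)

(** The sum of all [X n] has finite expectation, so it is finite almost surely and bounds each
    term. *)
Lemma ae_bounded_of_summable {R : realType} {d} {Omega : measurableType d}
    (P : probability Omega R) (X : nat -> Omega -> R) (C : R) :
  (forall n, P.-integrable [set: Omega] (EFin \o X n)) -> (forall n w, 0 <= X n w) ->
  (forall n, \int[P]_w X n w <= C / n.+1%:R ^+ 2) ->
  \forall w \ae P, exists M, forall n, X n w <= M.
Proof.
move=> iX X0 EX.
have C0 : 0 <= C.
  by have := EX 0; rewrite expr1n divr1; apply: le_trans; apply: Rintegral_ge0.
have mX n : measurable_fun [set: Omega] (EFin \o X n) by exact: measurable_int (iX n).
pose S (w : Omega) : \bar R := (\sum_(0 <= n <oo) (X n w)%:E)%E.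
have mS : measurable_fun [set: Omega] S.
  apply: (@ge0_emeasurable_sum _ _ _ _ (fun n w => (X n w)%:E) xpredT) => // [n w _ _|n _].
    by rewrite lee_fin.
  exact: mX.
have S0 w : (0 <= S w)%E by apply: nneseries_ge0 => n _ _; rewrite lee_fin.
have SE : (\int[P]_w S w <= (2 * C)%:E)%E.
  rewrite /S integral_nneseries//; last by move=> n w _; rewrite lee_fin.
  apply: lime_le.
    by apply: is_cvg_nneseries => n _ _; apply: integral_ge0 => w _; rewrite lee_fin.
  apply: nearW => N.
  apply: (@le_trans _ _ (\sum_(0 <= n < N) (C / n.+1%:R ^+ 2)%:E)%E).
    apply: lee_sum => n _; have := EX n; rewrite -lee_fin /Rintegral fineK//.
    by apply: integrable_fin_num => //; exact: iX.
  rewrite sumEFin lee_fin.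
  (* A telescoping majorant for the partial sums: 1/a^2 <= 2/(a (a+1)) for a >= 1. *)
  apply: (@le_trans _ _ (2 * C * (1 - N.+1%:R^-1))); last first.
    by rewrite ler_piMr ?mulr_ge0// gerBl invr_ge0.
  elim: N => [|N IH]; first by rewrite big_geq// invr1 subrr mulr0.
  rewrite big_nat_recr//=; apply: (le_trans (lerD IH (lexx _))).
  have a1 : (1 : R) <= N.+1%:R by rewrite ler1n.
  have -> : N.+2%:R = N.+1%:R + 1 :> R by rewrite natr1.
  move: (N.+1%:R : R) a1 => a a1.
  have a0 : 0 < a by lra.
  have a10 : 0 < a + 1 by lra.
  rewrite -subr_ge0.
  have -> : 2 * C * (1 - (a + 1)^-1) - (2 * C * (1 - a^-1) + C / a ^+ 2) =
     C * (a - 1) / (a ^+ 2 * (a + 1)) by field; rewrite !gt_eqF.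
  by apply: divr_ge0; apply: mulr_ge0; rewrite ?sqr_ge0 ?(ltW a10) ?subr_ge0.
have iS : P.-integrable [set: Omega] S.
  apply/integrableP; split => //; under eq_integral do rewrite gee0_abs//.
  exact: le_lt_trans SE (ltry _).
apply: filterS (integrable_ae measurableT iS) => w /(_ I) Sfin.
exists (fine (S w)) => n; rewrite -lee_fin fineK//.
apply: (@le_trans _ _ (\sum_(0 <= i < n.+1) (X i w)%:E)%E).
  by rewrite big_nat_recr//= leeDr// sume_ge0// => i _; rewrite lee_fin.
by apply: nneseries_lim_ge => i _ _; rewrite lee_fin.
Qed.

Lemma norm_le_of_even_power {R : realType} (y M : R) (N : nat) : (0 < N)%N -> 0 <= M ->
  y ^+ (2 * N) <= M -> `|y| <= M + 1.
Proof.
move=> N0 M0 h; rewrite leNgt; apply/negP => yM.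
have y1 : 1 <= `|y| by lra.
have : `|y| <= `|y| ^+ (2 * N) by rewrite ler_eXnr// muln_gt0.
rewrite -normrX (ger0_norm (_ : 0 <= y ^+ (2 * N))); first lra.
by rewrite mulnC exprM sqr_ge0.
Qed.

(** Kolmogorov's criterion in summed form. The 2N-th moment of a normalised increment on a grid of m
    cells is O(m^(-2N(H-alpha))), hence O(m^(-3)); adding the m cells leaves m^(-2), which is
    summable. The resulting almost sure bound is then read on dyadic grids. *)
Lemma fbm_holder {R : realType} {d} {Omega : measurableType d} (P : probability Omega R)
    (H : R) (B : R -> Omega -> R) (alpha A : R) :
  0 < H < 1 -> fractional_brownian_motion P H B -> 0 < alpha -> alpha < H -> 0 < A ->
  \forall w \ae P, exists2 C : R, 0 <= C & holder_with C alpha `[0, A] (fun t => B t w).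
Proof.
move=> H01 fbm a0 aH A0.
pose t (n i : nat) : R := A * (i%:R / n.+1%:R).
have t0 n i : 0 <= t n i by rewrite /t !mulr_ge0 ?invr_ge0 ?ler0n ?(ltW A0).
have Ha : 0 < H - alpha by rewrite subr_gt0.
(* The least order guaranteed by truncation for 2N(H - alpha) >= 3. *)
pose N := (Num.truncn (3 / (2 * (H - alpha)))).+1.
have N3 : 3 <= 2 * (H - alpha) * N%:R.
  by rewrite -ler_pdivrMl ?mulr_gt0// mulrC ltW// truncnS_gt.
pose X n w := \sum_(0 <= k < n.+1)
  (n.+1%:R `^ alpha * (B (t n k.+1) w - B (t n k) w)) ^+ (2 * N).
pose C := (2 * N%:R * A `^ (2 * H)) ^+ N.
have C0 : 0 <= C by rewrite exprn_ge0// mulr_ge0 ?mulr_ge0// powR_ge0.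
have dinc n k : exp_dominated (fbm_comb B (t n))
    (fun w => n.+1%:R `^ alpha * (B (t n k.+1) w - B (t n k) w)).
  apply: (exp_dominatedM (@fbm_comb_lin _ _ _ B (t n))).
    exact: (exp_dominated_cst (@fbm_comb_lin _ _ _ B (t n))).
  rewrite (_ : (fun w => _) = fbm_comb B (t n) (fbm_step k)).
    exact: (exp_dominated_linear (@fbm_comb_lin _ _ _ B (t n)) (fbm_comb_measurable fbm (t0 n))).
  by apply/funext => w; rewrite fbm_stepE.
have L_int n := gaussian_space_integrable (fbm_comb_measurable fbm (t0 n))
  (fbm_comb_gaussian fbm (t0 n)).
have dX n : exp_dominated (fbm_comb B (t n)) (X n).
  apply: (exp_dominated_sum (@fbm_comb_lin _ _ _ B (t n))) => k.
  exact: (exp_dominatedX (@fbm_comb_lin _ _ _ B (t n))).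
have iX n : P.-integrable [set: Omega] (EFin \o X n).
  exact: (exp_dominated_integrable (L_int n) (dX n)).
have X0 n w : 0 <= X n w by apply: sumr_ge0 => k _; rewrite exprM exprn_ge0// sqr_ge0.
have EX n : \int[P]_w X n w <= C / n.+1%:R ^+ 2.
  have m0 : 0 < n.+1%:R :> R by rewrite ltr0n.
  have m1 : 1 <= n.+1%:R :> R by rewrite ler1n.
  rewrite /X (expect_sum (@fbm_comb_lin _ _ _ B (t n)) (L_int n)); last first.
    by move=> k; exact: (exp_dominatedX (@fbm_comb_lin _ _ _ B (t n))).
  apply: (@le_trans _ _ (\sum_(0 <= k < n.+1) C * n.+1%:R `^ (- 3))).
    apply: ler_sum => k _.
    under eq_Rintegral do rewrite exprMn.
    rewrite (expectZ (L_int n)); last first.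
      rewrite (_ : (fun w => _) = (fun w => fbm_comb B (t n) (fbm_step k) w ^+ (2 * N))).
        apply: (exp_dominatedX (@fbm_comb_lin _ _ _ B (t n))).
        exact: (exp_dominated_linear (@fbm_comb_lin _ _ _ B (t n)) (fbm_comb_measurable fbm (t0 n))).
      by apply/funext => w; rewrite fbm_stepE.
    have := fbm_increment_moment_le H01 fbm (t0 n) k.+1 k N.
    have -> : `|t n k.+1 - t n k| = A / n.+1%:R.
      rewrite /t -mulrBr -mulrBl -natr1 addrAC subrr add0r mul1r ger0_norm//.
      by rewrite divr_ge0 ?(ltW A0)// ltW.
    move=> /(ler_wpM2l (exprn_ge0 (2 * N) (powR_ge0 n.+1%:R alpha))) /le_trans; apply.
    rewrite exprM -exprMn /C.
    have -> : n.+1%:R `^ alpha ^+ 2 * (2 * N%:R * (A / n.+1%:R) `^ (2 * H)) =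
        (2 * N%:R * A `^ (2 * H)) * n.+1%:R `^ (- (2 * (H - alpha))).
      rewrite powRM ?invr_ge0 ?(ltW A0) ?(ltW m0)// powR_invl ?(ltW m0)//.
      rewrite -powR_mulrn ?powR_ge0// -powRrM.
      have -> : - (2 * (H - alpha)) = alpha * 2 + - (2 * H) by ring.
      by rewrite powRD; [ring|rewrite pnatr_eq0 implybT].
    rewrite exprMn ler_wpM2l//.
    rewrite -powR_mulrn ?powR_ge0// -powRrM ler_powR//.
    by rewrite mulNr lerN2.
  rewrite sumr_const_nat subn0 -[leLHS]mulr_natl mulrCA ler_wpM2l//.
  rewrite powRN powR_mulrn ?(ltW m0)// exprS invfM mulrA divff ?gt_eqF// mul1r.
  by [].
have [_ _ _ cB] := fbm.
apply: filterS2 cB (ae_bounded_of_summable iX X0 EX) => w cw [M hM].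
have M0 : 0 <= M by exact: le_trans (hM 0).
apply: (@dyadic_holder _ alpha (M + 1)) => //; first by rewrite addr_ge0.
  apply: continuous_subspaceW cw => r /=; rewrite !in_itv/= andbT.
  by case/andP.
move=> n k kn.
(* [X] at index i uses i + 1 cells, so the predecessor of 2^n selects the dyadic grid; one increment
   is then isolated in a sum of nonnegative terms. *)
have := hM (2 ^ n).-1; rewrite /X.
have n2 : ((2 ^ n).-1.+1 = 2 ^ n)%N by rewrite prednK// expn_gt0.
rewrite /t n2 => h.
have p0 : 0 < (2 ^ n)%:R `^ alpha :> R by rewrite powR_gt0// ltr0n expn_gt0.
have : `|(2 ^ n)%:R `^ alpha *
  (B (A * (k.+1%:R / (2 ^ n)%:R)) w - B (A * (k%:R / (2 ^ n)%:R)) w)| <= M + 1.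
  apply: (@norm_le_of_even_power _ _ _ N) => //; apply: le_trans h.
  rewrite (@big_cat_nat _ _ _ k)//= 1?ltnW// (@big_ltn _ _ _ k)//.
  rewrite addrCA lerDl; apply: addr_ge0; apply: sumr_ge0 => i _.
    by rewrite exprM exprn_ge0// sqr_ge0.
  by rewrite exprM exprn_ge0// sqr_ge0.
rewrite normrM (gtr0_norm p0) -ler_pdivlMl// => /le_trans; apply.
rewrite mulrC ler_wpM2l ?addr_ge0//.
by rewrite -powRN natrX -powR_mulrn// -powRrM mulrC powRrM powR_mulrn ?powR_ge0.
Qed.

(** * Weighted increments after the exponential time change *)

Section lamperti_increments.
Context {R : realType} {d : measure_display} {Omega : measurableType d}.
Variables (P : probability Omega R) (H : R) (B : R -> Omega -> R).
Hypothesis H01 : 0 < H < 1.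
Hypothesis fbm : fractional_brownian_motion P H B.

Let H0 : 0 < H. Proof. by case/andP: H01. Qed.

Definition lamperti_time (m i : nat) : R := time_change H (i%:R / m%:R).

Let t_ge0 m i : 0 <= lamperti_time m i.
Proof. by rewrite mulr_ge0 ?expR_ge0// ltW. Qed.

Let t_mono m : {homo lamperti_time m : i j / (i <= j)%N >-> i <= j}.
Proof.
move=> i j ij; rewrite /lamperti_time /time_change ler_pM2l// ler_expR.
by rewrite !ler_wpM2r ?invr_ge0 ?ler0n ?(ltW H0)// ler_nat.
Qed.

(* The variance of the normalised increments, which by the Lamperti scaling does
   not depend on their position. *)
Definition lamperti_var (m : nat) : R := (H * (expR ((m%:R * H)^-1) - 1)) `^ (2 * H).

Let step_gt0 m : 0 <= expR ((m%:R * H)^-1) - 1.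
Proof. by rewrite subr_ge0 -[leLHS]expR0 ler_expR invr_ge0 mulr_ge0 ?ler0n ?ltW. Qed.

Let lamperti_step m i : lamperti_time m i.+1 - lamperti_time m i =
  expR (i%:R / m%:R / H) * (H * (expR ((m%:R * H)^-1) - 1)).
Proof.
rewrite /lamperti_time /time_change.
have -> : i.+1%:R / m%:R / H = i%:R / m%:R / H + (m%:R * H)^-1.
  by rewrite -natr1 invfM; ring.
by rewrite expRD; ring.
Qed.

Definition lamperti_vec (m i : nat) : {poly R} := expR (- (i%:R / m%:R)) *: fbm_step i.

Lemma lamperti_vecE m i w : fbm_comb B (lamperti_time m) (lamperti_vec m i) w =
  expR (- (i%:R / m%:R)) * (B (lamperti_time m i.+1) w - B (lamperti_time m i) w).
Proof.
rewrite -[lamperti_vec m i]add0r fbm_comb_lin fbm_stepE /fbm_comb size_poly0 big_ord0.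
by rewrite add0r.
Qed.

Local Notation cov m := (@second_moment _ _ _ P _ (fbm_comb B (lamperti_time m))).

Let cov_vec m i j : cov m (lamperti_vec m i) (lamperti_vec m j) =
  expR (- (i%:R / m%:R)) * expR (- (j%:R / m%:R)) * cov m (fbm_step i) (fbm_step j).
Proof.
have lin := second_moment_lin (@fbm_comb_lin _ _ _ B (lamperti_time m))
  (fbm_comb_measurable fbm (t_ge0 m)) (fbm_comb_gaussian fbm (t_ge0 m)).
have linZ a b s : cov m a (s *: b) = s * cov m a b.
  have z : cov m a 0 = 0 by have := lin a 0 0 1; rewrite scaler0 addr0; lra.
  by have := lin a 0 b s; rewrite add0r z add0r.
by rewrite linZ second_momentC linZ second_momentC; ring.
Qed.

Let cov_diag m i : cov m (fbm_step i) (fbm_step i) =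
  (lamperti_time m i.+1 - lamperti_time m i) `^ (2 * H).
Proof.
rewrite (cov_increment fbm (t_ge0 m)) !subrr normr0 powR0 ?mulf_neq0 ?gt_eqF//.
by rewrite distrC ger0_norm ?subr_ge0 ?t_mono//; field.
Qed.

(** The i-th time step is exp(i/(mH)) times a length independent of i. Raised to the power 2H the
    factor becomes exp(2i/m), which the squared weight exp(-i/m) cancels. *)
Lemma lamperti_vec_var m i : cov m (lamperti_vec m i) (lamperti_vec m i) = lamperti_var m.
Proof.
rewrite cov_vec cov_diag lamperti_step powRM ?expR_ge0//; last first.
  by rewrite mulr_ge0 ?step_gt0// ltW.
have -> : expR (i%:R / m%:R / H) `^ (2 * H) = expR (i%:R / m%:R) * expR (i%:R / m%:R).
  rewrite /powR gt_eqF ?expR_gt0// expRK -expRD; congr expR.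
  by move: (i%:R / m%:R) => s; field; rewrite gt_eqF.
have := expRN (i%:R / m%:R : R); set a := expR (i%:R / m%:R) => ->.
have a0 : a != 0 by rewrite gt_eqF ?expR_gt0.
by rewrite mulrA mulrACA mulVf// !mul1r.
Qed.

Let expR_sub1_le (y : R) : 0 <= y -> expR y - 1 <= y * expR y.
Proof.
move=> y0; have e1 := expR_ge1Dx (- y); have e0 := expR_gt0 y.
have e3 : expR y * expR (- y) = 1 by rewrite -expRD subrr expR0.
nra.
Qed.

Let base_step_le m : (0 < m)%N -> H * (expR ((m%:R * H)^-1) - 1) <= expR H^-1 / m%:R.
Proof.
move=> m0; have mR : 0 < m%:R :> R by rewrite ltr0n.
have y0 : 0 <= (m%:R * H)^-1 by rewrite invr_ge0 mulr_ge0 ?ltW.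
apply: (@le_trans _ _ (H * ((m%:R * H)^-1 * expR ((m%:R * H)^-1)))).
  by rewrite ler_wpM2l ?(ltW H0)// expR_sub1_le.
have -> : H * ((m%:R * H)^-1 * expR ((m%:R * H)^-1)) = expR ((m%:R * H)^-1) / m%:R.
  by field; rewrite !gt_eqF.
rewrite ler_wpM2r ?invr_ge0 ?(ltW mR)// ler_expR lef_pV2 ?posrE ?mulr_gt0//.
by rewrite ler_peMl ?(ltW H0)// ler1n.
Qed.

Lemma lamperti_var_le m : (0 < m)%N ->
  lamperti_var m <= expR H^-1 `^ (2 * H) * m%:R `^ (- (2 * H)).
Proof.
move=> m0; rewrite -powR_invl ?ler0n// -powRM ?expR_ge0 ?invr_ge0 ?ler0n//.
apply: ge0_ler_powR; rewrite ?nnegrE ?mulr_ge0 ?step_gt0 ?expR_ge0 ?invr_ge0 ?ler0n ?(ltW H0)//.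
exact: base_step_le.
Qed.

(** The weights are at most 1 and drop out. In [cov_step_row_sum] the covariance with the total
    increment is half the sum of two increments of x^(2H) over an interval of length [D], so it is
    at most C D^mu, as is the variance, which counts twice: hence the factor 3. *)
Lemma lamperti_row_sum_le (T : R) : 0 < T -> exists2 C : R, 0 <= C &
  forall m k i, (0 < m)%N -> k%:R / m%:R <= T -> (i < k)%N ->
  \sum_(0 <= j < k) `|cov m (lamperti_vec m i) (lamperti_vec m j)| <=
  C * m%:R `^ (- Num.min 1 (2 * H)).
Proof.
move=> T0; pose A := time_change H T.
have A0 : 0 <= A by rewrite mulr_ge0 ?expR_ge0// ltW.
have H2 : 2 * H <= 2 by have /andP[_ h] := H01; lra.
have HH : 0 < 2 * H by rewrite mulr_gt0.
have [C C0 hC] := powR_increment_le HH H2 A0.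
set mu := Num.min 1 (2 * H) in hC *.
have mu0 : 0 < mu by rewrite /mu lt_min ltr01.
(* exp(T/H) bounds the position factor exp(i/(mH)) of a time step and exp(1/H) comes from
   [base_step_le], so every step is at most c1/m. *)
pose c1 := expR (T / H) * expR H^-1.
have c10 : 0 <= c1 by rewrite mulr_ge0 ?expR_ge0.
exists (3 * C * c1 `^ mu); first by rewrite mulr_ge0 ?powR_ge0// mulr_ge0.
move=> m k i m0 kT ik; have mR : 0 < m%:R :> R by rewrite ltr0n.
have tA j : (j <= k)%N -> 0 <= lamperti_time m j <= A.
  move=> jk; rewrite t_ge0/= (le_trans (t_mono m jk))//.
  by rewrite /lamperti_time /A /time_change ler_pM2l// ler_expR ler_pM2r ?invr_gt0.
set D := lamperti_time m i.+1 - lamperti_time m i.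
have D0 : 0 <= D by rewrite subr_ge0 t_mono.
have Dm : D <= c1 / m%:R.
  rewrite /D lamperti_step /c1 -[leRHS]mulrA; apply: ler_pM; rewrite ?expR_ge0//.
  - by rewrite mulr_ge0 ?step_gt0// ltW.
  - rewrite ler_expR ler_pM2r ?invr_gt0//; apply: le_trans kT.
    by rewrite ler_pM2r ?invr_gt0// ler_nat ltnW.
  - exact: base_step_le.
have DC : C * D `^ mu <= C * (c1 `^ mu * m%:R `^ (- mu)).
  rewrite ler_wpM2l// -powR_invl ?ler0n// -powRM ?invr_ge0 ?ler0n//.
  by apply: ge0_ler_powR; rewrite ?nnegrE ?mulr_ge0 ?invr_ge0 ?ler0n ?(ltW mu0).
have diag : cov m (fbm_step i) (fbm_step i) <= C * D `^ mu.
  have /andP[ti0 tiA] := tA _ (ltnW ik); have /andP[ti0' tiA'] := tA _ ik.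
  have := hC D 0; rewrite cov_diag -/D D0 lexx A0 /= => h.
  have DA : D <= A by rewrite /D; lra.
  have := h DA isT; rewrite powR0 ?gt_eqF// !subr0 !ger0_norm ?powR_ge0//.
have total : `|cov m (fbm_step i) ('X^k - 'X^0)| <= C * D `^ mu.
  rewrite (cov_increment fbm (t_ge0 m)).
  set x1 := `|lamperti_time m 0 - _|; set x2 := `|lamperti_time m k - lamperti_time m i|.
  set x3 := `|_ - _|; set x4 := `|_ - _|.
  have t1 := t_mono m (leq0n i).
  have t2 := t_mono m (leqnSn i); have t3 := t_mono m ik.
  have /andP[tk0 tkA] := tA _ (leqnn k); have tz := t_ge0 m 0.
  have e1 : x1 = lamperti_time m i.+1 - lamperti_time m 0.
    by rewrite /x1 distrC ger0_norm// subr_ge0 (le_trans t1).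
  have e2 : x2 = lamperti_time m k - lamperti_time m i.
    by rewrite /x2 ger0_norm// subr_ge0 (le_trans t2).
  have e3 : x3 = lamperti_time m k - lamperti_time m i.+1 by rewrite /x3 ger0_norm// subr_ge0.
  have e4 : x4 = lamperti_time m i - lamperti_time m 0.
    by rewrite /x4 distrC ger0_norm// subr_ge0.
  clearbody x1 x2 x3 x4.
  have h1 : `|x1 `^ (2 * H) - x4 `^ (2 * H)| <= C * D `^ mu.
    have -> : D = `|x1 - x4| by rewrite e1 e4 opprB addrA subrK ger0_norm.
    by apply: hC; rewrite ?e1 ?e4; lra.
  have h2 : `|x2 `^ (2 * H) - x3 `^ (2 * H)| <= C * D `^ mu.
    have -> : D = `|x2 - x3| by rewrite e2 e3 opprB addrC addrA subrK ger0_norm.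
    by apply: hC; rewrite ?e2 ?e3; lra.
  have -> : x1 `^ (2 * H) + x2 `^ (2 * H) - x3 `^ (2 * H) - x4 `^ (2 * H) =
     (x1 `^ (2 * H) - x4 `^ (2 * H)) + (x2 `^ (2 * H) - x3 `^ (2 * H)).
    by move: (x1 `^ _) (x2 `^ _) (x3 `^ _) (x4 `^ _) => y1 y2 y3 y4; ring.
  rewrite normrM ger0_norm ?invr_ge0//.
  move: h1 h2; move: (x1 `^ _ - x4 `^ _) (x2 `^ _ - x3 `^ _) (C * _) => y z K h1 h2.
  by have := ler_normD y z; lra.
apply: (@le_trans _ _ (\sum_(0 <= j < k) `|cov m (fbm_step i) (fbm_step j)|)).
  have le1 j : expR (- (j%:R / m%:R)) <= 1 :> R.
    by rewrite -[leRHS]expR0 ler_expR oppr_le0 divr_ge0 ?ler0n.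
  apply: ler_sum => j _; rewrite cov_vec normrM; apply: ler_piMl => //.
  by rewrite normrM !ger0_norm ?expR_ge0// mulr_ile1 ?expR_ge0.
apply: (le_trans (cov_step_row_sum H01 fbm (t_ge0 m) (@t_mono m) ik)).
have -> : 3 * C * c1 `^ mu * m%:R `^ (- mu) = 3 * (C * (c1 `^ mu * m%:R `^ (- mu))) by ring.
lra.
Qed.
End lamperti_increments.

(** The normalised variance is x^(2H) with x = (exp y - 1)/y and y = 1/(nH). Then |x - 1| <= e y for
    y <= 1, with e the base of the exponential, and [powR_increment_le] transfers this to the power
    2H; its range [0, 1 + c] contains both x and 1. *)
Lemma lamperti_var_asymptotics {R : realType} (H : R) : 0 < H < 1 -> forall e : R, 0 < e ->
  \forall n \near \oo, `|n%:R `^ (2 * H) * lamperti_var H n - 1| <= e.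
Proof.
move=> /andP[H0 H1] e e0.
have HH : 0 < 2 * H by rewrite mulr_gt0.
have H2 : 2 * H <= 2 by lra.
pose c : R := expR 1.
have c0 : 0 < c by exact: expR_gt0.
have A0 : 0 <= 1 + c by rewrite addr_ge0// ltW.
have [C C0 hC] := powR_increment_le HH H2 A0.
set mu := Num.min 1 (2 * H) in hC.
have mu0 : 0 < mu by rewrite /mu lt_min ltr01.
have lim : C * (c / H) `^ mu * n%:R `^ (- mu) @[n --> \oo] --> C * (c / H) `^ mu * (0 : R).
  by apply: cvgM; [exact: cvg_cst|exact: powR_natN_cvg0].
rewrite mulr0 in lim.
near=> n.
have n0 : (0 < n)%N by near: n; exact: nbhs_infty_gt.
have nR : 0 < n%:R :> R by rewrite ltr0n.
have nH : H^-1 <= n%:R by near: n; exact: nbhs_infty_ger.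
have small : C * (c / H) `^ mu * n%:R `^ (- mu) <= e by near: n; exact: cvgr_le lim _ _.
pose y := (n%:R * H)^-1.
have y0 : 0 < y by rewrite invr_gt0 mulr_gt0.
have y1 : y <= 1 by rewrite invf_le1 ?mulr_gt0// mulrC -ler_pdivrMl// mulr1.
pose x := (expR y - 1) / y.
have xE : n%:R `^ (2 * H) * lamperti_var H n = x `^ (2 * H).
  rewrite /lamperti_var -powRM ?ler0n//; last first.
    by rewrite mulr_ge0 ?(ltW H0)// subr_ge0 -[leLHS]expR0 ler_expR ltW.
  by congr (_ `^ _); rewrite /x /y invrK; ring.
have x1 : `|x - 1| <= c * y.
  have -> : x - 1 = (expR y - 1 - y) / y by rewrite [RHS]mulrBl divff// gt_eqF.
  have yi0 : 0 <= y^-1 by rewrite invr_ge0 ltW.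
  rewrite normrM (ger0_norm yi0) ler_pdivrMr//.
  apply: (le_trans (expR_taylor1 y)); rewrite (gtr0_norm y0).
  by rewrite -[leRHS]mulrA -expr2 mulrC ler_wpM2r ?sqr_ge0// ler_expR.
have cy : c * y <= c by rewrite ler_piMr// ltW.
have x0 : 0 <= x by rewrite divr_ge0 ?(ltW y0)// subr_ge0 -[leLHS]expR0 ler_expR ltW.
rewrite xE -[X in _ - X](_ : 1 `^ (2 * H) = 1); last by rewrite powR1.
apply: (le_trans (hC x 1 _ _)).
- by move: x1; rewrite x0 ler_norml; lra.
- by rewrite ler01/=; lra.
apply: le_trans small; rewrite -mulrA ler_wpM2l//.
rewrite -powR_invl ?ler0n// -powRM ?divr_ge0 ?(ltW c0) ?(ltW H0) ?invr_ge0 ?ler0n//.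
apply: ge0_ler_powR; rewrite ?nnegrE ?mulr_ge0 ?invr_ge0 ?ler0n ?(ltW c0) ?(ltW H0) ?(ltW mu0)//.
by apply: (le_trans x1); rewrite /y invfM le_eqVlt; apply/orP; left; apply/eqP; ring.
Unshelve. all: by end_near. Qed.

(** The sum splits into a centred quadratic form, small by its moments, and (k/n) times the
    deviation of the normalised variance from 1, which is deterministic. The first part is
    controlled for all k at once. *)
Lemma fbm_quadratic_variation {R : realType} {d} {Omega : measurableType d}
    (P : probability Omega R) (H T : R) (B : R -> Omega -> R) :
  0 < H < 1 -> fractional_brownian_motion P H B -> 0 < T ->
  \forall w \ae P, forall e, 0 < e -> \forall n \near \oo, forall k : nat, k%:R / n%:R <= T ->
  `|\sum_(0 <= i < k) (n%:R `^ (2 * H - 1) *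
     (expR (- (i%:R / n%:R)) * (B (time_change H (i.+1%:R / n%:R)) w -
        B (time_change H (i%:R / n%:R)) w)) ^+ 2 - n%:R^-1)| <= e.
Proof.
move=> H01 fbm T0; have /andP[H0 H1] := H01.
have [C C0 hC] := lamperti_row_sum_le H01 fbm T0.
set mu := Num.min 1 (2 * H) in hC.
pose C1 := expR H^-1 `^ (2 * H).
have C10 : 0 <= C1 by exact: powR_ge0.
(* With row sums O(m^(-mu)) and normalisation s = m^(2H-1), [s m * tau] stays bounded, so the moment
   bound is the p-th power of O(m^(-kappa)). Here kappa = min(1, 2 - 2H) is positive because H <
   1. *)
pose kappa := mu + 1 - 2 * H.
have kappa0 : 0 < kappa by rewrite /kappa /mu; case: (leP 1 (2 * H)) => h; lra.
(* Four powers of n are required: one for the sum over k <= T n, one for the factor [n.+1%:R] in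
   [X], and two for summability in n. *)
pose p := (Num.truncn (4 / kappa)).+1.
have p4 : 4 <= kappa * p%:R by rewrite -ler_pdivrMl// mulrC ltW// truncnS_gt.
have t0 m i : 0 <= lamperti_time H m i by rewrite mulr_ge0 ?expR_ge0// ltW.
pose Lf m := fbm_comb B (lamperti_time H m).
have lin m := @fbm_comb_lin _ _ _ B (lamperti_time H m).
have meas m := fbm_comb_measurable fbm (t0 m).
have gauss m := fbm_comb_gaussian fbm (t0 m).
have L_int m := gaussian_space_integrable (meas m) (gauss m).
pose cov m := @second_moment _ _ _ P _ (Lf m).
pose Q m k w := \sum_(0 <= i < k) Lf m (lamperti_vec m i) w ^+ 2
   - \sum_(0 <= i < k) cov m (lamperti_vec m i) (lamperti_vec m i).
pose s (m : nat) : R := m%:R `^ (2 * H - 1).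
(* The factor [n.+1%:R] turns boundedness into convergence: if [X] stays below M, then each power of
   [s * Q] is at most M/n, uniformly in k. *)
pose X n w := \sum_(0 <= k < (Num.truncn (T * n.+1%:R)).+1)
   n.+1%:R * (s n.+1 * Q n.+1 k w) ^+ (2 * p).
pose G := (4 * p%:R * C) ^+ 2 + 2 * (4 * p%:R * C) * (T * C1).
have G0 : 0 <= G.
  by rewrite addr_ge0 ?sqr_ge0// !mulr_ge0// ?(ltW T0).
have dQ m k : exp_dominated (Lf m) (Q m k).
  rewrite (_ : Q m k = fun w => \sum_(0 <= i < k) Lf m (lamperti_vec m i) w ^+ 2 +
    (- \sum_(0 <= i < k) cov m (lamperti_vec m i) (lamperti_vec m i)))//.
  apply: (exp_dominatedD); last exact: (exp_dominated_cst (lin m)).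
  apply: (exp_dominated_sum (lin m)) => i; apply: (exp_dominatedX (lin m)).
  exact: (exp_dominated_linear (lin m) (meas m)).
have dsQ m k : exp_dominated (Lf m) (fun w => (s m * Q m k w) ^+ (2 * p)).
  apply: (exp_dominatedX (lin m)); apply: (exp_dominatedM (lin m)).
    exact: (exp_dominated_cst (lin m)).
  exact: dQ.
have dmsQ m k : exp_dominated (Lf m) (fun w => m%:R * (s m * Q m k w) ^+ (2 * p)).
  by apply: (exp_dominatedM (lin m)); [exact: (exp_dominated_cst (lin m))|exact: dsQ].
have iX n : P.-integrable [set: Omega] (EFin \o X n).
  apply: (exp_dominated_integrable (L_int n.+1)).
  by apply: (exp_dominated_sum (lin n.+1)) => k; exact: dmsQ.
have even_ge0 (r : R) : 0 <= r ^+ (2 * p) by rewrite exprM exprn_ge0// sqr_ge0.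
have X0 n w : 0 <= X n w by apply: sumr_ge0 => k _; rewrite mulr_ge0.
have EQ m k : (0 < m)%N -> k%:R / m%:R <= T ->
    \int[P]_w ((s m * Q m k w) ^+ (2 * p)) <= G ^+ p * m%:R `^ (- 4).
  move=> m0 kT; have mR : 0 < m%:R :> R by rewrite ltr0n.
  have m1 : 1 <= m%:R :> R by rewrite ler1n.
  have mn0 : m%:R != 0 :> R by rewrite gt_eqF.
  have s0 : 0 <= s m by exact: powR_ge0.
  have lam0 : 0 <= C * m%:R `^ (- mu) by rewrite mulr_ge0 ?powR_ge0.
  have := gaussian_space_quadratic_le (lin m) (meas m) (gauss m) (fbm_comb_mean fbm (t0 m))
    (fun i ik => hC m k i m0 kT ik) lam0 (leqnn p).
  rewrite -/(Lf m) -/(cov m) => hQ.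
  under eq_Rintegral do rewrite exprMn.
  rewrite (expectZ (L_int m)); last by apply: (exp_dominatedX (lin m)); exact: dQ.
  apply: (le_trans (ler_wpM2l (even_ge0 (s m)) hQ)).
  rewrite exprM -exprMn.
  set tau := \sum_(0 <= i < k) _.
  have tau0 : 0 <= tau.
    by apply: sumr_ge0 => i _; apply: Rintegral_ge0 => w _; rewrite -expr2 sqr_ge0.
  have sl : s m * (C * m%:R `^ (- mu)) = C * m%:R `^ (- kappa).
    rewrite mulrCA /s -powRD ?mn0 ?implybT//; congr (_ * _ `^ _).
    by rewrite /kappa; ring.
  have st : s m * tau <= T * C1.
    have -> : tau = k%:R * lamperti_var H m.
      rewrite /tau (eq_bigr (fun=> lamperti_var H m)).
        by rewrite sumr_const_nat subn0 -[LHS]mulr_natl.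
      by move=> i _; exact: (lamperti_vec_var H01 fbm).
    have kTm : k%:R <= T * m%:R by rewrite -ler_pdivrMr.
    apply: (@le_trans _ _ (s m * (T * m%:R * (C1 * m%:R `^ (- (2 * H)))))).
      rewrite ler_wpM2l//; apply: ler_pM => //; first exact: powR_ge0.
      exact: lamperti_var_le.
    have -> : s m * (T * m%:R * (C1 * m%:R `^ (- (2 * H)))) =
       T * C1 * (m%:R `^ (2 * H - 1) * m%:R `^ 1 * m%:R `^ (- (2 * H))).
      by rewrite /s powRr1 ?ler0n//; ring.
    rewrite -!powRD ?mn0 ?implybT//.
    have -> : 2 * H - 1 + 1 + - (2 * H) = 0 by ring.
    by rewrite powRr0 mulr1.
  have mk1 : m%:R `^ (- kappa) <= 1 :> R.
    by rewrite -[leRHS](powRr0 m%:R) ler_powR// oppr_le0 ltW.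
  have mk0 : 0 <= m%:R `^ (- kappa) :> R by exact: powR_ge0.
  have base : s m ^+ 2 * ((4 * p%:R * (C * m%:R `^ (- mu))) ^+ 2 +
      2 * (4 * p%:R * (C * m%:R `^ (- mu))) * tau) <= G * m%:R `^ (- kappa).
    have -> : s m ^+ 2 * ((4 * p%:R * (C * m%:R `^ (- mu))) ^+ 2 +
        2 * (4 * p%:R * (C * m%:R `^ (- mu))) * tau) =
      (4 * p%:R * (s m * (C * m%:R `^ (- mu)))) ^+ 2 +
        2 * (4 * p%:R * (s m * (C * m%:R `^ (- mu)))) * (s m * tau) by ring.
    rewrite sl; set z := m%:R `^ (- kappa) in mk1 mk0 *.
    have -> : G * z = (4 * p%:R * C) ^+ 2 * z + 2 * (4 * p%:R * (C * z)) * (T * C1).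
      by rewrite /G; ring.
    apply: lerD.
      have -> : (4 * p%:R * (C * z)) ^+ 2 = (4 * p%:R * C) ^+ 2 * (z * z) by ring.
      by rewrite ler_wpM2l ?sqr_ge0// ler_piMr.
    by rewrite ler_wpM2l// !mulr_ge0.
  apply: (le_trans (lerXn2r p _ _ base)); rewrite ?nnegrE.
  - by rewrite mulr_ge0 ?sqr_ge0// addr_ge0 ?sqr_ge0// !mulr_ge0.
  - by rewrite mulr_ge0.
  rewrite exprMn ler_wpM2l ?exprn_ge0//.
  by rewrite -powR_mulrn// -powRrM ler_powR// mulNr lerN2.
have EX n : \int[P]_w X n w <= ((T + 1) * G ^+ p) / n.+1%:R ^+ 2.
  have m0 : 0 < n.+1%:R :> R by rewrite ltr0n.
  have m1 : 1 <= n.+1%:R :> R by rewrite ler1n.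
  have Tm0 : 0 <= T * n.+1%:R by rewrite mulr_ge0 ?(ltW T0) ?(ltW m0).
  have /andP[K1 _] := truncn_itv Tm0.
  rewrite /X (expect_sum (lin n.+1) (L_int n.+1)); last by move=> k; exact: dmsQ.
  apply: (@le_trans _ _ (\sum_(0 <= k < (Num.truncn (T * n.+1%:R)).+1)
      n.+1%:R * (G ^+ p * n.+1%:R `^ (- 4)))).
    apply: ler_sum_nat => k /andP[_ kK].
    rewrite (expectZ (L_int n.+1)); last exact: dsQ.
    rewrite ler_wpM2l ?(ltW m0)//; apply: EQ => //.
    by rewrite ler_pdivrMr// (le_trans _ K1)// ler_nat.
  rewrite sumr_const_nat subn0 -[leLHS]mulr_natl.
  have KT : (Num.truncn (T * n.+1%:R)).+1%:R <= (T + 1) * n.+1%:R.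
    by rewrite -natr1 mulrDl mul1r lerD.
  have GG : 0 <= n.+1%:R * (G ^+ p * n.+1%:R `^ (- 4)).
    by rewrite mulr_ge0 ?(ltW m0)// mulr_ge0 ?exprn_ge0// powR_ge0.
  apply: (le_trans (ler_wpM2r GG KT)).
  rewrite powRN (powR_mulrn 4) ?(ltW m0)//.
  rewrite le_eqVlt; apply/orP; left; apply/eqP; field.
  by rewrite gt_eqF.
apply: filterS (ae_bounded_of_summable iX X0 EX) => w [M hM] e e0.
have M0 : 0 <= M by exact: le_trans (hM 0).
have e2 : 0 < e / 2 by rewrite divr_gt0.
have e2p : 0 < (e / 2) ^+ (2 * p) by rewrite exprn_gt0.
have eT : 0 < e / 2 / T by rewrite divr_gt0.
near=> n => k kT.
have n0 : (0 < n)%N by near: n; exact: nbhs_infty_gt.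
have nR : 0 < n%:R :> R by rewrite ltr0n.
have nM : M / (e / 2) ^+ (2 * p) <= n%:R by near: n; exact: nbhs_infty_ger.
have asym : `|n%:R `^ (2 * H) * lamperti_var H n - 1| <= e / 2 / T.
  by near: n; exact: lamperti_var_asymptotics.
have nS : (n.-1.+1 = n)%N by rewrite prednK.
have sQ : `|s n * Q n k w| <= e / 2.
  have := hM n.-1; rewrite /X nS => h.
  have kK : (k < (Num.truncn (T * n%:R)).+1)%N.
    rewrite ltnS -(ler_nat R).
    have Tn0 : 0 <= T * n%:R by rewrite mulr_ge0 ?(ltW T0) ?(ltW nR).
    have kTn : k%:R <= T * n%:R by rewrite -ler_pdivrMr.
    by rewrite ler_nat -ltnS -(ltr_nat R) (le_lt_trans kTn)// truncnS_gt.
  have hk : n%:R * (s n * Q n k w) ^+ (2 * p) <= M.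
    apply: le_trans h.
    rewrite (@big_cat_nat _ _ _ k)//= 1?ltnW// (@big_ltn _ _ _ k)//.
    by rewrite addrCA lerDl; apply: addr_ge0; apply: sumr_ge0 => i _; rewrite mulr_ge0.
  rewrite leNgt; apply/negP => big.
  have : (e / 2) ^+ (2 * p) < `|s n * Q n k w| ^+ (2 * p).
    by rewrite ltrXn2r ?(ltW e2)//.
  rewrite -normrX (ger0_norm (even_ge0 _)).
  rewrite ler_pdivrMr// in nM.
  by rewrite -(ltr_pM2l nR); move: hk nM; lra.
(* Centring: all variances equal [lamperti_var H n], so their sum is k times this value, and
   n^(2H-1) = n^(2H)/n. *)
have -> : \sum_(0 <= i < k) (n%:R `^ (2 * H - 1) *
     (expR (- (i%:R / n%:R)) * (B (time_change H (i.+1%:R / n%:R)) w -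
        B (time_change H (i%:R / n%:R)) w)) ^+ 2 - n%:R^-1) =
   s n * Q n k w + k%:R / n%:R * (n%:R `^ (2 * H) * lamperti_var H n - 1).
  have -> : \sum_(0 <= i < k) (n%:R `^ (2 * H - 1) *
     (expR (- (i%:R / n%:R)) * (B (time_change H (i.+1%:R / n%:R)) w -
        B (time_change H (i%:R / n%:R)) w)) ^+ 2 - n%:R^-1) =
     s n * \sum_(0 <= i < k) Lf n (lamperti_vec n i) w ^+ 2 - k%:R / n%:R.
    rewrite big_split/= -mulr_sumr sumr_const_nat subn0 -[_ *+ k]mulr_natl mulrN.
    by congr (_ * _ - _); apply: eq_bigr => i _; rewrite /Lf lamperti_vecE.
  have -> : \sum_(0 <= i < k) Lf n (lamperti_vec n i) w ^+ 2 =
      Q n k w + k%:R * lamperti_var H n.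
    rewrite /Q; have -> : \sum_(0 <= i < k) cov n (lamperti_vec n i) (lamperti_vec n i) =
       k%:R * lamperti_var H n.
      rewrite (eq_bigr (fun=> lamperti_var H n)).
        by rewrite sumr_const_nat subn0 -[LHS]mulr_natl.
      by move=> i _; exact: (lamperti_vec_var H01 fbm).
    by rewrite subrK.
  have -> : n%:R `^ (2 * H) = s n * n%:R.
    rewrite /s -{3}[n%:R](@powRr1 _ n%:R) ?ler0n// -powRD; last by rewrite (gt_eqF nR) implybT.
    by rewrite subrK.
  by field; rewrite gt_eqF.
apply: (le_trans (ler_normD _ _)).
have k0 : 0 <= k%:R / n%:R :> R by rewrite mulr_ge0 ?invr_ge0 ?ler0n.
have := ler_pM k0 (normr_ge0 _) kT asym.
rewrite [T * _]mulrC divfK ?gt_eqF// => h.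
by rewrite [X in _ + X]normrM (ger0_norm k0); move: sQ h; lra.
Unshelve. all: by end_near. Qed.

(** * Choice of the orders and conclusion *)

Lemma holder_on_le_order {R : realType} (beta beta' T : R) (f : R -> R) :
  0 < beta' -> beta' <= beta -> holder_on beta `[0, T] f ->
  exists2 C : R, 0 <= C & holder_with C beta' `[0, T] f.
Proof.
move=> b0 bb [C hC]; exists (`|C| * T `^ (beta - beta')).
  by rewrite mulr_ge0 ?powR_ge0.
move=> x y Dx Dy; have := hC x y Dx Dy; move: Dx Dy; rewrite /= !in_itv/=.
move=> /andP[x0 xT] /andP[y0 yT] /le_trans; apply.
have xyT : `|x - y| <= T by rewrite ler_norml; lra.
apply: (@le_trans _ _ (`|C| * `|x - y| `^ beta)).
  by rewrite ler_wpM2r ?powR_ge0// ler_norm.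
rewrite -mulrA ler_wpM2l//.
have -> : `|x - y| `^ beta = `|x - y| `^ (beta - beta') * `|x - y| `^ beta'.
  by rewrite -powRD subrK// (gt_eqF (lt_le_trans b0 bb)).
rewrite ler_wpM2r ?powR_ge0//; apply: ge0_ler_powR; rewrite ?nnegrE ?subr_ge0//.
by lra.
Qed.

(** The derivative of s |-> H exp(s/H) is exp(s/H), so the time change is Lipschitz on [0, T] with
    constant exp(T/H). *)
Lemma time_change_holder {R : realType} (H T alpha C : R) (B : R -> R) :
  0 < H -> 0 < T -> 0 < alpha -> 0 <= C ->
  holder_with C alpha `[0, time_change H T] B ->
  holder_with (C * expR (T / H) `^ alpha) alpha `[0, T] (fun s => B (time_change H s)).
Proof.
move=> H0 T0 a0 C0 hB.
have wlog_le x y : 0 <= x -> x <= y -> y <= T ->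
    `|B (time_change H x) - B (time_change H y)| <=
    C * expR (T / H) `^ alpha * `|x - y| `^ alpha.
  move=> x0 xy yT.
  have mono (a b : R) : a <= b -> time_change H a <= time_change H b.
    by move=> ab; rewrite /time_change ler_pM2l// ler_expR ler_pM2r ?invr_gt0.
  have tc0 a : 0 <= time_change H a by rewrite mulr_ge0 ?expR_ge0// ltW.
  apply: le_trans (hB _ _ _ _) _; rewrite /= ?in_itv/= ?tc0 ?mono//; first exact: le_trans yT.
  rewrite -mulrA ler_wpM2l// -powRM ?expR_ge0//.
  apply: ge0_ler_powR; rewrite ?nnegrE ?mulr_ge0 ?expR_ge0 ?(ltW a0)//.
  have hxy := mono _ _ xy.
  rewrite distrC ger0_norm ?subr_ge0// distrC ger0_norm ?subr_ge0//.
  rewrite /time_change -mulrBr.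
  have e1 := expR_ge1Dx (x / H - y / H).
  have e2 : expR (x / H) = expR (y / H) * expR (x / H - y / H) by rewrite -expRD addrC subrK.
  apply: (@le_trans _ _ (expR (y / H) * (y - x))); last first.
    by rewrite ler_wpM2r ?subr_ge0// ler_expR ler_pM2r ?invr_gt0.
  have -> : expR (y / H) * (y - x) = H * (expR (y / H) * (y / H - x / H)).
    by field; rewrite gt_eqF.
  rewrite ler_wpM2l ?(ltW H0)// e2 -{1}[expR (y / H)]mulr1 -mulrBr ler_wpM2l ?expR_ge0//.
  by lra.
move=> x y; rewrite /= !in_itv/= => /andP[x0 xT] /andP[y0 yT].
have [xy|yx] := leP x y; first exact: wlog_le.
by rewrite distrC (distrC x); apply: wlog_le => //; exact: ltW.
Qed.

Unset Implicit Arguments.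

Theorem theorem4 (R : realType) (d : measure_display) (Omega : measurableType d)
  (P : probability Omega R) (H T beta : R) (B u Z : R -> Omega -> R)
  (H01 : 0 < H < 1) (T0 : 0 < T)
  (fbmB : fractional_brownian_motion P H B)
  (beta_gt : 1 - H < beta)
  (u_process : stochastic_process `[0, T] u)
  (u_holder : \forall w \ae P, holder_on beta `[0, T] (fun t => u t w))
  (ZE : forall t w, 0 <= t <= T ->
    Z t w = stieltjes (fun s => u s w) (fun s => Y1 H B s w) 0 t) :
  \forall w \ae P,
    {uniform `[0, T],
      (fun (n : nat) (t : R) =>
        n%:R `^ (2 * H - 1) * realized_variation (fun s => Z s w) n t) @ \oo -->
      (fun t : R => \int[lebesgue_measure]_(s in `[0, t]) (`|u s w| ^+ 2))}.
Proof.
have /andP[H0 H1] := H01.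
(* The order is capped at 1, as [Z_local] requires beta <= 1; since H > 0 the capped order still
   exceeds 1 - H. *)
pose beta' := Num.min beta 1.
have b1 : beta' <= 1 by rewrite ge_min lexx orbT.
have bb : beta' <= beta by rewrite ge_min lexx.
have bH : 1 - H < beta' by rewrite lt_min beta_gt; lra.
have b0 : 0 < beta' by lra.
(* The loss in the order of the paths of B. The first entry keeps alpha positive and the second
   keeps alpha + beta' above 1; as H < 1, also 2 eta <= H + beta' - 1 < beta', which is the
   condition 2H < 2 alpha + beta'. *)
pose eta := Num.min H (H + beta' - 1) / 2.
have eH : eta <= H / 2 by rewrite ler_pM2r ?invr_gt0// ge_min lexx.
have eb : eta <= (H + beta' - 1) / 2 by rewrite ler_pM2r ?invr_gt0// ge_min lexx orbT.
have e0 : 0 < eta by rewrite divr_gt0// lt_min H0; lra.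
pose alpha := H - eta.
have a0 : 0 < alpha by rewrite /alpha; lra.
have aH : alpha < H by rewrite /alpha; lra.
have ab : 1 < alpha + beta' by rewrite /alpha; lra.
have abH : 2 * H < 2 * alpha + beta' by rewrite /alpha; lra.
have A0 : 0 < time_change H T by rewrite mulr_gt0 ?expR_gt0.
apply: filterS3 u_holder (fbm_holder H01 fbmB a0 aH A0)
  (fbm_quadratic_variation H01 fbmB T0) => w hu [CB CB0 hB] hQV.
have [Cu Cu0 {}hu] := holder_on_le_order b0 bb hu.
have hW := time_change_holder H0 T0 a0 CB0 hB.
have CW0 : 0 <= CB * expR (T / H) `^ alpha by rewrite mulr_ge0 ?powR_ge0.
have key := pathwise_variation T0 a0 b0 b1 ab abH Cu0 CW0 hu hW (fun t => ZE t w) hQV.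
move=> S /uniform_nbhs[E [entE EsubS]].
move: entE; rewrite -entourage_ballE => -[e /= epos eE].
have := key e epos; apply: filterS => n hn; apply: EsubS => t /=.
rewrite in_itv/= => /hn ht; apply: eE.
by rewrite /= /ball/= distrC.
Qed.
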